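(* Fix $z\in\mathbb{C}$ with $|z|>1$. For each $N\ge 1$ let $G=G_N$ be an $N\times N$ complex Ginibre matrix (i.i.d. $\mathcal{N}_{\mathbb{C}}(0,1/N)$ entries) with eigenvalues $\lambda_1,\dots,\lambda_N$, conditioned on $\{\lambda_1=z\}$, and let $\mathscr{O}_{11}$ be the diagonal overlap of $G_N$ associated with the eigenvalue $\lambda_1$ (all these conditioned objects, for $N\geq 1$, being defined on a common probability space). Then $$\mathscr{O}_{11}\xrightarrow[N\to\infty]{\text{a.s.}}\frac{|z|^2}{|z|^2-1}.$$
   Context: Ginibre matrix: $G=(G_{ij})_{1\le i,j\le N}$ with i.i.d. entries $G_{ij}\sim\mathcal{N}_{\mathbb{C}}(0,1/N)$, i.e. centered circularly symmetric complex Gaussians with $\mathbb{E}|G_{ij}|^2=1/N$. Overlaps: for a matrix with simple spectrum $\{\lambda_1,\dots,\lambda_N\}$, let $R_i$ be right eigenvectors (column vectors with $GR_i=\lambda_iR_i$) and $L_i$ left eigenvectors ($L_i^*G=\lambda_iL_i^*$), normalized by the bi-orthogonality condition $\langle L_i|R_j\rangle=\delta_{ij}$, where $\langle L|R\rangle=L^*R$. The matrix of overlaps is $\mathscr{O}_{ij}=\langle L_i|L_j\rangle\langle R_j|R_i\rangle$; in particular $\mathscr{O}_{ii}=\|L_i\|^2\|R_i\|^2$, which does not depend on the choice of the normalized eigenvectors. Conditioning: the eigenvalues are labelled exchangeably, so that $(\lambda_1,\dots,\lambda_N)$ has joint density on $\mathbb{C}^N$ proportional to $\prod_{1\le i<j\le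 N}|z_i-z_j|^2e^{-N\sum_{i=1}^N|z_i|^2}$. Conditioning on $\{\lambda_1=z\}$ means the following (the usual disintegration): $(\lambda_2,\dots,\lambda_N)$ has density on $\mathbb{C}^{N-1}$ proportional to $\prod_{k=2}^N|z-z_k|^2\prod_{2\le i<j\le N}|z_i-z_j|^2e^{-N\sum_{i=2}^N|z_i|^2}$, and the conditioned matrix is unitarily conjugate (Schur form) to an upper triangular matrix with diagonal $(z,\lambda_2,\dots,\lambda_N)$ and strictly upper triangular entries i.i.d. $\mathcal{N}_{\mathbb{C}}(0,1/N)$, independent of $(\lambda_2,\dots,\lambda_N)$. Overlaps are invariant under unitary conjugation. No particular joint law across different values of $N$ is prescribed. *)

(* Defs.v *)
From HB Require Import structures.
From mathcomp Require Import all_boot all_order all_algebra spectral.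
From mathcomp Require Import complex.
From mathcomp Require Import all_classical all_reals all_analysis.

Set Implicit Arguments.
Unset Strict Implicit.
Unset Printing Implicit Defensive.

Import Order.TTheory GRing.Theory Num.Theory.
Import numFieldNormedType.Exports.
Import Normc.

Local Open Scope classical_set_scope.
Local Open Scope ring_scope.
Local Open Scope complex_scope.
Local Open Scope sesquilinear_scope.

Definition complex_of_pair {R : realType} (p : R * R) : R[i] := p.1 +i* p.2.
Definition pair_of_complex {R : realType} (c : R[i]) : R * R :=
  (complex.Re c, complex.Im c).

Definition complex_display : measure_display.
Proof. exact: default_measure_display. Qed.

(* The Borel sigma-algebra of C, transported from R * R. *)
Section measurable_complex.
Context {R : realType}.

Let G : set (set R[i]) :=
  preimage_set_system setT (@pair_of_complex R) measurable.

Let sG : sigma_algebra setT G.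
Proof.
apply: sigma_algebra_preimage; split=> //.
- by move=> A mA; rewrite setTD; exact: measurableC.
- by move=> F mF; exact: bigcupT_measurable.
Qed.

Let G0 : G set0. Proof. by have [] := sG. Qed.

Let GC A : G A -> G (~` A).
Proof. by have [_ + _] := sG => /[apply]; rewrite setTD. Qed.

Let GU (F : (set R[i])^nat) : (forall i, G (F i)) -> G (\bigcup_i F i).
Proof. by have [_ _] := sG; apply. Qed.

HB.instance Definition _ := isPointed.Build R[i] 0.
HB.instance Definition _ := @isMeasurable.Build complex_display R[i] G G0 GC GU.

End measurable_complex.

Lemma measurable_complex_of_pair (R : realType) :
  measurable_fun setT (@complex_of_pair R).
Proof.
move=> _ _ [B mB <-]; rewrite !setTI.
by rewrite (_ : _ @^-1` _ = B)//; apply/seteqP; split=> -[].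
Qed.

Lemma measurable_pair_of_complex (R : realType) :
  measurable_fun setT (@pair_of_complex R).
Proof. by move=> _ B mB; exists B. Qed.

Definition complex_lebesgue (R : realType) : set R[i] -> \bar R :=
  pushforward (@lebesgue_measure R \x @lebesgue_measure R)%E complex_of_pair.

Section tuple_measure.
Context {d} {T : measurableType d} {R : realType}.
Variable mu : set T -> \bar R.

(* n-fold product of mu (for sigma-finite mu). *)
Fixpoint tuple_measure (n : nat) : set (n.-tuple T) -> \bar R :=
  match n with
  | 0 => dirac ([tuple] : 0.-tuple T)
  | m.+1 => pushforward (mu \x @tuple_measure m)%E
              (fun p : T * m.-tuple T => [tuple of p.1 :: p.2])
  end.

End tuple_measure.

Arguments tuple_measure {d T R} mu n A.

(* N_C(0, v): real and imaginary parts are independent N(0, v / 2), so that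
   the second absolute moment is v (normal_prob takes a standard deviation). *)
Definition complex_normal (R : realType) (v : R) : set R[i] -> \bar R :=
  pushforward (normal_prob 0 (Num.sqrt (v / 2)) \x
               normal_prob 0 (Num.sqrt (v / 2)))%E complex_of_pair.

Definition has_law d d' (T : measurableType d) (T' : measurableType d')
    (R : realType) (P : probability T R) (X : {RV P >-> T'})
    (mu : set T' -> \bar R) : Prop :=
  forall A, measurable A -> distribution P X A = mu A.

Section overlaps.
Context {R : realType} {n : nat}.
Implicit Types (G V W : 'M[R[i]]_n) (lam : n.-tuple R[i]).

Definition braket (u v : 'cV[R[i]]_n) : R[i] := (u^t* *m v) 0 0.

(* The left (resp. right) eigenvectors L_i (resp. R_i) are the columns of V
   (resp. of W). *)
Definition biorthogonal_eigenvectors G lam V W : Prop :=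
  [/\ forall i, G *m col i W = tnth lam i *: col i W,
      forall i, (col i V)^t* *m G = tnth lam i *: (col i V)^t*
    & forall i j, braket (col i V) (col j W) = (i == j)%:R].

Definition overlap V W (i j : 'I_n) : R[i] :=
  braket (col i V) (col j V) * braket (col j W) (col i W).

End overlaps.

Section conditioned_ginibre.
Context {R : realType}.

(* Unnormalized density of (lambda_2, ..., lambda_N) given lambda_1 = z,
   where N = n + 1; the tuple t is indexed from 0. *)
Definition eigen_weight (n : nat) (z : R[i]) (t : n.-tuple R[i]) : R :=
  (\prod_(k < n) normc (z - tnth t k) ^+ 2) *
  (\prod_(i < n) \prod_(j < n | (i < j)%N)
     normc (tnth t i - tnth t j) ^+ 2) *
  expR (- (n.+1%:R * \sum_(k < n) normc (tnth t k) ^+ 2)).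

Definition schur_mx (n : nat) (z : R[i]) (t : n.-tuple R[i])
    (T : 'I_n.+1 -> 'I_n.+1 -> R[i]) : 'M[R[i]]_n.+1 :=
  \matrix_(i, j) if (i < j)%N then T i j
                 else if i == j then tnth [tuple of z :: t] i else 0.

Context d (Omega : measurableType d) (P : probability Omega R).

(* Mutual independence of the vector lam and of the T i j, i < j; taking
   B i j = setT gives the product rule for every subfamily. *)
Definition schur_independent (n : nat) (lam : {RV P >-> n.-tuple R[i]})
    (T : 'I_n.+1 -> 'I_n.+1 -> {RV P >-> R[i]}) : Prop :=
  forall (A : set (n.-tuple R[i])) (B : 'I_n.+1 -> 'I_n.+1 -> set R[i]),
    measurable A -> (forall i j, measurable (B i j)) ->
    P (lam @^-1` A `&`
       [set w | forall i j : 'I_n.+1, (i < j)%N -> B i j (T i j w)]) =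
    (P (lam @^-1` A) *
     \prod_(i < n.+1) \prod_(j < n.+1 | (i < j)%N) P (T i j @^-1` B i j))%E.

(* G is a Ginibre matrix of size n + 1 conditioned on {lambda_1 = z}, with
   remaining eigenvalues lam.  Only the entries T i j with i < j matter. *)
Definition conditioned_ginibre (n : nat) (z : R[i])
    (lam : {RV P >-> n.-tuple R[i]}) (G : Omega -> 'M[R[i]]_n.+1) : Prop :=
  (exists c : R, has_law lam (fun A =>
     \int[tuple_measure (@complex_lebesgue R) n]_(t in A)
       (c * eigen_weight z t)%:E)%E) /\
  exists T : 'I_n.+1 -> 'I_n.+1 -> {RV P >-> R[i]},
    [/\ forall i j : 'I_n.+1, (i < j)%N ->
          has_law (T i j) (complex_normal n.+1%:R^-1),
        schur_independent lam T
      & {ae P, forall w, exists2 U : 'M[R[i]]_n.+1, U \is unitarymx &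
          G w = U *m schur_mx z (lam w) (fun i j => T i j w) *m U^t*}].

End conditioned_ginibre.

(* Main.v *)
Require Import Defs.
From HB Require Import structures.
From mathcomp Require Import all_boot all_order all_algebra spectral.
From mathcomp Require Import complex.
From mathcomp Require Import all_classical all_reals all_analysis.
From mathcomp Require Import measurable_realfun zify ring lra.

(** In Schur form the right eigenvector for [z] is a multiple of the first basis
    vector, so the overlap is the squared norm of the left eigenvector with first
    entry [1] ([overlap_schur]). This vector is computed column by column, and
    column [j] multiplies the squared norm of the part already known by
    [1 + x_j] ([sqnorm_left_vec]). A linear form in independent complex Gaussians
    is Gaussian; hence, given the eigenvalues and the preceding columns, [x_j] is
    exponential of mean [1 / (N |z - lambda_j|^2)]. Integrating out the
    triangular entries therefore turns a moment of the overlap into the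
    expectation of a product of one-point functions of the eigenvalues
    ([integral_increment_prod], [separated_moment_le]).

    Let [f >= 0] with [|z - w|^2 f(w) <= W(w)], where
    [W(w) = |z - w|^2 + k1 + k2 |w|^(2m)]. The expectation of the product of the
    [f(lambda_j)] is at most a ratio of two integrals of a squared Vandermonde
    determinant. Such an integral is [n!] times the determinant of a Gram matrix;
    in the polynomials orthonormal for the weight [|z - w|^2] the ratio is
    [det A], and [det A <= exp (tr A - n)] ([integral_slater_le]). The orthogonal
    polynomials satisfy a two-term recursion, which makes the trace explicit
    ([tilted_vandermonde]). For [x = |z|^2 > 1] and [k1 = s / N] the exponent is
    [s] times a Riemann sum for [ln (x / (x - 1))] ([mean_exponent_le],
    [mean_exponent_ge]).

    With [f] coming from the power [s] of the overlap, or from a polynomial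
    majorant of its power [- s], this bounds both moments on the event that no
    eigenvalue is within a fixed distance of [z]
    ([overlap_upper_moment], [overlap_lower_moment]). The term in [k2] controls
    the complementary event: near [z] one has [|w| > 1], so [|w|^(2m)] is
    exponentially large in [m] there, while the square norms of [w^m] times the
    orthonormal polynomials stay bounded for [m] of order [sqrt N]
    ([unseparated_le]). Taking [s = m] of order [sqrt N], Markov's inequality
    bounds the probability of a relative deviation [eps] from [x / (x - 1)] by a
    multiple of [1 / N^2] ([deviation_le]), and the Borel-Cantelli lemma
    concludes. *)

Import Order.TTheory GRing.Theory Num.Theory.
Import numFieldNormedType.Exports.

Local Open Scope classical_set_scope.
Local Open Scope ring_scope.
Local Open Scope complex_scope.

Set Implicit Arguments.
Unset Strict Implicit.
Unset Printing Implicit Defensive.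

(** * Densities and Gaussian moments *)

Lemma measurable_set_of_bool d (T : measurableType d) (b : T -> bool) :
  measurable_fun setT b -> measurable [set x | b x].
Proof.
move=> mb; rewrite [X in measurable X](_ : _ = setT `&` b @^-1` [set true]).
  exact: mb.
by rewrite setTI; apply/seteqP; split.
Qed.

Section density.
Local Open Scope ereal_scope.
Context d (T : measurableType d) (R : realType).
Variables (mu : {sigma_finite_measure set T -> \bar R}).
Variables (nu : {finite_measure set T -> \bar R}) (g : T -> R).
Hypotheses (mg : measurable_fun setT g) (g0 : forall x, (0 <= g x)%R).
Hypothesis nuE : forall A, measurable A -> nu A = \int[mu]_(x in A) (g x)%:E.
Import Radon_Nikodym_SigmaFinite.

(** Almost everywhere, a density is the Radon-Nikodym derivative. *)
Lemma ge0_integral_density (f : T -> \bar R) : measurable_fun setT f ->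
  (forall x, 0 <= f x) -> \int[nu]_x f x = \int[mu]_x (f x * (g x)%:E).
Proof.
move=> mf f0.
have mgE : measurable_fun setT (EFin \o g) by exact/measurable_EFinP.
have dom : nu `<< mu.
  apply/null_content_dominatesP => A mA muA.
  by rewrite nuE// null_set_integral//; exact: measurable_funTS.
have fi := f_integrable dom.
rewrite -(change_of_variables dom f0 measurableT mf).
apply: ae_eq_integral => //.
- by apply: emeasurable_funM => //; exact: measurable_int fi.
- exact: emeasurable_funM.
have gE : ae_eq mu setT (Radon_Nikodym_SigmaFinite.f nu mu) (EFin \o g).
  by apply: integral_ae_eq => // E _ mE; rewrite -f_integral// nuE.
by apply: filterS gE => x /= h xT; rewrite h.
Qed.

End density.

(** [(k - 1)!!] for even [k] and [0] for odd [k]: the [k]-th moment of the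
    standard Gaussian. *)
Fixpoint dfact (k : nat) : nat :=
  match k with
  | 0 => 1
  | 1 => 0
  | k'.+2 => k'.+1 * dfact k'
  end.

Lemma dfact_odd k : odd k -> dfact k = 0%N.
Proof.
have [n] := ubnP k; elim: n k => // n IH [|[|k]]//= kn; rewrite negbK => ok.
by rewrite IH ?muln0// -ltnS (leq_trans _ kn).
Qed.

Section gaussian_moments.
Context {R : realType}.
Variable s : R.
Hypothesis s0 : 0 < s.
Local Notation mu := (@lebesgue_measure R).
Local Notation rho := (normal_pdf 0 s).

Let sne0 : s != 0. Proof. by rewrite gt_eqF. Qed.

Let rhoE x : rho x = normal_peak s * expR (- x ^+ 2 / (s ^+ 2 *+ 2)).
Proof. by rewrite normal_pdfE// /normal_fun subr0. Qed.

Let is_derive_rho (x : R^o) :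
  is_derive x 1 (rho : R^o -> R^o) (- (x / s ^+ 2) * rho x).
Proof.
rewrite (_ : rho = fun x => normal_peak s * expR (- x ^+ 2 / (s ^+ 2 *+ 2))); last first.
  by apply/funext => y; rewrite rhoE.
apply: is_derive_eq.
rewrite scaler0 add0r /GRing.scale/= !mulr1.
have s20 : s ^+ 2 != 0 by rewrite expf_neq0.
by field.
Qed.

Let continuous_rho : continuous rho.
Proof. exact: continuous_normal_pdf. Qed.

Let cvgy_rho : rho x @[x --> +oo%R] --> (0 : R).
Proof.
rewrite (_ : rho = fun x => normal_peak s * expR (- (x ^+ 2 / (s ^+ 2 *+ 2)))); last first.
  by apply/funext => y; rewrite rhoE mulNr.
rewrite -[X in _ --> X](mulr0 (normal_peak s)); apply: cvgMr.
apply: (cvg_comp (fun x => x ^+ 2 / (s ^+ 2 *+ 2)) (fun x => expR (- x))); last exact: cvgr_expR.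
apply: gt0_cvgMly; last exact: cvgr_expr2.
by rewrite invr_gt0 pmulrn_lgt0// exprn_gt0.
Qed.

Let integral_tail (a : R) : 0 <= a ->
  (\int[mu]_(x in `[a, +oo[) (x * rho x)%:E = (s ^+ 2 * rho a)%:E)%E.
Proof.
move=> a0.
rewrite (@ge0_continuous_FTC2y _ _ (fun x => - (s ^+ 2 * rho x)) a 0).
- by rewrite -EFinB sub0r opprK.
- by move=> x ax; rewrite mulr_ge0 ?normal_pdf_ge0// (le_trans a0).
- by apply: continuous_subspaceT => x; apply: cvgM; [exact: cvg_id|exact: continuous_rho].
- have e : - (s ^+ 2 * 0) = 0 :> R by rewrite mulr0 oppr0.
  rewrite -[X in _ --> X]e.
  by apply: cvgN; apply: cvgMr; exact: cvgy_rho.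
- by move=> x _; have := is_derive_rho x => h; apply: ex_derive.
- apply: cvg_at_right_filter; apply: cvgN; apply: cvgMr; exact: continuous_rho.
- move=> x _; rewrite derive1E; have := is_derive_rho x => h.
  rewrite derive_val.
  rewrite ?scaler0 ?addr0 ?add0r /GRing.scale/=.
  have s20 : s ^+ 2 != 0 by rewrite expf_neq0.
  by field.
Qed.

Let integral_pow (t : R) k : 0 <= t ->
  (\int[mu]_(x in `[0%R, t]) (k.+1%:R * x ^+ k)%:E = (t ^+ k.+1)%:E)%E.
Proof.
rewrite le_eqVlt => /predU1P[<-|t0].
  rewrite set_itv1 integral_set1 expr0n//.
rewrite (@continuous_FTC2 _ _ (fun x => x ^+ k.+1) _ _ t0).
- by rewrite expr0n/= sube0.
- apply: continuous_subspaceT => x; apply: cvgMr; exact: exprn_continuous.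
- split.
  + by move=> x _; exact: exprn_derivable.
  + by apply: cvg_at_right_filter; exact: exprn_continuous.
  + by apply: cvg_at_left_filter; exact: exprn_continuous.
- by move=> x _; rewrite exp_derive1.
Qed.

(** Half-line moments: their integrands have a sign, so they can be computed
    by Tonelli before integrability is known. *)
Let H k := (\int[mu]_(x in `[0%R, +oo[) (x ^+ k * rho x)%:E)%E.

Let mH k : measurable_fun setT (fun x : R => x ^+ k * rho x).
Proof.
by apply: measurable_funM; [exact: exprn_measurable|exact: measurable_normal_pdf].
Qed.

(** Integration by parts in Tonelli form: both sides are the integral of
    [(k + 1) x^k y rho(y)] over [0 <= x <= y], since [y rho(y)] is the
    derivative of [- s^2 rho]. *)
Let HS k : (H k.+2 = (s ^+ 2 * k.+1%:R)%:E * H k)%E.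
Proof.
pose f (p : measurableTypeR R * measurableTypeR R) : \bar R :=
  ((k.+1%:R * `|p.1| ^+ k) * (`|p.2| * rho p.2) *
    (\1_[set q : measurableTypeR R * measurableTypeR R | 0 <= q.1 <= q.2] p))%:E.
have mD : measurable [set q : measurableTypeR R * measurableTypeR R | 0 <= q.1 <= q.2].
  apply: measurable_set_of_bool; apply: measurable_and.
    by apply: measurable_fun_ler => //; exact: measurable_fst.
  by apply: measurable_fun_ler; [exact: measurable_fst|exact: measurable_snd].
have mf : measurable_fun setT f.
  apply/measurable_EFinP; apply: measurable_funM; last exact: measurable_indic.
  apply: measurable_funM.
    apply: measurable_funM => //; apply: measurable_funX.
    by apply: measurableT_comp => //; exact: measurable_fst.
  apply: measurable_funM.
    by apply: measurableT_comp => //; exact: measurable_snd.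
  by apply: measurableT_comp; [exact: measurable_normal_pdf|exact: measurable_snd].
have f0 p : (0 <= f p)%E.
  rewrite lee_fin !mulr_ge0 ?exprn_ge0 ?normal_pdf_ge0//.
have := fubini_tonelli f mf f0.
move=> /(_ mu mu).
have -> : (\int[mu]_x \int[mu]_y f (x, y) = (s ^+ 2 * k.+1%:R)%:E * H k)%E.
  rewrite -ge0_integralZl//; last 3 first.
  - by apply/measurable_EFinP/measurable_funTS; exact: mH.
  - move=> x; rewrite /= in_itv/= andbT => x0.
    by rewrite lee_fin mulr_ge0 ?exprn_ge0 ?normal_pdf_ge0.
  - by rewrite lee_fin mulr_ge0// sqr_ge0.
  rewrite [RHS]integral_mkcond; apply: eq_integral => x _.
  rewrite patchE; case: ifPn => [|].
    rewrite inE/= in_itv/= andbT => x0.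
    transitivity (\int[mu]_(y in `[x, +oo[) ((k.+1%:R * x ^+ k)%:E * (y * rho y)%:E))%E.
      rewrite [RHS]integral_mkcond; apply: eq_integral => y _.
      rewrite patchE /f indicE; case: ifPn => [|].
        rewrite inE/= in_itv/= andbT => xy.
        rewrite mem_set/= ?x0// mulr1 -EFinM ger0_norm// ger0_norm//.
        exact: le_trans xy.
      rewrite notin_setE/= in_itv/= andbT => xy.
      by rewrite memNset ?mulr0//= => /andP[].
    rewrite ge0_integralZl//.
    - by rewrite integral_tail// -!EFinM; congr EFin; ring.
    - by apply/measurable_EFinP/measurable_funTS; have := @mH 1; under eq_fun do rewrite expr1.
    - move=> y; rewrite /= in_itv/= andbT => y0.
      by rewrite lee_fin mulr_ge0 ?normal_pdf_ge0// (le_trans x0).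
    - by rewrite lee_fin mulr_ge0 ?exprn_ge0.
  rewrite notin_setE/= in_itv/= andbT => x0.
  apply: integral0_eq => y _.
  by rewrite /f indicE memNset ?mulr0//= => /andP[].
move=> ->.
rewrite /H integral_mkcond; apply: eq_integral => y _.
rewrite patchE; case: ifPn => [|].
  rewrite inE/= in_itv/= andbT => y0.
  transitivity (\int[mu]_(x in `[0%R, y]) ((y * rho y)%:E * (k.+1%:R * x ^+ k)%:E))%E; last first.
    rewrite [LHS]integral_mkcond; apply: eq_integral => x _.
    rewrite patchE /f indicE; case: ifPn => [|].
      rewrite inE/= in_itv/= => /andP[x0 xy].
      rewrite mem_set/= ?x0// mulr1 -EFinM ger0_norm// ger0_norm// mulrC//.
    rewrite notin_setE/= in_itv/= => xy.
    by rewrite memNset ?mulr0.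
  rewrite ge0_integralZl//.
  - by rewrite integral_pow// -!EFinM; congr EFin; rewrite !exprS; ring.
  - by apply/measurable_EFinP/measurable_funTS/measurable_funM.
  - move=> x; rewrite /= in_itv/= => /andP[x0 _].
    by rewrite lee_fin mulr_ge0 ?exprn_ge0.
  - by rewrite lee_fin mulr_ge0 ?normal_pdf_ge0.
rewrite notin_setE/= in_itv/= andbT => y0.
symmetry; apply: integral0_eq => x _.
by rewrite /f indicE memNset ?mulr0//= => /andP[x0] /(le_trans x0).
Qed.

(** Reduces moments over the line to half-line moments. *)
Let fold_integral (g : R -> R) : continuous g -> (forall x, 0 <= g x) ->
  (\int[mu]_x (g x)%:E =
   \int[mu]_(x in `[0%R, +oo[) (g x)%:E + \int[mu]_(x in `[0%R, +oo[) (g (- x))%:E)%E.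
Proof.
move=> cg g0.
have mg : measurable_fun [set: R] g by exact: continuous_measurable_fun.
rewrite (_ : [set: _] = `]-oo, 0%R[ `|` `[0%R, +oo[); last first.
  by rewrite -setCitvr setUC setUv.
rewrite ge0_integral_setU//=; last 3 first.
- exact/measurable_EFinP/measurable_funTS.
- by move=> x _; rewrite lee_fin.
- by apply/disj_setPS => x []/=; rewrite !in_itv/= andbT => /lt_geF ->.
rewrite addeC; congr (_ + _)%E.
rewrite integral_itv_bndo_bndc; last exact/measurable_EFinP/measurable_funTS.
rewrite -{1}oppr0 ge0_integration_by_substitutionNy//.
exact: continuous_subspaceT.
Qed.

Let H_ge0 k : (0 <= H k)%E.
Proof.
apply: integral_ge0 => x; rewrite /= in_itv/= andbT => x0.
by rewrite lee_fin mulr_ge0 ?exprn_ge0 ?normal_pdf_ge0.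
Qed.

Let H_even k : ~~ odd k -> H k = ((s ^+ k * (dfact k)%:R) / 2)%:E.
Proof.
have [n] := ubnP k; elim: n k => // n IH [|[|k]]// kn.
  move=> _; have := fold_integral continuous_rho (normal_pdf_ge0 0 s).
  rewrite integral_normal_pdf.
  have -> : (\int[mu]_(x in `[0%R, +oo[) (rho x)%:E = H 0%N)%E.
    by apply: eq_integral => x _; rewrite expr0 mul1r.
  have -> : (\int[mu]_(x in `[0%R, +oo[) (rho (- x))%:E = H 0%N)%E.
    by apply: eq_integral => x _; rewrite !rhoE sqrrN expr0 mul1r.
  move=> e.
  have : H 0%N \is a fin_num.
    rewrite ge0_fin_numE ?H_ge0//.
    by rewrite ltey; apply/eqP => h; move: e; rewrite h.
  move=> /fineK h; move: e; rewrite -h -EFinD => -[e].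
  by congr EFin; rewrite /= expr0; lra.
rewrite /= negbK => ok; rewrite HS IH//; last by rewrite -ltnS (leq_trans _ kn).
by rewrite -EFinM natrM !exprS; by congr EFin; field.
Qed.

Let H_fin k : H k \is a fin_num.
Proof.
have [n] := ubnP k; elim: n k => // n IH [|[|k]]// kn.
- by rewrite H_even.
- rewrite /H; under eq_integral do rewrite expr1.
  by rewrite integral_tail.
- by rewrite HS fin_numM// IH// -ltnS (leq_trans _ kn).
Qed.

Let measurable_normX k : measurable_fun setT (fun x : R => `|x| ^+ k).
Proof. by apply: measurable_funX; exact: normr_measurable. Qed.

Let continuous_normX k : continuous (fun x : R => `|x| ^+ k).
Proof.
move=> x; apply: (@continuous_comp _ _ _ (fun x : R => `|x|) (fun x : R => x ^+ k)).
  exact: (@norm_continuous _ R^o x).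
exact: exprn_continuous.
Qed.

Let abs_moment k :
  (\int[normal_prob 0 s]_x (`|x| ^+ k)%:E = 2%:E * H k)%E.
Proof.
rewrite (@ge0_integral_density _ _ _ mu (normal_prob 0 s) rho)//; last 2 first.
- exact: measurable_normal_pdf.
- by apply/measurable_EFinP; exact: measurable_normX.
under eq_integral do rewrite -EFinM.
rewrite fold_integral.
- rewrite mule_natl mule2n; congr (_ + _)%E; apply: eq_integral => x;
    rewrite inE/= in_itv/= andbT => x0; first by rewrite ger0_norm.
  by rewrite normrN ger0_norm// !rhoE sqrrN.
- move=> x; apply: cvgM; last exact: continuous_rho.
  exact: continuous_normX.
- by move=> x; rewrite mulr_ge0 ?normal_pdf_ge0.
Qed.

Lemma integrable_normal_moment k :
  (normal_prob 0 s).-integrable setT (fun x => (x ^+ k)%:E).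
Proof.
apply/integrableP; split; first by apply/measurable_EFinP; exact: exprn_measurable.
under eq_integral do rewrite /= normrX.
by rewrite abs_moment -ge0_fin_numE ?mule_ge0 ?fin_numM// -[H k]fineK// lee_fin ?mulr_ge0//.
Qed.

Lemma integral_normal_moment k :
  (\int[normal_prob 0 s]_x (x ^+ k)%:E = (s ^+ k * (dfact k)%:R)%:E)%E.
Proof.
have [ok|ek] := boolP (odd k); last first.
  under eq_integral => x _.
    rewrite -[x ^+ k]ger0_norm; last by rewrite exprn_even_ge0.
    rewrite normrX; over.
  rewrite abs_moment H_even// -EFinM; by congr EFin; field.
rewrite dfact_odd// mulr0.
have iabs : (normal_prob 0 s).-integrable setT (fun x => (`|x| ^+ k)%:E).
  rewrite (_ : (fun x => _) = abse \o (fun x => (x ^+ k)%:E)); last first.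
    by apply/funext => x/=; rewrite normrX.
  by apply: integrable_abse; exact: integrable_normal_moment.
(* Adding the absolute moment makes the integrand nonnegative. *)
suff : (\int[normal_prob 0 s]_x (`|x| ^+ k + x ^+ k)%:E = 2%:E * H k)%E.
  under eq_integral do rewrite EFinD.
  rewrite integralD//; last exact: integrable_normal_moment.
  rewrite abs_moment => e.
  have f : (\int[normal_prob 0 s]_x (x ^+ k)%:E)%E \is a fin_num.
    by apply: integrable_fin_num => //; exact: integrable_normal_moment.
  move: e; rewrite -(fineK f) -(fineK (H_fin k)) -!EFinM -EFinD => -[e].
  by congr EFin; lra.
have nn x : 0 <= `|x| ^+ k + x ^+ k :> R.
  have : - (x ^+ k) <= `|x ^+ k| by rewrite -normrN ler_norm.
  by rewrite normrX; lra.
rewrite (@ge0_integral_density _ _ _ mu (normal_prob 0 s) rho)//; last 2 first.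
- exact: measurable_normal_pdf.
- apply/measurable_EFinP; apply: measurable_funD; last exact: exprn_measurable.
  exact: measurable_normX.
under eq_integral do rewrite -EFinM.
rewrite fold_integral.
- rewrite [X in (_ + X)%E]integral0_eq ?adde0; last first.
    move=> x; rewrite /= in_itv/= andbT => x0.
    by rewrite normrN ger0_norm// exprNn -signr_odd ok expr1 mulN1r subrr mul0r.
  rewrite -ge0_integralZl//.
  - apply: eq_integral => x; rewrite inE/= in_itv/= andbT => x0.
    by rewrite ger0_norm// -EFinM; congr EFin; ring.
  - by apply/measurable_EFinP/measurable_funTS; exact: mH.
  - move=> x; rewrite /= in_itv/= andbT => x0.
    by rewrite lee_fin mulr_ge0 ?exprn_ge0 ?normal_pdf_ge0.
- move=> x; apply: cvgM; last exact: continuous_rho.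
  apply: cvgD; last exact: exprn_continuous.
  exact: continuous_normX.
- by move=> x; rewrite mulr_ge0 ?normal_pdf_ge0.
Qed.

End gaussian_moments.

(** * Formal Gaussian expectation and its Wick formula *)

(** Gaussian expectation of a formal polynomial: [X^k] has moment
    [t^(k/2) (k-1)!!] for [k] even and [0] for [k] odd. *)
Definition gauss_expect (A : comNzRingType) (t : A) (p : {poly A}) : A :=
  \sum_(k < size p) p`_k * (t ^+ k./2 *+ dfact k).

Section gauss_expect.
Variable (A : comNzRingType) (t : A).
Local Notation E := (gauss_expect t).

Lemma gauss_expect_widen n (p : {poly A}) : (size p <= n)%N ->
  E p = \sum_(k < n) p`_k * (t ^+ k./2 *+ dfact k).
Proof.
move=> pn; rewrite /gauss_expect (big_ord_widen _ (fun k => p`_k * (t ^+ k./2 *+ dfact k)) pn).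
rewrite big_mkcond/=; apply: eq_bigr => i _; case: ltnP => // pi.
by rewrite nth_default// mul0r.
Qed.

Lemma gauss_expectD : {morph E : p q / p + q}.
Proof.
move=> p q; pose n := maxn (size p) (size q).
rewrite (@gauss_expect_widen n) ?size_polyD// (@gauss_expect_widen n p) ?leq_maxl//.
rewrite (@gauss_expect_widen n q) ?leq_maxr// -big_split/=.
by apply: eq_bigr => i _; rewrite coefD mulrDl.
Qed.

Lemma gauss_expectZ c p : E (c *: p) = c * E p.
Proof.
rewrite (@gauss_expect_widen (size p)) ?size_scale_leq// mulr_sumr.
by apply: eq_bigr => i _; rewrite coefZ mulrA.
Qed.

Lemma gauss_expect0 : E 0 = 0.
Proof. by rewrite -(scale0r (0 : {poly A})) gauss_expectZ mul0r. Qed.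

Lemma gauss_expect_sum (I : Type) (r : seq I) (P : pred I) (F : I -> {poly A}) :
  E (\sum_(i <- r | P i) F i) = \sum_(i <- r | P i) E (F i).
Proof. exact: (big_morph E gauss_expectD gauss_expect0). Qed.

Lemma gauss_expectXn k : E 'X^k = t ^+ k./2 *+ dfact k.
Proof.
rewrite (@gauss_expect_widen k.+1) ?size_polyXn// big_ord_recr/= big1 ?add0r.
  by rewrite coefXn eqxx mul1r.
by move=> i _; rewrite coefXn ltn_eqF// mul0r.
Qed.

Lemma gauss_expect1 : E 1 = 1.
Proof. by rewrite -(expr0 'X) gauss_expectXn/= expr0. Qed.

(** Gaussian integration by parts. *)
Lemma gauss_expectX p : E ('X * p) = t * E p^`().
Proof.
elim/poly_ind: p => [|p c _]; first by rewrite mulr0 deriv0 gauss_expect0 mulr0.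
have Ep (q : {poly A}) : q = \sum_(i < size q) q`_i *: 'X^i.
  by rewrite -poly_def coefK.
rewrite {2}[_ + _]Ep [_ + _ in LHS]Ep; set q := _ + _.
rewrite mulr_sumr !raddf_sum/= !gauss_expect_sum mulr_sumr.
apply: eq_bigr => i _; rewrite -scalerAr -exprS derivZ !gauss_expectZ derivXn.
rewrite mulrCA; congr (_ * _); rewrite gauss_expectXn.
case: i => -[|i] _ /=; first by rewrite mulr0n gauss_expect0 mulr0.
rewrite -scaler_nat gauss_expectZ gauss_expectXn exprS mulnC mulrnA.
by rewrite -[_ *+ i.+1]mulr_natl; ring.
Qed.

End gauss_expect.

Lemma rmorph_gauss_expect (A B : comNzRingType) (f : {rmorphism A -> B}) t p :
  f (gauss_expect t p) = gauss_expect (f t) (map_poly f p).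
Proof.
rewrite [RHS](@gauss_expect_widen _ _ (size p)) ?size_poly//.
rewrite rmorph_sum; apply: eq_bigr => i _.
by rewrite coef_map rmorphM rmorphMn rmorphXn.
Qed.

Section wick.
Variable (R : rcfType) (tau : R[i]).
Local Notation C := R[i].

(** Two independent variables of the same variance [tau]: [X], and the variable
    [Y] of the coefficients. *)
Definition gauss_expect2 (Q : {poly {poly C}}) : C :=
  gauss_expect tau (gauss_expect tau%:P Q).

Let gauss_expect2D : {morph gauss_expect2 : P Q / P + Q}.
Proof. by move=> P Q; rewrite /gauss_expect2 !gauss_expectD. Qed.

Lemma gauss_expect2Z c Q : gauss_expect2 (c%:P *: Q) = c * gauss_expect2 Q.
Proof. by rewrite /gauss_expect2 gauss_expectZ mul_polyC gauss_expectZ. Qed.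

Lemma gauss_expect2_sum (I : Type) (r : seq I) (P : pred I) (F : I -> {poly {poly C}}) :
  gauss_expect2 (\sum_(i <- r | P i) F i) = \sum_(i <- r | P i) gauss_expect2 (F i).
Proof.
have gauss_expect20 : gauss_expect2 0 = 0 by rewrite /gauss_expect2 !gauss_expect0.
exact: (big_morph gauss_expect2 gauss_expect2D gauss_expect20).
Qed.

Let Dy (Q : {poly {poly C}}) : {poly {poly C}} := map_poly (@deriv C) Q.

Let coef_Dy Q k : (Dy Q)`_k = (Q`_k)^`().
Proof. by rewrite /Dy coef_map_id0 ?deriv0. Qed.

Let gauss_expect2_X Q : gauss_expect2 ('X * Q) = tau * gauss_expect2 Q^`().
Proof. by rewrite /gauss_expect2 gauss_expectX mul_polyC gauss_expectZ. Qed.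

Let gauss_expect2_Y Q : gauss_expect2 ('X *: Q) = tau * gauss_expect2 (Dy Q).
Proof.
rewrite /gauss_expect2 gauss_expectZ gauss_expectX; congr (_ * gauss_expect _ _).
rewrite (@gauss_expect_widen _ _ (size Q) (Dy Q)) ?size_poly//.
rewrite /gauss_expect raddf_sum/=; apply: eq_bigr => k _.
rewrite coef_Dy derivM [X in _ + _ * X](_ : _ = 0) ?mulr0 ?addr0//.
by rewrite -rmorphXn -rmorphMn/= derivC.
Qed.

(** The derivation [d/dX + u d/dY]; it kills [X + u Y] when [u ^+ 2 = - 1]. *)
Let dbar u (Q : {poly {poly C}}) : {poly {poly C}} := Q^`() + u%:P%:P * Dy Q.

Let DyM P Q : Dy (P * Q) = Dy P * Q + P * Dy Q.
Proof.
apply/polyP => k; rewrite coef_Dy coefD !coefM raddf_sum/= -big_split/=.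
by apply: eq_bigr => i _; rewrite !coef_Dy derivM.
Qed.

Let dbarM u P Q : dbar u (P * Q) = dbar u P * Q + P * dbar u Q.
Proof. by rewrite /dbar derivM DyM; ring. Qed.

(** The form [X + u Y]: the complex variable for [u = 'i], its conjugate for
    [u = - 'i]. *)
Definition xyform u : {poly {poly C}} := 'X + (u *: 'X)%:P.

Let gauss_expect2_lin u Q : gauss_expect2 (xyform u * Q) = tau * gauss_expect2 (dbar u Q).
Proof.
rewrite /xyform mulrDl gauss_expect2D gauss_expect2_X mul_polyC -[u *: 'X]mul_polyC -scalerA gauss_expect2Z gauss_expect2_Y.
by rewrite /dbar gauss_expect2D mul_polyC gauss_expect2Z; ring.
Qed.

Let dbar_lin u w : dbar u (xyform w) = (1 + u * w)%:P%:P.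
Proof.
rewrite /dbar /xyform derivD derivX derivC addr0.
have -> : Dy ('X + (w *: 'X)%:P) = w%:P%:P.
  apply/polyP => k; rewrite coef_Dy coefD coefX !coefC; case: k => [|[|k]]/=.
  - by rewrite add0r derivZ derivX -mul_polyC mulr1.
  - by rewrite addr0 derivC.
  - by rewrite addr0 deriv0.
by rewrite rmorphD rmorphM/= rmorphD rmorphM !rmorph1.
Qed.

Let leibniz_pow (A : comNzRingType) (c x : A) k :
  c * x ^+ k + x * ((c * x ^+ k.-1) *+ k) = (c * x ^+ k) *+ k.+1.
Proof.
case: k => [|k]; first by rewrite mulr0n mulr0 addr0.
by rewrite -mulrnAr mulrCA mulrnAr -exprS mulrnAr -mulrS.
Qed.

Let dbar_linX u w k :
  dbar u (xyform w ^+ k) = ((1 + u * w)%:P%:P * xyform w ^+ k.-1) *+ k.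
Proof.
elim: k => [|k IH].
  have Dy1 : Dy 1 = 0.
    by have /eqP := DyM 1 1; rewrite !mulr1 mul1r -subr_eq subrr => /eqP.
  by rewrite expr0 mulr0n /dbar derivC add0r Dy1 mulr0.
by rewrite exprS dbarM dbar_lin IH leibniz_pow.
Qed.

(** Integration by parts against one factor [X + 'i Y] differentiates the
    others, and only the conjugate factors have a nonzero derivative: each
    of the [a] factors is paired with one of the [b] conjugate ones. *)
Lemma wick a b :
  gauss_expect2 (xyform 'i%C ^+ a * xyform (- 'i%C) ^+ b) =
  if a == b then (2 * tau) ^+ a *+ a`! else 0.
Proof.
have dbar_pow (u w : C) : u * w = 1 -> u * u = -1 -> forall a b,
    dbar u (xyform u ^+ a * xyform w ^+ b) = (b%:R * 2)%:P%:P * (xyform u ^+ a * xyform w ^+ b.-1).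
  move=> uw uu i j; rewrite dbarM !dbar_linX uw uu subrr !rmorph0 mul0r mul0rn mul0r add0r.
  have -> : (j%:R * 2)%:P%:P = (1 + 1 : C)%:P%:P *+ j.
    by rewrite mulr_natl !polyCMn.
  by rewrite mulrnAr mulrnAl mulrCA.
have ii : 'i%C * 'i%C = -1 :> C by rewrite -expr2 sqr_i.
have iiN : 'i%C * - 'i%C = 1 :> C by rewrite mulrN ii opprK.
have iNi : - 'i%C * 'i%C = 1 :> C by rewrite mulNr ii opprK.
have iNiN : - 'i%C * - 'i%C = - 1 :> C by rewrite mulrNN ii.
elim: a b => [|a IH] [|b].
- by rewrite !expr0 mulr1 /gauss_expect2 gauss_expect1 gauss_expect1.
- rewrite mulrC exprS -mulrA gauss_expect2_lin (dbar_pow _ _ iNi iNiN) mul0r !rmorph0 mul0r.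
  by rewrite /gauss_expect2 !gauss_expect0 mulr0.
- rewrite exprS -mulrA gauss_expect2_lin (dbar_pow _ _ iiN ii) mul0r !rmorph0 mul0r.
  by rewrite /gauss_expect2 !gauss_expect0 mulr0.
- rewrite exprS -mulrA gauss_expect2_lin (dbar_pow _ _ iiN ii) mul_polyC gauss_expect2Z IH eqSS.
  case: eqP => [->|_]; last by rewrite !mulr0.
  rewrite /= factS exprS -[_ *+ b`!]mulr_natr -[_ *+ (_ * _)]mulr_natr natrM.
  by ring.
Qed.

End wick.

Definition nsq (R : rcfType) (c : R[i]) : R := complex.Re c ^+ 2 + complex.Im c ^+ 2.

Section nsq.
Context {R : rcfType}.
Implicit Types c d : R[i].

Lemma nsq_normc c : nsq c = Normc.normc c ^+ 2.
Proof. by case: c => a b; rewrite /nsq /= sqr_sqrtr// addr_ge0 ?sqr_ge0. Qed.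

Lemma nsq_ge0 c : 0 <= nsq c.
Proof. by rewrite addr_ge0 ?sqr_ge0. Qed.

Lemma nsqM : {morph (@nsq R) : c d / c * d}.
Proof. by move=> c d; rewrite !nsq_normc Normc.normcM exprMn. Qed.

Lemma nsqC c : (nsq c)%:C = c * c^*%C.
Proof. by case: c => a b; rewrite /nsq; simpc; congr (_ +i* _); ring. Qed.

Lemma nsq_eq0 c : (nsq c == 0) = (c == 0).
Proof. by case: c => a b; rewrite /nsq paddr_eq0 ?sqr_ge0// !sqrf_eq0 eq_complex. Qed.

Lemma nsq0 : nsq (0 : R[i]) = 0.
Proof. by rewrite /nsq /= expr0n addr0. Qed.

Lemma nsq1 : nsq (1 : R[i]) = 1.
Proof. by rewrite /nsq /= expr1n expr0n addr0. Qed.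

Lemma nsq_real (a : R) : nsq a%:C = a ^+ 2.
Proof. by rewrite /nsq /= expr0n addr0. Qed.

Lemma nsqX c n : nsq (c ^+ n) = nsq c ^+ n.
Proof. by elim: n => [|n IH]; rewrite ?expr0 ?nsq1// !exprS nsqM IH. Qed.

Lemma nsqN c : nsq (- c) = nsq c.
Proof. by case: c => a b; rewrite /nsq /= !sqrrN. Qed.

Lemma nsqV c : nsq c^-1 = (nsq c)^-1.
Proof. by rewrite !nsq_normc Normc.normcV exprVn. Qed.

Lemma nsq_norm c : (nsq c)%:C = `|c| ^+ 2.
Proof. by rewrite nsqC sqr_normc. Qed.

Lemma nsq_prod (I : Type) (r : seq I) (P : pred I) (F : I -> R[i]) :
  nsq (\prod_(i <- r | P i) F i) = \prod_(i <- r | P i) nsq (F i).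
Proof. exact: (big_morph _ nsqM nsq1). Qed.

End nsq.

Section fock_formal.
Variable (R : rcfType) (s : R).
Local Notation C := R[i].
Local Notation tau := ((s ^+ 2)%:C).

(** The polynomial [|q(X + iY)|^2] in the two real variables. *)
Definition sqmod_poly (q : {poly C}) : {poly {poly C}} :=
  (\sum_(j < size q) (q`_j)%:P *: xyform 'i%C ^+ j) *
  (\sum_(j < size q) ((q`_j)^*%C)%:P *: xyform (- 'i%C) ^+ j).

(** Expanding the product, [wick] keeps only the diagonal terms. *)
Lemma expect_sqmod_poly q :
  gauss_expect2 tau (sqmod_poly q) =
  (\sum_(j < size q) nsq q`_j * ((2 * s ^+ 2) ^+ j * j`!%:R))%:C.
Proof.
rewrite /sqmod_poly mulr_suml gauss_expect2_sum rmorph_sum/=.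
apply: eq_bigr => j _; rewrite mulr_sumr gauss_expect2_sum.
rewrite (bigD1 j)//= big1 ?addr0.
  rewrite -scalerAl -scalerAr scalerA -rmorphM gauss_expect2Z wick eqxx.
  rewrite [RHS]rmorphM/= nsqC; congr (_ * _).
  by rewrite mulr_natr [RHS]rmorphMn/= [in RHS]rmorphXn/= [in RHS]rmorphM/= rmorph_nat.
move=> k kj.
rewrite -scalerAl -scalerAr scalerA -rmorphM gauss_expect2Z wick.
rewrite -val_eqE eq_sym/= in kj.
by rewrite (negbTE kj) mulr0.
Qed.

Lemma eval_sqmod_poly q (x y : R) :
  ((sqmod_poly q).[x%:C%:P]).[y%:C] = (nsq q.[x +i* y])%:C.
Proof.
rewrite /sqmod_poly hornerM hornerM !horner_sum nsqC; congr (_ * _).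
  rewrite horner_coef; apply: eq_bigr => j _.
  rewrite hornerZ hornerM hornerC horner_exp horner_exp; congr (_ * _ ^+ _).
  rewrite /xyform hornerD hornerX hornerC hornerD hornerC hornerZ hornerX.
  by simpc.
rewrite horner_coef rmorph_sum; apply: eq_bigr => j _.
rewrite hornerZ hornerM hornerC horner_exp horner_exp rmorphM rmorphXn; congr (_ * _ ^+ _).
rewrite /xyform hornerD hornerX hornerC hornerD hornerC hornerZ hornerX.
by simpc.
Qed.

End fock_formal.

(** * Square norms of polynomials under the complex Gaussian *)

Section measurable_complex_functions.
Context {R : realType} d (T : measurableType d).
Implicit Types f g : T -> R[i].

Lemma measurable_complexP f : measurable_fun setT f <->
  measurable_fun setT (fun x => complex.Re (f x)) /\
  measurable_fun setT (fun x => complex.Im (f x)).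
Proof.
split=> [mf|[mre mim]].
  have m := measurableT_comp (@measurable_pair_of_complex R) mf.
  split.
    exact: (measurableT_comp measurable_fst m).
  exact: (measurableT_comp measurable_snd m).
rewrite (_ : f = @complex_of_pair R \o (fun x => (complex.Re (f x), complex.Im (f x)))); last first.
  by apply/funext => x /=; case: (f x).
apply: measurableT_comp; first exact: measurable_complex_of_pair.
exact/measurable_fun_pairP.
Qed.

Lemma measurable_Re f : measurable_fun setT f ->
  measurable_fun setT (fun x => complex.Re (f x)).
Proof. by move=> /measurable_complexP[]. Qed.

Lemma measurable_complexD f g : measurable_fun setT f -> measurable_fun setT g ->
  measurable_fun setT (fun x => f x + g x).
Proof.
move=> /measurable_complexP[f1 f2] /measurable_complexP[g1 g2].
apply/measurable_complexP; split.
  under eq_fun do rewrite raddfD/=; exact: measurable_funD.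
under eq_fun do rewrite raddfD/=; exact: measurable_funD.
Qed.

Lemma measurable_complexN f : measurable_fun setT f ->
  measurable_fun setT (fun x => - f x).
Proof.
move=> /measurable_complexP[f1 f2]; apply/measurable_complexP; split.
  under eq_fun do rewrite raddfN/=; exact: measurableT_comp.
under eq_fun do rewrite raddfN/=; exact: measurableT_comp.
Qed.

Lemma measurable_complexM f g : measurable_fun setT f -> measurable_fun setT g ->
  measurable_fun setT (fun x => f x * g x).
Proof.
move=> /measurable_complexP[f1 f2] /measurable_complexP[g1 g2].
apply/measurable_complexP; split.
  rewrite (_ : (fun x => _) = fun x => complex.Re (f x) * complex.Re (g x) -
    complex.Im (f x) * complex.Im (g x)).
    by apply: measurable_funB; exact: measurable_funM.
  by apply/funext => x; case: (f x) => a b; case: (g x).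
rewrite (_ : (fun x => _) = fun x => complex.Re (f x) * complex.Im (g x) +
    complex.Im (f x) * complex.Re (g x)).
  by apply: measurable_funD; exact: measurable_funM.
by apply/funext => x; case: (f x) => a b; case: (g x).
Qed.

Lemma measurable_complexB f g : measurable_fun setT f -> measurable_fun setT g ->
  measurable_fun setT (fun x => f x - g x).
Proof. by move=> mf mg; apply: measurable_complexD => //; exact: measurable_complexN. Qed.

Lemma measurable_nsq f : measurable_fun setT f ->
  measurable_fun setT (fun x => nsq (f x)).
Proof.
move=> /measurable_complexP[f1 f2]; apply: measurable_funD;
  exact: measurable_funX.
Qed.

Lemma measurable_complexV f : measurable_fun setT f ->
  measurable_fun setT (fun x => (f x)^-1).
Proof.
move=> mf; have [f1 f2] := (measurable_complexP f).1 mf.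
have mn := measurable_nsq mf.
have mV : measurable_fun setT (fun x => (nsq (f x))^-1).
  rewrite (_ : (fun x => _) = (@powR R)^~ (-1) \o (fun x => nsq (f x))); last first.
    by apply/funext => x /=; rewrite powR_inv1// nsq_ge0.
  by apply: (@measurableT_comp _ _ _ _ _ _ ((@powR R)^~ (-1))) => //; exact: measurable_powR.
apply/measurable_complexP; split.
  rewrite (_ : (fun x => _) = fun x => complex.Re (f x) * (nsq (f x))^-1).
    exact: measurable_funM.
  by apply/funext => x; case: (f x).
rewrite (_ : (fun x => _) = fun x => - (complex.Im (f x) * (nsq (f x))^-1)).
  by apply: measurableT_comp => //; exact: measurable_funM.
by apply/funext => x; case: (f x).
Qed.

Lemma measurable_complex_sum (I : Type) (r : seq I) (P : pred I) (F : I -> T -> R[i]) :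
  (forall i, measurable_fun setT (F i)) ->
  measurable_fun setT (fun x => \sum_(i <- r | P i) F i x).
Proof.
move=> mF; elim: r => [|i r IH].
  by under eq_fun do rewrite big_nil; exact: measurable_cst.
under eq_fun do rewrite big_cons.
by case: (P i) => //; exact: measurable_complexD.
Qed.

Lemma measurable_complex_prod (I : Type) (r : seq I) (P : pred I) (F : I -> T -> R[i]) :
  (forall i, measurable_fun setT (F i)) ->
  measurable_fun setT (fun x => \prod_(i <- r | P i) F i x).
Proof.
move=> mF; elim: r => [|i r IH].
  by under eq_fun do rewrite big_nil; exact: measurable_cst.
under eq_fun do rewrite big_cons.
by case: (P i) => //; exact: measurable_complexM.
Qed.

Lemma measurable_complexX f n : measurable_fun setT f ->
  measurable_fun setT (fun x => f x ^+ n).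
Proof.
move=> mf; elim: n => [|n IH].
  by under eq_fun do rewrite expr0; exact: measurable_cst.
by under eq_fun do rewrite exprS; exact: measurable_complexM.
Qed.

Lemma measurable_horner (p : {poly R[i]}) f : measurable_fun setT f ->
  measurable_fun setT (fun x => p.[f x]).
Proof.
move=> mf; under eq_fun do rewrite horner_coef.
apply: measurable_complex_sum => i; apply: measurable_complexM.
  exact: measurable_cst.
exact: measurable_complexX.
Qed.

End measurable_complex_functions.

Lemma measurable_nsq_dist (R : realType) (z : R[i]) :
  measurable_fun setT (fun w : R[i] => nsq (z - w)).
Proof.
by apply: measurable_nsq; apply: measurable_complexB;
  [exact: measurable_cst|exact: measurable_id].
Qed.

Lemma measurable_real_horner (R : realType) (p : {poly R}) :
  measurable_fun setT (fun x : R => p.[x]).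
Proof.
under eq_fun do rewrite horner_coef.
apply: measurable_sum => i; apply: measurable_funM; first exact: measurable_cst.
exact: exprn_measurable.
Qed.

Section integral_nsq_horner.
Context {R : realType}.
Local Notation N s := (normal_prob 0 s : set (measurableTypeR R) -> \bar R).

Lemma ge0_integral_complex_normal (v : R) (f : R[i] -> \bar R) :
  measurable_fun setT f -> (forall w, 0 <= f w)%E ->
  (\int[complex_normal v]_w f w =
   \int[N (Num.sqrt (v / 2))]_y \int[N (Num.sqrt (v / 2))]_x f (x +i* y))%E.
Proof.
move=> mf f0; rewrite /complex_normal ge0_integral_pushforward//; last first.
  exact: measurable_complex_of_pair.
rewrite preimage_setT fubini_tonelli2//; last by move=> p; exact: f0.
by apply: measurableT_comp => //; exact: measurable_complex_of_pair.
Qed.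

(** Transfers the formal expectation to the integral, one real variable at a
    time; the coefficients stay complex. *)
Lemma integral_normal_polyC (s : R) (p : {poly R[i]}) : 0 < s ->
  (N s).-integrable setT (fun x : R => (complex.Re p.[x%:C])%:E) /\
  (\int[N s]_x (complex.Re p.[x%:C])%:E =
   (complex.Re (gauss_expect (s ^+ 2)%:C p))%:E)%E.
Proof.
move=> s0.
have e n : (N s).-integrable setT
      (fun x : R => (\sum_(k < n) complex.Re p`_k * x ^+ k)%:E) /\
    (\int[N s]_x (\sum_(k < n) complex.Re p`_k * x ^+ k)%:E =
     (\sum_(k < n) complex.Re p`_k * (s ^+ k * (dfact k)%:R))%:E)%E.
  elim: n => [|n [IH1 IH2]].
    rewrite big_ord0; split.
      rewrite (_ : (fun x => _) = cst 0%E); first exact: integrable0.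
      by apply/funext => x; rewrite big_ord0.
    by rewrite integral0_eq// => x _; rewrite big_ord0.
  have I : (N s).-integrable setT (fun x : R => (complex.Re p`_n * x ^+ n)%:E).
    under eq_fun do rewrite EFinM.
    by apply: integrableZl => //; exact: integrable_normal_moment.
  split.
    under eq_fun do rewrite big_ord_recr/= EFinD.
    exact: integrableD.
  under eq_integral do rewrite big_ord_recr/= EFinD.
  rewrite integralD// IH2 big_ord_recr/= EFinD; congr (_ + _)%E.
  under eq_integral do rewrite EFinM.
  rewrite integralZl//; last exact: integrable_normal_moment.
  by rewrite integral_normal_moment// EFinM.
have ReM (a : R) (c : R[i]) : complex.Re (c * a%:C) = complex.Re c * a.
  by case: c => x y /=; rewrite mulr0 subr0.
have E x : complex.Re p.[x%:C] = \sum_(k < size p) complex.Re p`_k * x ^+ k.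
  rewrite horner_coef raddf_sum; apply: eq_bigr => k _.
  by rewrite /= -rmorphXn/= ReM.
have [e1 e2] := e (size p).
split; first by under eq_fun do rewrite E.
under eq_integral do rewrite E.
rewrite e2 /gauss_expect; congr EFin; rewrite [RHS]raddf_sum; apply: eq_bigr => k _ /=.
rewrite -rmorphXn -rmorphMn/= ReM; congr (_ * _).
have [ok|ek] := boolP (odd k); first by rewrite dfact_odd// mulr0 mulr0n.
by rewrite -exprM mul2n even_halfK// mulr_natr.
Qed.

(** Distinct powers of [w] are orthogonal for a rotation invariant Gaussian,
    and [w^j] has square norm [v^j j!]. *)
Theorem integral_nsq_horner (v : R) (q : {poly R[i]}) : 0 < v ->
  (\int[complex_normal v]_w (nsq q.[w])%:E =
   (\sum_(j < size q) nsq q`_j * (v ^+ j * j`!%:R))%:E)%E.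
Proof.
move=> v0; set s := Num.sqrt (v / 2).
have s0 : 0 < s by rewrite sqrtr_gt0 divr_gt0.
have s2 : s ^+ 2 = v / 2 by rewrite sqr_sqrtr// ltW// divr_gt0.
rewrite ge0_integral_complex_normal; last 2 first.
- apply/measurable_EFinP/measurable_nsq/measurable_horner; exact: measurable_id.
- by move=> w; rewrite lee_fin nsq_ge0.
rewrite -/s.
have e (y : R) : (\int[N s]_x (nsq q.[x +i* y])%:E =
    (complex.Re (gauss_expect (s ^+ 2)%:C%:P (sqmod_poly q)).[y%:C])%:E)%E.
  set P := map_poly (horner_eval y%:C) (sqmod_poly q).
  have [_ ] := integral_normal_polyC P s0.
  have -> : (gauss_expect (s ^+ 2)%:C%:P (sqmod_poly q)).[y%:C] =
      gauss_expect (s ^+ 2)%:C P.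
    have := rmorph_gauss_expect (horner_eval y%:C) (s ^+ 2)%:C%:P (sqmod_poly q).
    by rewrite /= {1 2}/horner_eval hornerC.
  move=> <-.
  apply: eq_integral => x _; congr EFin.
  transitivity (complex.Re (nsq q.[x +i* y])%:C); first by [].
  rewrite -eval_sqmod_poly; congr complex.Re.
  rewrite -[LHS]/(horner_eval y%:C (sqmod_poly q).[x%:C%:P]) -horner_map/=.
  by rewrite /horner_eval hornerC.
under eq_integral do rewrite e.
have [_ ->] := integral_normal_polyC (gauss_expect (s ^+ 2)%:C%:P (sqmod_poly q)) s0.
rewrite -[gauss_expect _ (gauss_expect _ _)]/(gauss_expect2 (s ^+ 2)%:C (sqmod_poly q)).
rewrite expect_sqmod_poly/= s2; congr EFin; apply: eq_bigr => j _.
by rewrite [2 * _]mulrC divfK.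
Qed.

End integral_nsq_horner.

(** * Tonelli theorem for product measures on tuples *)

Section sigma_finite_product.
Context d1 d2 (T1 : measurableType d1) (T2 : measurableType d2) (R : realType).
Variables (m1 : {sigma_finite_measure set T1 -> \bar R}).
Variables (m2 : {sigma_finite_measure set T2 -> \bar R}).

Let pm : set (T1 * T2) -> \bar R := (m1 \x m2)%E.

HB.instance Definition _ := Measure.on pm.

Let pm_sigma_finite : sigma_finite setT pm.
Proof.
have [F TF Foo] := sigma_finiteT m1; have [G TG Goo] := sigma_finiteT m2.
exists (fun k => if unpickle k is Some (i, j) then F i `*` G j else set0).
  apply/esym/seteqP; split=> // -[x y] _.
  have [i _ Fx] : (\bigcup_i F i) x by rewrite -TF.
  have [j _ Gy] : (\bigcup_j G j) y by rewrite -TG.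
  by exists (pickle (i, j)) => //; rewrite pickleK.
move=> k; case: (unpickle k) => [[i j]|]; last by rewrite measure0.
have [? ?] := Foo i; have [? ?] := Goo j.
split; first exact: measurableX.
by rewrite /pm product_measure1E// lte_mul_pinfty// ge0_fin_numE.
Qed.

HB.instance Definition _ := Measure_isSigmaFinite.Build _ _ _ pm pm_sigma_finite.

(** An existence statement: integration lemmas ask for a bundled measure, which
    rewriting with the equation provides. *)
Lemma sigma_finite_product :
  exists m : {sigma_finite_measure set (T1 * T2)%type -> \bar R},
    (m : set (T1 * T2)%type -> \bar R) = (m1 \x m2)%E.
Proof. by exists pm. Qed.

End sigma_finite_product.

Section sigma_finite_pushforward.
Context d1 d2 (T1 : measurableType d1) (T2 : measurableType d2) (R : realType).
Variables (m : {sigma_finite_measure set T1 -> \bar R}) (f : T1 -> T2) (g : T2 -> T1).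
Hypotheses (mf : measurable_fun setT f) (mg : measurable_fun setT g).
Hypothesis fK : cancel f g.

Let pf : set T2 -> \bar R := pushforward m f.

Let pf0 : pf set0 = 0%E.
Proof. by rewrite /pf; apply: measure0. Qed.

Let pf_ge0 A : (0 <= pf A)%E.
Proof. by rewrite /pf; apply: measure_ge0. Qed.

Let pf_sigma_additive : semi_sigma_additive pf.
Proof. by rewrite /pf; apply: measure_semi_sigma_additive. Qed.

HB.instance Definition _ := isMeasure.Build _ _ _ pf pf0 pf_ge0 pf_sigma_additive.

Let pf_sigma_finite : sigma_finite setT pf.
Proof.
have [F TF Foo] := sigma_finiteT m.
exists (fun k => g @^-1` F k).
  by rewrite -preimage_bigcup -TF preimage_setT.
move=> k; have [mF Fk] := Foo k; split.
  by rewrite -[X in measurable X]setTI; exact: mg.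
rewrite /pf /pushforward -comp_preimage.
by rewrite (_ : g \o f = id)//; apply/funext => x /=; rewrite fK.
Qed.

HB.instance Definition _ := Measure_isSigmaFinite.Build _ _ _ pf pf_sigma_finite.

Lemma sigma_finite_pushforward :
  exists m' : {sigma_finite_measure set T2 -> \bar R},
    (m' : set T2 -> \bar R) = pushforward m f.
Proof. by exists pf. Qed.

End sigma_finite_pushforward.

Section tuple_measure_tonelli.
Context d (T : measurableType d) (R : realType).
Variable mu : {sigma_finite_measure set T -> \bar R}.

Lemma measurable_tuple_cons n :
  measurable_fun setT (fun p : T * n.-tuple T => [tuple of p.1 :: p.2]).
Proof. exact: measurable_cons. Qed.

Lemma measurable_tuple_uncons n :
  measurable_fun setT (fun t : n.+1.-tuple T => (thead t, [tuple of behead t])).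
Proof.
apply/measurable_fun_pairP; split; first exact: measurable_tnth.
exact: measurable_behead.
Qed.

Let tuple_measureS n : tuple_measure mu n.+1 =
  pushforward (mu \x tuple_measure mu n)%E
    (fun p : T * n.-tuple T => [tuple of p.1 :: p.2]).
Proof. by []. Qed.

Lemma tuple_measure_sigma_finite n :
  exists m : {sigma_finite_measure set (n.-tuple T) -> \bar R},
    (m : set _ -> \bar R) = tuple_measure mu n.
Proof.
elim: n => [|n [m me]].
  by exists (dirac ([tuple] : 0.-tuple T)).
rewrite tuple_measureS -me.
have fK : cancel (fun p : T * n.-tuple T => [tuple of p.1 :: p.2])
    (fun t : n.+1.-tuple T => (thead t, [tuple of behead t])).
  by move=> [x t]; rewrite /= theadE; congr pair; exact: val_inj.
have [mm mmE] := sigma_finite_product mu m; rewrite -mmE.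
have [m' m'E] := sigma_finite_pushforward mm (@measurable_tuple_cons n)
  (@measurable_tuple_uncons n) fK.
by exists m'.
Qed.

Lemma ge0_integral_tuple_measure0 (f : 0.-tuple T -> \bar R) :
  measurable_fun setT f -> (forall t, 0 <= f t)%E ->
  (\int[tuple_measure mu 0]_t f t = f [tuple])%E.
Proof. by move=> mf f0; rewrite /= integral_dirac// diracT mul1e. Qed.

Section step.
Variables (n : nat) (f : n.+1.-tuple T -> \bar R).
Hypotheses (mf : measurable_fun setT f) (f0 : forall t, (0 <= f t)%E).

Let mf' : measurable_fun setT (fun p : T * n.-tuple T => f [tuple of p.1 :: p.2]).
Proof. exact: measurableT_comp mf (@measurable_tuple_cons n). Qed.

Lemma ge0_integral_tuple_measureS :
  (\int[tuple_measure mu n.+1]_t f t =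
   \int[mu]_x \int[tuple_measure mu n]_t f [tuple of x :: t])%E.
Proof.
have [m me] := tuple_measure_sigma_finite n; rewrite tuple_measureS -me.
rewrite ge0_integral_pushforward//; last exact: measurable_tuple_cons.
by rewrite preimage_setT fubini_tonelli1// => p; exact: f0.
Qed.

(** The head integrated first. *)
Lemma ge0_integral_tuple_measureSr :
  (\int[tuple_measure mu n.+1]_t f t =
   \int[tuple_measure mu n]_t \int[mu]_x f [tuple of x :: t])%E.
Proof.
have [m me] := tuple_measure_sigma_finite n; rewrite tuple_measureS -me.
rewrite ge0_integral_pushforward//; last exact: measurable_tuple_cons.
by rewrite preimage_setT fubini_tonelli2// => p; exact: f0.
Qed.

Lemma measurable_integral_tuple_tail :
  measurable_fun setT (fun x => \int[tuple_measure mu n]_t f [tuple of x :: t])%E.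
Proof.
have [m me] := tuple_measure_sigma_finite n; rewrite -me.
exact: (measurable_fun_fubini_tonelli_F _ mf').
Qed.

End step.

End tuple_measure_tonelli.

(** * Integrals of squared determinants *)

Section slater.
Context d (T : measurableType d) (R : realType).
Variable mu : {sigma_finite_measure set T -> \bar R}.
Variable W : T -> R.
Hypotheses (mW : measurable_fun setT W) (W0 : forall x, 0 <= W x).

Definition slater_mx n (psi : 'I_n -> T -> R[i]) (t : n.-tuple T) : 'M[R[i]]_n :=
  \matrix_(i, j) psi i (tnth t j).

Definition slater_weight n (psi : 'I_n -> T -> R[i]) (t : n.-tuple T) : R :=
  (\prod_(k < n) W (tnth t k)) * nsq (\det (slater_mx psi t)).

Lemma slater_weight_ge0 n (psi : 'I_n -> T -> R[i]) t : 0 <= slater_weight psi t.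
Proof. by rewrite mulr_ge0 ?nsq_ge0 ?prodr_ge0. Qed.

Lemma measurable_det d' (S : measurableType d') n (M : S -> 'M[R[i]]_n) :
  (forall i j, measurable_fun setT (fun x => M x i j)) ->
  measurable_fun setT (fun x => \det (M x)).
Proof.
move=> mM; apply: measurable_complex_sum => s; apply: measurable_complexM.
  exact: measurable_cst.
by apply: measurable_complex_prod => i.
Qed.

Lemma measurable_prod_tuple n (f : T -> R) : measurable_fun setT f ->
  measurable_fun setT (fun t : n.-tuple T => \prod_(k < n) f (tnth t k)).
Proof.
move=> mf; apply: measurable_prod => i _.
by apply: measurableT_comp mf _; exact: measurable_tnth.
Qed.

Lemma measurable_slater_weight n (psi : 'I_n -> T -> R[i]) :
  (forall i, measurable_fun setT (psi i)) -> measurable_fun setT (slater_weight psi).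
Proof.
move=> mpsi; apply: measurable_funM; first exact: measurable_prod_tuple.
apply: measurable_nsq; apply: measurable_det => i j.
under eq_fun do rewrite mxE.
by apply: measurableT_comp (mpsi i) _; exact: measurable_tnth.
Qed.

(** Laplace expansion along the first column: integrating the first variable
    leaves the sum of the squared minors, by orthogonality. *)
Lemma integral_slater_orthogonal n (psi : 'I_n -> T -> R[i]) (al : 'I_n -> R) :
  (forall i, measurable_fun setT (psi i)) ->
  (forall i, 0 <= al i) ->
  (forall c : 'I_n -> R[i],
    \int[mu]_x (W x * nsq (\sum_i c i * psi i x))%:E =
    (\sum_i nsq (c i) * al i)%:E)%E ->
  (\int[tuple_measure mu n]_t (slater_weight psi t)%:E =
   (n`!%:R * \prod_i al i)%:E)%E.
Proof.
elim: n psi al => [|n IH] psi al mpsi al0 orth.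
  rewrite ge0_integral_tuple_measure0; last 2 first.
  - by apply/measurable_EFinP; apply: measurable_slater_weight.
  - by move=> t; rewrite lee_fin slater_weight_ge0.
  by rewrite /slater_weight !big_ord0 det_mx00 nsq1 fact0.
rewrite ge0_integral_tuple_measureSr; last 2 first.
- by apply/measurable_EFinP; apply: measurable_slater_weight.
- by move=> t; rewrite lee_fin slater_weight_ge0.
pose minor (i : 'I_n.+1) := slater_weight (fun k : 'I_n => psi (lift i k)).
have mminor i : measurable_fun setT (minor i).
  by apply: measurable_slater_weight => k; exact: mpsi.
have step (t : n.-tuple T) :
    (\int[mu]_x (slater_weight psi [tuple of x :: t])%:E =
     (\sum_i al i * minor i t)%:E)%E.
  pose c (i : 'I_n.+1) : R[i] := (-1) ^+ (i + 0) * \det (slater_mx (fun k : 'I_n => psi (lift i k)) t).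
  have e x : slater_weight psi [tuple of x :: t] =
      (\prod_(k < n) W (tnth t k)) * (W x * nsq (\sum_i c i * psi i x)).
    rewrite /slater_weight big_ord_recl tnth0 [in RHS]mulrA.
    rewrite [in RHS](mulrC _ (W x)); congr (_ * _ * nsq _).
      by apply: eq_bigr => k _; rewrite tnthS.
    rewrite (expand_det_col _ ord0); apply: eq_bigr => i _.
    rewrite mxE tnth0 mulrC /cofactor /c.
    suff -> : row' i (col' ord0 (slater_mx psi [tuple of x :: t])) =
      slater_mx (fun k : 'I_n => psi (lift i k)) t by [].
    by apply/matrixP => a b; rewrite !mxE tnthS.
  under eq_integral do rewrite e EFinM.
  rewrite ge0_integralZl//; last 3 first.
  - apply/measurable_EFinP/measurable_funM => //; apply: measurable_nsq.
    apply: measurable_complex_sum => i; apply: measurable_complexM => //.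
  - by move=> x _; rewrite lee_fin mulr_ge0// nsq_ge0.
  - by rewrite lee_fin prodr_ge0.
  rewrite orth -EFinM; congr EFin; rewrite mulr_sumr; apply: eq_bigr => i _.
  rewrite /c nsqM nsqX nsqN nsq1 expr1n mul1r /minor /slater_weight.
  by ring.
have [m me] := tuple_measure_sigma_finite mu n; rewrite -me.
under eq_integral do rewrite step -sumEFin.
rewrite ge0_integral_sum//; last 2 first.
- by move=> i; by apply/measurable_EFinP/measurable_funM.
- by move=> i t _; rewrite lee_fin mulr_ge0// slater_weight_ge0.
transitivity (\sum_(i < n.+1) (n`!%:R * \prod_j al j)%:E)%E; last first.
  by rewrite sumEFin sumr_const card_ord factS natrM; congr EFin; rewrite -[LHS]mulr_natl mulrA.
apply: eq_bigr => i _.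
under eq_integral do rewrite EFinM.
rewrite ge0_integralZl//; last 3 first.
- by apply/measurable_EFinP; exact: mminor.
- by move=> t _; rewrite lee_fin slater_weight_ge0.
- by rewrite lee_fin.
have -> : (\int[m]_t (minor i t)%:E = (n`!%:R * \prod_k al (lift i k))%:E)%E; last first.
  by rewrite -EFinM (bigD1_ord i)//=; congr EFin; ring.
rewrite me; apply: IH => // c.
pose c' j := if unlift i j is Some k then c k else 0.
have c'i : c' i = 0 by rewrite /c' unlift_none.
have c'l k : c' (lift i k) = c k by rewrite /c' liftK.
transitivity (\int[mu]_x (W x * nsq (\sum_i c' i * psi i x))%:E)%E.
  apply: eq_integral => x _; congr (_ * nsq _)%:E.
  rewrite [RHS](bigD1_ord i)//= c'i mul0r add0r.
  by apply: eq_bigr => k _; rewrite c'l.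
rewrite orth; congr EFin; rewrite [LHS](bigD1_ord i)//= c'i nsq0 mul0r add0r.
by apply: eq_bigr => k _; rewrite c'l.
Qed.

Local Open Scope sesquilinear_scope.

(** A unitary change of basis diagonalises the Gram matrix [A] and multiplies
    the determinant by a phase, so that the integral is [n! det A]; then
    [det A <= exp (tr A - n)] eigenvalue by eigenvalue. *)
Lemma integral_slater_le n (psi : 'I_n -> T -> R[i]) (A : 'M[R[i]]_n) :
  (forall i, measurable_fun setT (psi i)) ->
  A^t* = A ->
  (forall c : 'rV[R[i]]_n,
    \int[mu]_x (W x * nsq (\sum_i c 0 i * psi i x))%:E =
    (complex.Re ((c *m A *m c^t*) 0 0))%:E)%E ->
  (\int[tuple_measure mu n]_t (slater_weight psi t)%:E <=
   (n`!%:R * expR (complex.Re (\tr A) - n%:R))%:E)%E.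
Proof.
move=> mpsi herm gram.
have /orthomx_spectralP AE : A \is normalmx by apply/normalmxP; rewrite herm.
set P := spectralmx A in AE; set D := spectral_diag A in AE.
have Pu : P \is unitarymx by exact: spectral_unitarymx.
rewrite invmx_unitary// in AE.
have PP : P *m P^t* = 1%:M by apply/unitarymxP.
have PAP : P *m A *m P^t* = diag_mx D.
  by rewrite [X in _ *m X *m _]AE !mulmxA PP mul1mx -mulmxA PP mulmx1.
pose psi' i x := \sum_j P i j * psi j x.
have mpsi' i : measurable_fun setT (psi' i).
  by apply: measurable_complex_sum => j; apply: measurable_complexM.
pose al i := complex.Re (D 0 i).
have orth (c : 'I_n -> R[i]) :
    (\int[mu]_x (W x * nsq (\sum_i c i * psi' i x))%:E =
    (\sum_i nsq (c i) * al i)%:E)%E.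
  pose cv : 'rV[R[i]]_n := \row_i c i.
  transitivity (\int[mu]_x (W x * nsq (\sum_i (cv *m P) 0 i * psi i x))%:E)%E.
    apply: eq_integral => x _; congr (_ * nsq _)%:E.
    under eq_bigr do rewrite mulr_sumr.
    rewrite exchange_big/=; apply: eq_bigr => j _.
    by rewrite mxE mulr_suml; apply: eq_bigr => i _; rewrite mxE mulrA.
  rewrite gram trmx_mul map_mxM/= !mulmxA -(mulmxA _ P A) -(mulmxA _ (P *m A)) PAP.
  congr EFin; rewrite mxE raddf_sum/=; apply: eq_bigr => i _.
  rewrite mul_mx_diag !mxE/=.
  rewrite [LHS](_ : _ = complex.Re ((nsq (c i))%:C * D 0 i)); last first.
    by rewrite nsqC mulrAC.
  by rewrite /al; case: (D 0 i) => a b /=; rewrite mul0r subr0.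
have al0 i : 0 <= al i.
  have := orth (fun j => (j == i)%:R).
  rewrite [X in X%:E](bigD1 i)//= eqxx nsq1 mul1r big1 ?addr0; last first.
    by move=> j /negbTE ->; rewrite nsq0 mul0r.
  move=> e; rewrite -lee_fin -e; apply: integral_ge0 => x _.
  by rewrite lee_fin mulr_ge0// nsq_ge0.
have := integral_slater_orthogonal mpsi' al0 orth.
have -> : (\int[tuple_measure mu n]_t (slater_weight psi' t)%:E =
    \int[tuple_measure mu n]_t (slater_weight psi t)%:E)%E.
  have [m me] := tuple_measure_sigma_finite mu n; rewrite -me.
  apply: eq_integral => t _; congr EFin; rewrite /slater_weight; congr (_ * _).
  have -> : slater_mx psi' t = P *m slater_mx psi t.
    by apply/matrixP => i j; rewrite !mxE; apply: eq_bigr => k _; rewrite mxE.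
  rewrite det_mulmx nsqM [X in X * _](_ : _ = 1) ?mul1r//.
  apply: complexI; rewrite nsqC.
  have := congr1 determinant PP; rewrite det_mulmx det1 det_map_mx det_tr.
  by [].
move=> ->; rewrite lee_fin ler_wpM2l//.
have -> : complex.Re (\tr A) = \sum_i al i.
  have -> : \tr A = \tr (diag_mx D).
    by rewrite -PAP mxtrace_mulC mulmxA (mulmx1C PP) mul1mx.
  by rewrite mxtrace_diag raddf_sum.
have -> : \sum_i al i - n%:R = \sum_i (al i - 1).
  by rewrite sumrB sumr_const card_ord.
rewrite expR_sum; apply: ler_prod => i _; rewrite al0/=.
by have := expR_ge1Dx (al i - 1); rewrite addrC subrK.
Qed.

End slater.

(** * Orthogonal polynomials for the weight of the squared distance to a point *)

Lemma real_complexM (R : rcfType) (a b : R) : (a * b)%:C = a%:C * b%:C :> R[i].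
Proof. exact: rmorphM. Qed.

Section fock_form.
Context {R : rcfType}.
Local Notation C := R[i].
Variable v : R.
Implicit Types p q r : {poly C}.

(** Square norm of [w^j] under the Gaussian of variance [v]. *)
Definition fock_w (j : nat) : R := v ^+ j * j`!%:R.

(** Hermitian form of the complex Gaussian of variance [v] on polynomials: the
    monomials are orthogonal with square norms [fock_w]. *)
Definition fip (p q : {poly C}) : C :=
  \sum_(j < size p) p`_j * (q`_j)^*%C * (fock_w j)%:C.

Definition fnorm (p : {poly C}) : R := \sum_(j < size p) nsq p`_j * fock_w j.

Lemma fip_widen n p q : (size p <= n)%N ->
  fip p q = \sum_(j < n) p`_j * (q`_j)^*%C * (fock_w j)%:C.
Proof.
move=> pn; rewrite /fip.
rewrite (big_ord_widen _ (fun j => p`_j * (q`_j)^*%C * (fock_w j)%:C) pn).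
rewrite big_mkcond/=; apply: eq_bigr => i _; case: ltnP => // pi.
by rewrite nth_default// !mul0r.
Qed.

Lemma fip_herm p q : (fip p q)^*%C = fip q p.
Proof.
rewrite (@fip_widen (maxn (size p) (size q))) ?leq_maxl//.
rewrite (@fip_widen (maxn (size p) (size q)) q) ?leq_maxr//.
rewrite rmorph_sum; apply: eq_bigr => j _ /=.
by case: p`_j => a b; case: q`_j => c d; simpc; congr (_ +i* _); ring.
Qed.

Lemma fipDl p q r : fip (p + q) r = fip p r + fip q r.
Proof.
pose n := maxn (size p) (size q).
rewrite (@fip_widen n) ?size_polyD// (@fip_widen n p) ?leq_maxl//.
rewrite (@fip_widen n q) ?leq_maxr// -big_split/=.
by apply: eq_bigr => j _; rewrite coefD !mulrDl.
Qed.

Lemma fipZl c p q : fip (c *: p) q = c * fip p q.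
Proof.
rewrite (@fip_widen (size p)) ?size_scale_leq// mulr_sumr.
by apply: eq_bigr => j _; rewrite coefZ !mulrA.
Qed.

Lemma fipDr p q r : fip r (p + q) = fip r p + fip r q.
Proof. by rewrite -!(fip_herm _ r) fipDl rmorphD. Qed.

Lemma fipZr c p q : fip q (c *: p) = c^*%C * fip q p.
Proof. by rewrite -!(fip_herm _ q) fipZl rmorphM. Qed.

Lemma fip0l q : fip 0 q = 0.
Proof. by rewrite -(scale0r (0 : {poly C})) fipZl mul0r. Qed.

Lemma fip_suml (I : Type) (s : seq I) (P : pred I) (F : I -> {poly C}) q :
  fip (\sum_(i <- s | P i) F i) q = \sum_(i <- s | P i) fip (F i) q.
Proof. by apply: (big_morph (fip^~ q)) => [? ?|]; rewrite ?fipDl ?fip0l. Qed.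

Lemma fip_sumr (I : Type) (s : seq I) (P : pred I) (F : I -> {poly C}) q :
  fip q (\sum_(i <- s | P i) F i) = \sum_(i <- s | P i) fip q (F i).
Proof.
rewrite -fip_herm fip_suml rmorph_sum; apply: eq_bigr => i _ /=.
by rewrite fip_herm.
Qed.

Lemma fip_XX a b : fip 'X^a 'X^b = if a == b then (fock_w a)%:C else 0.
Proof.
rewrite (@fip_widen a.+1) ?size_polyXn// big_ord_recr/= big1 ?add0r.
  rewrite !coefXn eqxx mul1r; case: eqP => _; last by rewrite conjc0 mul0r.
  by rewrite conjc1 mul1r.
by move=> i _; rewrite coefXn ltn_eqF// !mul0r.
Qed.

Lemma fnormE p : (fnorm p)%:C = fip p p.
Proof.
rewrite /fnorm /fip rmorph_sum; apply: eq_bigr => j _.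
by rewrite rmorphM/= nsqC.
Qed.

Lemma fnormRe p : fnorm p = complex.Re (fip p p).
Proof. by rewrite -fnormE. Qed.

End fock_form.

Section orthogonal_polynomials.
Context {R : rcfType}.
Local Notation C := R[i].
Variables (v : R) (z : C).
Hypotheses (v0 : 0 < v) (z0 : z != 0).
Local Notation x := (nsq z).
Local Notation w := (fock_w v).

(** Pivots of the Cholesky factorisation of the Gram matrix of the normalised
    monomials for the weight [|z - w|^2]. *)
Fixpoint op_pivot (k : nat) : R :=
  match k with
  | 0 => x + v
  | k'.+1 => x + k.+1%:R * v - x * (k%:R * v) / op_pivot k'
  end.

(** Monic orthogonal polynomials for that weight. *)
Fixpoint op_poly (k : nat) : {poly C} :=
  match k with
  | 0 => 1
  | k'.+1 => 'X^k + (z * (k%:R * v / op_pivot k')%:C) *: op_poly k'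
  end.

Let x0 : 0 < x.
Proof. by rewrite lt_neqAle nsq_ge0 eq_sym nsq_eq0 z0. Qed.

Lemma fock_w_gt0 k : 0 < w k.
Proof. by rewrite mulr_gt0 ?exprn_gt0// ltr0n fact_gt0. Qed.

Lemma fock_wS k : w k.+1 = k.+1%:R * v * w k.
Proof. by rewrite /fock_w exprS factS natrM; ring. Qed.

Lemma op_pivot_ge k : x <= op_pivot k.
Proof.
elim: k => [|k IH]; first by rewrite /= lerDl ltW.
have d0 : 0 < op_pivot k by exact: lt_le_trans IH.
rewrite /= -addrA lerDl subr_ge0 ler_pdivrMr// mulrC.
rewrite ler_pM ?(ltW x0)//; first by rewrite mulr_ge0 ?(ltW v0).
by rewrite ler_pM2r// ler_nat.
Qed.

Lemma op_pivot_gt0 k : 0 < op_pivot k.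
Proof. exact: lt_le_trans (op_pivot_ge k). Qed.

(** Multiplication by [w - z]: the form [T] below is the Hermitian form for the
    weight [|z - w|^2]. *)
Definition shifted (p : {poly C}) : {poly C} := ('X - z%:P) * p.

Local Notation T p q := (fip v (shifted p) (shifted q)).

Lemma shiftedXn k : shifted 'X^k = 'X^(k.+1) - z *: 'X^k.
Proof. by rewrite /shifted mulrBl -exprS mul_polyC. Qed.

Lemma shiftedD p q : shifted (p + q) = shifted p + shifted q.
Proof. exact: mulrDr. Qed.

Lemma shiftedZ c p : shifted (c *: p) = c *: shifted p.
Proof. by rewrite /shifted -scalerAr. Qed.

(** Multiplication by [w - z] raises degrees by at most one, so the Gram matrix
    of the monomials is tridiagonal. *)
Let T_XX a b : T 'X^a 'X^b =
  if a == b then (w a.+1 + x * w a)%:C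
  else if a == b.+1 then - z * (w a)%:C
  else if a.+1 == b then - z^*%C * (w b)%:C
  else 0.
Proof.
rewrite !shiftedXn -!scaleNr !fipDl !fipDr !fipZl !fipZr !fip_XX eqSS rmorphN/=.
case: (eqVneq a b) => [<-|ab].
  rewrite [a.+1 == a]gtn_eqF// [a == a.+1]ltn_eqF// !mulr0 addr0 add0r mulrA mulrNN.
  by rewrite -nsqC -rmorphM -rmorphD.
case: (eqVneq a b.+1) => [->|ab1].
  by rewrite (gtn_eqF (ltnW _))// !mulr0 !add0r addr0.
case: (eqVneq a.+1 b) => [<-|ab2].
  by rewrite !mulr0 !addr0 add0r.
by rewrite !mulr0 !addr0.
Qed.

(** Orthogonality to lower monomials, by induction on [k]: the coefficient in
    [op_poly] cancels the single offending entry of the tridiagonal Gram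
    matrix, at [j = k - 1], and the pivot is what remains at [j = k]. *)
Lemma fip_op_poly_X k j : T (op_poly k) 'X^j =
  if (j < k)%N then 0
  else if j == k then (op_pivot k * w k)%:C
  else if j == k.+1 then - z^*%C * (w k.+1)%:C
  else 0.
Proof.
elim: k j => [|k IH] j.
  rewrite /= -(expr0 'X) T_XX.
  case: j => [|[|j]]//=.
  by rewrite fock_wS; congr (_%:C); ring.
have wS : w k.+1 != 0 by rewrite gt_eqF// fock_w_gt0.
have dk : op_pivot k != 0 by rewrite gt_eqF// op_pivot_gt0.
rewrite [op_poly _]/= shiftedD shiftedZ fipDl fipZl IH T_XX.
have [jk|] := ltnP j k.+1.
  rewrite gtn_eqF//.
  move: jk; rewrite ltnS leq_eqVlt => /predU1P[->|jk].
    rewrite !eqxx ltnn.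
    have -> : w k.+1 = k.+1%:R * v / op_pivot k * (op_pivot k * w k).
      by rewrite fock_wS; field.
    by rewrite [(_ * (op_pivot k * w k))%:C]real_complexM; ring.
  rewrite jk mulr0 addr0 eqSS (gtn_eqF jk).
  by rewrite (gtn_eqF (leqW (leqW jk))).
rewrite leq_eqVlt => /predU1P[<-|kj].
  rewrite ltnNge leqnSn/= !eqxx gtn_eqF//.
  rewrite (_ : z * _ * _ = - (x * (k.+1%:R * v / op_pivot k * w k.+1))%:C); last first.
    rewrite [(x * _)%:C]real_complexM [(_ * w k.+1)%:C]real_complexM.
    by rewrite nsqC; ring.
  rewrite -raddfB; congr (_%:C).
  by rewrite !fock_wS /=; field.
have [e1 e2 e3] : [/\ (k.+1 == j) = false, (k.+1 == j.+1) = false & (j < k)%N = false].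
  by split; lia.
have [e4 e5] : (j == k) = false /\ (j == k.+1) = false by split; lia.
rewrite e1 e2 e3 e4 e5 mulr0 addr0 [k.+2 == j]eq_sym.
by case: eqP => // ->.
Qed.

Lemma fip_op_poly_lt k l : (l < k)%N -> T (op_poly k) (op_poly l) = 0.
Proof.
elim: l => [|l IH] lk.
  by rewrite [op_poly 0]/= -(expr0 'X) fip_op_poly_X lk.
rewrite [op_poly l.+1]/= shiftedD shiftedZ fipDr fipZr IH ?mulr0 ?addr0; last exact: ltnW.
by rewrite fip_op_poly_X lk.
Qed.

Lemma fip_op_poly k l :
  T (op_poly k) (op_poly l) = if k == l then (op_pivot k * w k)%:C else 0.
Proof.
have [kl|lk|<-] := ltngtP k l.
- by rewrite -fip_herm fip_op_poly_lt// conjc0.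
- by rewrite fip_op_poly_lt.
case: k => [|k].
  have e : op_poly 0 = 'X^0 by rewrite expr0.
  by rewrite {2}e fip_op_poly_X.
have -> p : T p (op_poly k.+1) =
    T p 'X^(k.+1) + (z * (k.+1%:R * v / op_pivot k)%:C)^*%C * T p (op_poly k).
  by rewrite -fipZr -shiftedZ -fipDr -shiftedD.
rewrite fip_op_poly_lt//.
by rewrite mulr0 addr0 fip_op_poly_X ltnn eqxx.
Qed.

Lemma size_op_poly k : size (op_poly k) = k.+1.
Proof.
elim: k => [|k IH]; first by rewrite size_poly1.
rewrite /= size_polyDl size_polyXn// ltnS.
by rewrite (leq_trans (size_scale_leq _ _))// IH.
Qed.

Lemma monic_op_poly k : op_poly k \is monic.
Proof.
case: k => [|k]; first exact: monic1.
rewrite /= monicE lead_coefDl; first by rewrite lead_coefXn.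
rewrite size_polyXn (leq_ltn_trans (size_scale_leq _ _))//.
by rewrite size_op_poly.
Qed.

(** Divided by [op_pivot k], this is the square norm of [w^m] times the
    orthonormal polynomial of degree [k]. *)
Definition op_energy (m k : nat) : R := fnorm v ('X^m * op_poly k) / w k.

Lemma op_energy0 m : op_energy m 0 = w m / w 0.
Proof. by rewrite /op_energy /= mulr1 fnormRe fip_XX eqxx. Qed.

(** In [w^m p_(k+1)] the leading monomial is orthogonal to the rest, which is a
    multiple of [w^m p_k]. *)
Lemma op_energyS m k : op_energy m k.+1 =
  w (m + k.+1) / w k.+1 + x * (k.+1%:R * v) / op_pivot k ^+ 2 * op_energy m k.
Proof.
have w0 : w k != 0 by rewrite gt_eqF// fock_w_gt0.
have k0 : k.+1%:R * v != 0 by rewrite gt_eqF// mulr_gt0.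
have dk : op_pivot k != 0 by rewrite gt_eqF// op_pivot_gt0.
have orth : fip v ('X^m * op_poly k) 'X^(m + k.+1) = 0.
  rewrite (@fip_widen _ _ (m + k.+1)); last first.
    by rewrite size_Mmonic ?monic_op_poly ?monic_neq0 ?monicXn// size_polyXn size_op_poly.
  by rewrite big1// => i _; rewrite coefXn ltn_eqF// conjc0 mulr0 mul0r.
set b := z * (k.+1%:R * v / op_pivot k)%:C.
have -> : op_energy m k.+1 = (w (m + k.+1) + nsq b * fnorm v ('X^m * op_poly k)) / w k.+1.
  rewrite /op_energy; congr (_ / _); apply: complexI.
  rewrite fnormE [op_poly k.+1]/= -/b mulrDr -exprD -scalerAr.
  have pyth P Q : fip v Q P = 0 ->
      fip v (P + b *: Q) (P + b *: Q) = fip v P P + (nsq b)%:C * fip v Q Q.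
    move=> QP; rewrite fipDl (fipDr _ P) (fipDr _ P) !fipZl !fipZr QP nsqC.
    by rewrite -(fip_herm _ Q P) QP conjc0; ring.
  by rewrite (pyth _ _ orth) fip_XX eqxx -fnormE -real_complexM -raddfD.
rewrite /b nsqM nsq_real /op_energy !fock_wS.
move: k0; set c := k.+1%:R * v => k0.
by field; rewrite w0 k0 dk.
Qed.

End orthogonal_polynomials.

(** * Squared Vandermonde determinants against one-point weights *)

Section complex_normal_probability.
Context {R : realType}.
Variable v : R.

Local Notation gamma := (complex_normal v).

Let mc : measurable_fun [set: measurableTypeR R * measurableTypeR R]
  (@complex_of_pair R).
Proof. exact: measurable_complex_of_pair. Qed.

Let gamma0 : gamma set0 = 0%E.
Proof. by rewrite /complex_normal; apply: measure0. Qed.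

Let gamma_ge0 A : (0 <= gamma A)%E.
Proof. by rewrite /complex_normal; apply: measure_ge0. Qed.

Let gamma_sigma_additive : semi_sigma_additive gamma.
Proof. by rewrite /complex_normal; apply: measure_semi_sigma_additive. Qed.

HB.instance Definition _ :=
  isMeasure.Build _ _ _ gamma gamma0 gamma_ge0 gamma_sigma_additive.

Let gammaT : gamma setT = 1%E.
Proof. by rewrite /complex_normal /pushforward preimage_setT; apply: probability_setT. Qed.

HB.instance Definition _ := Measure_isProbability.Build _ _ _ gamma gammaT.

End complex_normal_probability.

Section vandermonde.
Context {R : realType}.
Local Notation C := R[i].

Definition vdm_sq n (t : n.-tuple C) : R :=
  \prod_(i < n) \prod_(j < n | (i < j)%N) nsq (tnth t i - tnth t j).

Lemma vdm_sq_ge0 n (t : n.-tuple C) : 0 <= vdm_sq t.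
Proof. by apply: prodr_ge0 => i _; apply: prodr_ge0 => j _; exact: nsq_ge0. Qed.

Lemma measurable_vdm_sq n : measurable_fun setT (@vdm_sq n).
Proof.
apply: measurable_prod => i _.
rewrite (_ : (fun t => _) = fun t : n.-tuple C => \prod_(j < n)
    (if (i < j)%N then nsq (tnth t i - tnth t j) else 1)); last first.
  by apply/funext => t; rewrite big_mkcond.
apply: measurable_prod => j _; case: (ltnP i j) => _; last exact: measurable_cst.
by apply: measurable_nsq; apply: measurable_complexB; exact: measurable_tnth.
Qed.

(** The coefficient matrix of polynomials of degrees [0, 1, ...] is triangular. *)
Lemma det_poly_mx n (p : nat -> {poly C}) (t : n.-tuple C) :
  (forall k, size (p k) <= k.+1)%N ->
  nsq (\det (\matrix_(i < n, j < n) (p i).[tnth t j])) =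
  (\prod_(k < n) nsq (p k)`_k) * vdm_sq t.
Proof.
move=> sp.
pose L : 'M[C]_n := \matrix_(i, k) (p i)`_k.
have -> : \matrix_(i < n, j < n) (p i).[tnth t j] =
    L *m Vandermonde n (\row_j tnth t j).
  apply/matrixP => i j; rewrite !mxE.
  rewrite (@horner_coef_wide _ n); last exact: leq_trans (sp i) (ltn_ord i).
  by apply: eq_bigr => k _; rewrite !mxE.
rewrite det_mulmx nsqM; congr (_ * _).
  rewrite det_trig; first by rewrite nsq_prod; apply: eq_bigr => k _; rewrite mxE.
  apply/is_trig_mxP => i j ij; rewrite mxE nth_default//.
  exact: leq_trans (sp i) ij.
rewrite det_Vandermonde nsq_prod; apply: eq_bigr => i _.
by rewrite nsq_prod; apply: eq_bigr => j _; rewrite !mxE -nsqN opprB.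
Qed.

Lemma horner_sum_scale n (c : 'I_n -> C) (p : 'I_n -> {poly C}) (w : C) :
  (\sum_i c i *: p i).[w] = \sum_i c i * (p i).[w].
Proof. by rewrite horner_sum; apply: eq_bigr => i _; rewrite hornerZ. Qed.

End vandermonde.

Section vandermonde_integral.
Context {R : realType}.
Local Notation C := R[i].
Variables (v : R) (z : C) (n : nat).
Hypotheses (v0 : 0 < v) (z0 : z != 0).
Local Notation gamma := (complex_normal v).
Local Notation delta := (op_pivot v z).
Local Notation fw := (fock_w v).

Let Dk k : R := delta k * fw k.

Let Dk_gt0 k : 0 < Dk k.
Proof. by rewrite mulr_gt0 ?op_pivot_gt0 ?fock_w_gt0. Qed.

(** Normalised to be orthonormal for the weight [|z - w|^2], so that the Gram
    matrix [A] below is the identity plus the contributions of [k1] and [k2]. *)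
Let np k : {poly C} := (Num.sqrt (Dk k))^-1%:C *: op_poly v z k.

Let psi (k : 'I_n) (w : C) : C := (np k).[w].

Let mpsi k : measurable_fun setT (psi k).
Proof. by apply: measurable_horner; exact: measurable_id. Qed.

Let nsq_scal k : nsq (Num.sqrt (Dk k))^-1%:C = (Dk k)^-1.
Proof. by rewrite nsq_real exprVn sqr_sqrtr// ltW. Qed.

Let slaterE W (t : n.-tuple C) : slater_weight W psi t =
  (\prod_(k < n) (Dk k)^-1) * ((\prod_(k < n) W (tnth t k)) * vdm_sq t).
Proof.
rewrite /slater_weight /slater_mx det_poly_mx; last first.
  by move=> k; rewrite (leq_trans (size_scale_leq _ _))// size_op_poly.
rewrite [in RHS]mulrCA; congr (_ * (_ * _)); apply: eq_bigr => k _.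
rewrite coefZ nsqM nsq_scal.
have /monicP := monic_op_poly v z k.
by rewrite lead_coefE size_op_poly => ->; rewrite nsq1 mulr1.
Qed.

Let Kn := \prod_(k < n) (Dk k)^-1.
Let Kn_gt0 : 0 < Kn.
Proof. by apply: prodr_gt0 => k _; rewrite invr_gt0. Qed.

Let Kn_neq0 : Kn != 0. Proof. by rewrite gt_eqF. Qed.

Let fip_expand (c : 'I_n -> C) (p : 'I_n -> {poly C}) (L : {poly C} -> {poly C}) :
    (forall q r, L (q + r) = L q + L r) -> (forall a q, L (a *: q) = a *: L q) ->
  fip v (L (\sum_i c i *: p i)) (L (\sum_i c i *: p i)) =
  \sum_j \sum_i c i * fip v (L (p i)) (L (p j)) * (c j)^*%C.
Proof.
move=> LD LZ.
have L0 : L 0 = 0 by have := LZ 0 0; rewrite !scale0r.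
rewrite (big_morph L LD L0) fip_sumr; apply: eq_bigr => j _.
rewrite LZ fipZr fip_suml mulr_sumr; apply: eq_bigr => i _.
by rewrite LZ fipZl mulrC.
Qed.

Section weight.
Variables (k1 k2 : R) (m : nat).
Hypothesis k20 : 0 <= k2.

Definition tilted_weight (w : C) : R := nsq (z - w) + k1 + k2 * nsq w ^+ m.

Hypothesis W0 : forall w, 0 <= tilted_weight w.

Let F (p q : {poly C}) : C :=
  fip v (shifted z p) (shifted z q) + k1%:C * fip v p q +
  k2%:C * fip v ('X^m * p) ('X^m * q).

Let F_herm p q : (F p q)^*%C = F q p.
Proof.
rewrite /F !rmorphD /= !(rmorphM (@conjc R)) /= !fip_herm.
by rewrite !oppr0.
Qed.

Let F_sum (c : 'I_n -> C) (p : 'I_n -> {poly C}) :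
  F (\sum_i c i *: p i) (\sum_i c i *: p i) =
  \sum_j \sum_i c i * F (p i) (p j) * (c j)^*%C.
Proof.
have E := fip_expand c p.
rewrite /F E; [|exact: shiftedD|exact: shiftedZ].
rewrite (E id)// (E (fun q => 'X^m * q)); last 2 first.
- by move=> q r; rewrite mulrDr.
- by move=> a q; rewrite scalerAr.
rewrite !mulr_sumr -!big_split/=; apply: eq_bigr => j _.
rewrite !mulr_sumr -!big_split/=; apply: eq_bigr => i _.
by ring.
Qed.

Let mW : measurable_fun setT tilted_weight.
Proof.
apply: measurable_funD.
  apply: measurable_funD; last exact: measurable_cst.
  apply: measurable_nsq; apply: measurable_complexB; first exact: measurable_cst.
  exact: measurable_id.
apply: measurable_funM; first exact: measurable_cst.
by apply: measurable_funX; apply: measurable_nsq; exact: measurable_id.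
Qed.

Let integral_nsq (q : {poly C}) :
  (\int[gamma]_w (nsq q.[w])%:E = (fnorm v q)%:E)%E.
Proof. exact: integral_nsq_horner. Qed.

Let mh (q : {poly C}) : measurable_fun setT (fun w : C => nsq q.[w]).
Proof. by apply: measurable_nsq; apply: measurable_horner; exact: measurable_id. Qed.

Let integral_weight (q : {poly C}) :
  (\int[gamma]_w (tilted_weight w * nsq q.[w])%:E = (complex.Re (F q q))%:E)%E.
Proof.
have [a [b [a0 b0 ab]]] : exists a b : R, [/\ 0 <= a, 0 <= b & a - b = k1].
  have [h|h] := leP 0 k1; first by exists k1, 0; rewrite subr0.
  by exists 0, (- k1); rewrite oppr_ge0 (ltW h) sub0r opprK.
have Zl (c : R) (p : {poly C}) : 0 <= c ->
    (\int[gamma]_w (c * nsq p.[w])%:E = (c * fnorm v p)%:E)%E.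
  move=> c0; under eq_integral do rewrite EFinM.
  rewrite ge0_integralZl//; first by rewrite integral_nsq EFinM.
  - by apply/measurable_EFinP; exact: mh.
  - by move=> w _; rewrite lee_fin nsq_ge0.
have mZ (c : R) p : measurable_fun setT (fun w : C => (c * nsq p.[w])%:E).
  by apply/measurable_EFinP; apply: measurable_funM; [exact: measurable_cst|exact: mh].
have nZ (c : R) p w : 0 <= c -> (0 <= (c * nsq p.[w])%:E)%E.
  by move=> c0; rewrite lee_fin mulr_ge0// nsq_ge0.
have mWq : measurable_fun setT (fun w : C => (tilted_weight w * nsq q.[w])%:E).
  by apply/measurable_EFinP; apply: measurable_funM.
have nWq w : (0 <= (tilted_weight w * nsq q.[w])%:E)%E.
  by rewrite lee_fin mulr_ge0// nsq_ge0.
have e : (\int[gamma]_w (tilted_weight w * nsq q.[w])%:E + (b * fnorm v q)%:E =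
    (fnorm v (shifted z q) + a * fnorm v q + k2 * fnorm v ('X^m * q))%:E)%E.
  rewrite -Zl// -ge0_integralD//; last by move=> w _; exact: nZ.
  rewrite !EFinD -!Zl// -integral_nsq.
  rewrite -ge0_integralD//; last 3 first.
  - by move=> w _; rewrite lee_fin nsq_ge0.
  - by apply/measurable_EFinP; exact: mh.
  - by move=> w _; exact: nZ.
  rewrite -ge0_integralD//; last 3 first.
  - by move=> w _; rewrite adde_ge0// ?nZ// lee_fin nsq_ge0.
  - by apply: emeasurable_funD => //; apply/measurable_EFinP; exact: mh.
  - by move=> w _; exact: nZ.
  apply: eq_integral => w _; rewrite -!EFinD; congr EFin.
  rewrite /tilted_weight -ab /shifted !hornerM hornerD hornerX hornerN hornerC hornerXn.
  by rewrite !nsqM nsqX -(nsqN (w - z)) opprB; ring.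
have -> : complex.Re (F q q) =
    fnorm v (shifted z q) + a * fnorm v q + k2 * fnorm v ('X^m * q) - b * fnorm v q.
  rewrite /F -!fnormE -!real_complexM -!raddfD/= -ab; ring.
move: e; case: (\int[gamma]_w _)%E => [r|//|//].
by rewrite -EFinD => -[<-]; rewrite addrK.
Qed.

Let A : 'M[C]_n := \matrix_(i, j) F (np i) (np j).

Local Open Scope sesquilinear_scope.

Let gram (c : 'rV[C]_n) :
  (\int[gamma]_w (tilted_weight w * nsq (\sum_i c 0%R i * psi i w))%:E =
   (complex.Re ((c *m A *m c^t*) 0%R 0%R))%:E)%E.
Proof.
under eq_integral do rewrite -horner_sum_scale.
rewrite integral_weight F_sum; congr (complex.Re _)%:E.
rewrite mxE; apply: eq_bigr => j _; rewrite !mxE mulr_suml; apply: eq_bigr => i _.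
by rewrite mxE.
Qed.

Let np_F k : complex.Re (F (np k) (np k)) =
  1 + k1 * (op_energy v z 0 k / delta k) + k2 * (op_energy v z m k / delta k).
Proof.
have e L : (forall a q, L (a *: q) = a *: L q) ->
    fip v (L (np k)) (L (np k)) = ((Dk k)^-1 * fnorm v (L (op_poly v z k)))%:C.
  move=> LZ; rewrite /np LZ fipZl fipZr mulrA -nsqC nsq_scal.
  by rewrite -fnormE -real_complexM.
rewrite /F e; last exact: shiftedZ.
rewrite (e id)// (e (fun q => 'X^m * q)); last by move=> a q; rewrite scalerAr.
rewrite -!real_complexM -!raddfD/=.
have -> : fnorm v (shifted z (op_poly v z k)) = Dk k.
  by rewrite fnormRe fip_op_poly// eqxx.
have d0 : delta k != 0 by rewrite gt_eqF ?op_pivot_gt0.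
have w0 : fw k != 0 by rewrite gt_eqF ?fock_w_gt0.
rewrite /op_energy expr0 mul1r /Dk; field.
by rewrite d0 w0.
Qed.

Lemma integral_tilted_le :
  (\int[tuple_measure gamma n]_t
     ((\prod_(k < n) tilted_weight (tnth t k)) * vdm_sq t)%:E <=
   (Kn^-1 * n`!%:R * expR (k1 * (\sum_(k < n) op_energy v z 0 k / delta k) +
                 k2 * (\sum_(k < n) op_energy v z m k / delta k)))%:E)%E.
Proof.
have [g ge] := tuple_measure_sigma_finite gamma n.
have := @integral_slater_le _ _ _ gamma tilted_weight mW W0 n psi A mpsi _ gram.
have -> : A^t* = A.
  by apply/matrixP => i j; rewrite !mxE; exact: F_herm.
move=> /(_ erefl).
have -> : complex.Re (\tr A) - n%:R =
    k1 * (\sum_(k < n) op_energy v z 0 k / delta k) +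
    k2 * (\sum_(k < n) op_energy v z m k / delta k).
  rewrite /mxtrace raddf_sum/=.
  under eq_bigr do rewrite mxE np_F.
  rewrite !big_split/= sumr_const card_ord -!mulr_sumr; ring.
rewrite -ge; under eq_integral do rewrite slaterE EFinM.
rewrite ge0_integralZl//; last 3 first.
- apply/measurable_EFinP; apply: measurable_funM; last exact: measurable_vdm_sq.
  exact: measurable_prod_tuple.
- by move=> t _; rewrite lee_fin mulr_ge0 ?vdm_sq_ge0// prodr_ge0.
- by rewrite lee_fin ltW.
rewrite -/Kn; set I := (X in (Kn%:E * X)%E) => h.
rewrite [leLHS](_ : _ = (Kn^-1%:E * (Kn%:E * I))%E); last first.
  by rewrite muleA -EFinM mulVf// mul1e.
rewrite -mulrA [leRHS]EFinM.
by rewrite lee_wpmul2l// lee_fin invr_ge0 ltW.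
Qed.

End weight.

Lemma integral_vdm :
  (\int[tuple_measure gamma n]_t
     ((\prod_(k < n) nsq (z - tnth t k)) * vdm_sq t)%:E = (Kn^-1 * n`!%:R)%:E)%E.
Proof.
have [g ge] := tuple_measure_sigma_finite gamma n.
have mW0 : measurable_fun setT (fun w : C => nsq (z - w)).
  apply: measurable_nsq; apply: measurable_complexB; first exact: measurable_cst.
  exact: measurable_id.
have orth (c : 'I_n -> C) :
    (\int[gamma]_w (nsq (z - w) * nsq (\sum_i c i * psi i w))%:E =
     (\sum_i nsq (c i) * 1)%:E)%E.
  set q := \sum_i c i *: np i.
  transitivity (\int[gamma]_w (nsq (shifted z q).[w])%:E)%E.
    apply: eq_integral => w _; rewrite /q -horner_sum_scale /shifted hornerM nsqM.
    by rewrite hornerD hornerX hornerN hornerC -nsqN opprB.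
  rewrite integral_nsq_horner// -[X in X%:E]/(fnorm v (shifted z q)) fnormRe fip_expand; last 2 first.
  - exact: shiftedD.
  - exact: shiftedZ.
  congr EFin; rewrite raddf_sum; apply: eq_bigr => j _.
  rewrite (bigD1 j)//= big1 ?addr0.
    have e1 : complex.Re (c j * (c j)^*%C) = nsq (c j) * 1 by rewrite -nsqC mulr1.
    rewrite -e1 mulrAC shiftedZ fipZl fipZr fip_op_poly// eqxx.
    rewrite [X in _ * X](_ : _ = 1) ?mulr1//.
    by rewrite mulrA -nsqC nsq_scal -real_complexM -/(Dk j) mulVf// gt_eqF.
  move=> i ij; rewrite !shiftedZ fipZl fipZr fip_op_poly//.
  by rewrite val_eqE (negbTE ij) !mulr0 mul0r.
have := @integral_slater_orthogonal _ _ _ gamma _ mW0 (fun w => nsq_ge0 (z - w)) n psi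
  (fun=> 1) mpsi (fun=> ler01) orth.
rewrite -ge; under eq_integral do rewrite slaterE EFinM.
rewrite ge0_integralZl//; last 3 first.
- apply/measurable_EFinP; apply: measurable_funM; last exact: measurable_vdm_sq.
  exact: (measurable_prod_tuple mW0).
- by move=> t _; rewrite lee_fin mulr_ge0 ?vdm_sq_ge0// prodr_ge0// => i _; exact: nsq_ge0.
- by rewrite lee_fin ltW.
rewrite -/Kn big1// mulr1; set I := (X in (Kn%:E * X)%E) => h.
rewrite [LHS](_ : _ = (Kn^-1%:E * (Kn%:E * I))%E); last first.
  by rewrite muleA -EFinM mulVf// mul1e.
by rewrite h EFinM.
Qed.

(** Against the eigenvalue density, an expectation of a product of one-point
    functions is at most the exponential of the corresponding trace. *)
Theorem tilted_vandermonde : exists2 Z : R, 0 < Z &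
  (\int[tuple_measure gamma n]_t
     ((\prod_(k < n) nsq (z - tnth t k)) * vdm_sq t)%:E = Z%:E)%E /\
  forall (k1 k2 : R) (m : nat), 0 <= k2 -> (forall w, 0 <= tilted_weight k1 k2 m w) ->
  (\int[tuple_measure gamma n]_t
     ((\prod_(k < n) tilted_weight k1 k2 m (tnth t k)) * vdm_sq t)%:E <=
   (Z * expR (k1 * (\sum_(k < n) op_energy v z 0 k / delta k) +
              k2 * (\sum_(k < n) op_energy v z m k / delta k)))%:E)%E.
Proof.
exists (Kn^-1 * n`!%:R).
  by rewrite mulr_gt0 ?invr_gt0// ltr0n fact_gt0.
by split; [exact: integral_vdm|move=> k1 k2 m k20 W0; exact: integral_tilted_le].
Qed.

End vandermonde_integral.

(** * Linear forms in complex Gaussian variables *)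

Section tuple_cat.
Context d (T : measurableType d) (R : realType).
Variable mu : {sigma_finite_measure set T -> \bar R}.

Lemma measurable_tuple_cat a b :
  measurable_fun setT (fun p : a.-tuple T * b.-tuple T => [tuple of p.1 ++ p.2]).
Proof.
apply/measurable_fun_tnthP => i.
case: (split_ordP i) => j ->.
  rewrite (_ : _ \o _ = fun p => tnth p.1 j); last first.
    by apply/funext => p /=; rewrite tnth_lshift.
  exact: measurableT_comp (measurable_tnth j) measurable_fst.
rewrite (_ : _ \o _ = fun p => tnth p.2 j); last first.
  by apply/funext => p /=; rewrite tnth_rshift.
exact: measurableT_comp (measurable_tnth j) measurable_snd.
Qed.

Lemma ge0_integral_tuple_measureD a b (f : (a + b).-tuple T -> \bar R) :
  measurable_fun setT f -> (forall t, 0 <= f t)%E ->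
  (\int[tuple_measure mu (a + b)]_t f t =
   \int[tuple_measure mu a]_s \int[tuple_measure mu b]_t f [tuple of s ++ t])%E.
Proof.
have [mb mbE] := tuple_measure_sigma_finite mu b.
elim: a f => [|a IH] f mf f0.
  rewrite ge0_integral_tuple_measure0.
  - rewrite -mbE; apply: eq_integral => t _; congr (f _); exact: val_inj.
  - rewrite -mbE.
    apply: (@measurable_fun_fubini_tonelli_F _ _ _ _ _ mb
      (fun p : 0.-tuple T * b.-tuple T => f [tuple of p.1 ++ p.2])) => //.
    exact: measurableT_comp mf (@measurable_tuple_cat 0 b).
  - by move=> t; rewrite -mbE; apply: integral_ge0.
have mf' x : measurable_fun setT (fun t : (a + b).-tuple T => f [tuple of x :: t]).
  by apply: measurableT_comp mf _; apply: measurable_cons.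
transitivity (\int[mu]_x \int[tuple_measure mu (a + b)]_t f [tuple of x :: t])%E.
  exact: ge0_integral_tuple_measureS.
transitivity (\int[mu]_x \int[tuple_measure mu a]_s \int[tuple_measure mu b]_t
    f [tuple of (x :: s) ++ t])%E.
  apply: eq_integral => x _.
  apply: (etrans (IH (fun t => f [tuple of x :: t]) (mf' x) (fun t => f0 _))).
  have [ma maE] := tuple_measure_sigma_finite mu a; rewrite -maE -mbE.
  apply: eq_integral => s _; apply: eq_integral => t _; congr (f _); exact: val_inj.
rewrite ge0_integral_tuple_measureS//.
- rewrite -mbE.
  apply: (@measurable_fun_fubini_tonelli_F _ _ _ _ _ mb
    (fun p : a.+1.-tuple T * b.-tuple T => f [tuple of p.1 ++ p.2])) => //.
  exact: measurableT_comp mf (@measurable_tuple_cat a.+1 b).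
- by move=> t; rewrite -mbE; apply: integral_ge0.
Qed.

End tuple_cat.

Section gaussian_linear_forms.
Context {R : realType}.
Local Notation C := R[i].
Variable v : R.
Hypothesis v0 : 0 < v.
Local Notation gamma := (complex_normal v).

(** The polynomial [(a + c X) ^+ k] in [integral_nsq_horner]. *)
Lemma integral_affine_moment (a c : C) k :
  (\int[gamma]_x (nsq (a + c * x) ^+ k)%:E =
   (\sum_(j < k.+1) nsq a ^+ (k - j) * (v * nsq c) ^+ j * ('C(k, j) ^ 2 * j`!)%:R)%:E)%E.
Proof.
pose q : {poly C} := (a%:P + c *: 'X) ^+ k.
have qw w : nsq (a + c * w) ^+ k = nsq q.[w].
  by rewrite /q horner_exp nsqX hornerD hornerC hornerZ hornerX.
under eq_integral do rewrite qw.
have qE : q = \poly_(j < k.+1) (a ^+ (k - j) * c ^+ j *+ 'C(k, j)).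
  rewrite /q exprDn poly_def; apply: eq_bigr => j _.
  by rewrite exprZn -polyC_exp mul_polyC scalerA scalerMnl.
rewrite integral_nsq_horner//; congr EFin.
rewrite (_ : \sum_(j < size q) _ = \sum_(j < k.+1) nsq q`_j * (v ^+ j * j`!%:R)); last first.
  have sq : (size q <= k.+1)%N by rewrite qE size_poly.
  rewrite (big_ord_widen _ (fun j => nsq q`_j * (v ^+ j * j`!%:R)) sq) big_mkcond/=.
  apply: eq_bigr => i _; case: ltnP => // qi.
  by rewrite nth_default// nsq0 mul0r.
apply: eq_bigr => j _; rewrite qE coef_poly ltn_ord.
rewrite -mulr_natr !nsqM !nsqX [nsq _%:R](_ : _ = 'C(k, j)%:R ^+ 2); last first.
  by rewrite -(rmorph_nat (real_complex R)) nsq_real.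
by rewrite exprMn natrM natrX; ring.
Qed.

(** The identity that makes the binomial sum of [integral_affine_moment]
    collapse when the constant term is itself a Gaussian. *)
Lemma bin_sq_fact k j : (j <= k)%N ->
  ('C(k, j) ^ 2 * j`! * (k - j)`! = 'C(k, j) * k`!)%N.
Proof. by move=> jk; rewrite -[in RHS](bin_fact jk) -mulnn; ring. Qed.

Let sqf m (c : seq C) (s : m.-tuple C) k : R := nsq (\sum_(i < m) c`_i * tnth s i) ^+ k.

Let msqf m (c : seq C) k : measurable_fun setT (fun s : m.-tuple C => sqf c s k).
Proof.
apply: measurable_funX; apply: measurable_nsq; apply: measurable_complex_sum => i.
by apply: measurable_complexM; [exact: measurable_cst|exact: measurable_tnth].
Qed.

Let sqf_ge0 m (c : seq C) (s : m.-tuple C) k : 0 <= sqf c s k.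
Proof. by rewrite exprn_ge0 ?nsq_ge0. Qed.

(** One variable at a time: adding an independent Gaussian to a Gaussian adds the
    variances, by [bin_sq_fact] and the binomial formula. *)
Lemma integral_linear_moment m (c : seq C) k :
  (\int[tuple_measure gamma m]_s (nsq (\sum_(i < m) c`_i * tnth s i) ^+ k)%:E =
   (k`!%:R * (v * \sum_(i < m) nsq c`_i) ^+ k)%:E)%E.
Proof.
elim: m c k => [|m IH] c k.
  rewrite ge0_integral_tuple_measure0; last 2 first.
  - by apply/measurable_EFinP; exact: msqf.
  - by move=> t; rewrite lee_fin; exact: sqf_ge0.
  by rewrite !big_ord0 nsq0 mulr0; case: k => [|k]; rewrite ?expr0 ?mulr1// !expr0n/= mulr0.
have [g gE] := tuple_measure_sigma_finite gamma m.
rewrite ge0_integral_tuple_measureSr; last 2 first.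
- by apply/measurable_EFinP; exact: msqf.
- by move=> t; rewrite lee_fin; exact: sqf_ge0.
have step (s : m.-tuple C) :
    (\int[gamma]_x (nsq (\sum_(i < m.+1) c`_i * tnth [tuple of x :: s] i) ^+ k)%:E =
     \sum_(j < k.+1) ((v * nsq c`_0) ^+ j * ('C(k, j) ^ 2 * j`!)%:R *
       sqf (behead c) s (k - j))%:E)%E.
  rewrite sumEFin.
  transitivity (\int[gamma]_x (nsq (\sum_(i < m) (behead c)`_i * tnth s i + c`_0 * x) ^+ k)%:E)%E.
    apply: eq_integral => x _; congr (nsq _ ^+ _)%:E.
    rewrite big_ord_recl tnth0 addrC; congr (_ + _); apply: eq_bigr => i _.
    by rewrite tnthS nth_behead.
  rewrite integral_affine_moment; congr EFin; apply: eq_bigr => j _.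
  by rewrite /sqf; ring.
have IHg i : (\int[g]_s (sqf (behead c) s i)%:E =
    (i`!%:R * (v * \sum_(i < m) nsq (behead c)`_i) ^+ i)%:E)%E.
  by rewrite gE; exact: IH.
rewrite -gE; under eq_integral do rewrite step.
have mj (j : 'I_k.+1) : measurable_fun setT (fun s : m.-tuple C =>
    ((v * nsq c`_0) ^+ j * ('C(k, j) ^ 2 * j`!)%:R * sqf (behead c) s (k - j))%:E).
  apply/measurable_EFinP; apply: measurable_funM; first exact: measurable_cst.
  exact: msqf.
have pj (j : 'I_k.+1) : 0 <= (v * nsq c`_0) ^+ j * ('C(k, j) ^ 2 * j`!)%:R :> R.
  by rewrite mulr_ge0// exprn_ge0// mulr_ge0 ?nsq_ge0// ltW.
rewrite ge0_integral_sum//; last by move=> j s _; rewrite lee_fin mulr_ge0.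
have ij (j : 'I_k.+1) : (\int[g]_s ((v * nsq c`_0) ^+ j * ('C(k, j) ^ 2 * j`!)%:R *
    sqf (behead c) s (k - j))%:E =
    (k`!%:R * ((v * \sum_(i < m) nsq (behead c)`_i) ^+ (k - j) * (v * nsq c`_0) ^+ j *+ 'C(k, j)))%:E)%E.
  under eq_integral do rewrite EFinM.
  rewrite ge0_integralZl//; last 3 first.
  - by apply/measurable_EFinP; exact: msqf.
  - by move=> s _; rewrite lee_fin.
  - by rewrite lee_fin.
  rewrite IHg -EFinM; congr EFin.
  have := bin_sq_fact (ltn_ord j : (j <= k)%N).
  move=> /(congr1 (fun n => n%:R : R)); rewrite !natrM => e.
  set A := (_ ^+ j); set B := (_ ^+ (k - j)).
  transitivity (A * B * ('C(k, j)%:R * 'C(k, j)%:R * j`!%:R * (k - j)`!%:R)); first by ring.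
  by rewrite e -[_ *+ 'C(k, j)]mulr_natr; ring.
under eq_bigr do rewrite ij.
rewrite sumEFin -mulr_sumr -exprDn; congr (_ * _ ^+ _)%:E.
rewrite -mulrDr big_ord_recl addrC; congr (_ * (_ + _)).
by apply: eq_bigr => i _; rewrite nth_behead.
Qed.

(** Expectation of [p] of an exponential variable of mean [u]. *)
Definition exp_expect (p : {poly R}) (u : R) : R := \sum_(k < size p) p`_k * (k`!%:R * u ^+ k).

Lemma integral_linear_poly m (c : seq C) (p : {poly R}) :
  (forall x, 0 <= x -> 0 <= p.[x]) ->
  (\int[tuple_measure gamma m]_s (p.[nsq (\sum_(i < m) c`_i * tnth s i)])%:E =
   (exp_expect p (v * \sum_(i < m) nsq c`_i))%:E)%E.
Proof.
move=> p0; have [g gE] := tuple_measure_sigma_finite gamma m; rewrite -gE.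
have lg k : (\int[g]_s (sqf c s k)%:E =
    (k`!%:R * (v * \sum_(i < m) nsq c`_i) ^+ k)%:E)%E.
  by rewrite gE; exact: integral_linear_moment.
have imon k : g.-integrable setT (fun s : m.-tuple C => (sqf c s k)%:E).
  apply/integrableP; split; first by apply/measurable_EFinP; exact: msqf.
  under eq_integral do rewrite /= ger0_norm//.
  by rewrite lg ltry.
have e n : g.-integrable setT (fun s => (\sum_(k < n) p`_k * sqf c s k)%:E) /\
    (\int[g]_s (\sum_(k < n) p`_k * sqf c s k)%:E =
     (\sum_(k < n) p`_k * (k`!%:R * (v * \sum_(i < m) nsq c`_i) ^+ k))%:E)%E.
  elim: n => [|n [IH1 IH2]].
    rewrite big_ord0; split.
      rewrite (_ : (fun x => _) = cst 0%E); first exact: integrable0.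
      by apply/funext => x; rewrite big_ord0.
    by rewrite integral0_eq// => x _; rewrite big_ord0.
  have I : g.-integrable setT (fun s : m.-tuple C => (p`_n * sqf c s n)%:E).
    by under eq_fun do rewrite EFinM; apply: integrableZl.
  split.
    by under eq_fun do rewrite big_ord_recr/= EFinD; exact: integrableD.
  under eq_integral do rewrite big_ord_recr/= EFinD.
  rewrite integralD// IH2 big_ord_recr/= EFinD; congr (_ + _)%E.
  under eq_integral do rewrite EFinM.
  rewrite integralZl//.
  by rewrite lg EFinM.
have [_ <-] := e (size p).
by apply: eq_integral => s _; rewrite horner_coef.
Qed.

End gaussian_linear_forms.

(** * Left eigenvectors of Gaussian triangular matrices *)

Section left_eigenvector.
Context {R : realType}.
Local Notation C := R[i].
Implicit Types (bs ls ts : seq C) (l z : C).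

Definition column_form bs ts : C := \sum_(i < size bs) bs`_i * ts`_i.

(** For [bs = [:: 1]], the row [b] with first entry [1] solving [b T = z b], where
    [T] is triangular with diagonal [z :: ls] and strictly upper entries [ts],
    listed column after column. *)
Fixpoint left_vec z bs ls ts : seq C :=
  if ls is l :: ls' then
    left_vec z (rcons bs (column_form bs ts / (z - l))) ls' (drop (size bs) ts)
  else bs.

Definition sqnorm bs : R := \sum_(b <- bs) nsq b.

Fixpoint increment_prod (f : R -> R) z bs ls ts : R :=
  if ls is l :: ls' then
    f (nsq (column_form bs ts / (z - l)) / sqnorm bs) *
    increment_prod f z (rcons bs (column_form bs ts / (z - l))) ls' (drop (size bs) ts)
  else 1.

Fixpoint triangle_size (j k : nat) : nat :=
  if k is k'.+1 then j + triangle_size j.+1 k' else 0.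

Lemma sqnorm_ge0 bs : 0 <= sqnorm bs.
Proof. by apply: sumr_ge0 => b _; exact: nsq_ge0. Qed.

Lemma sqnorm_rcons bs b : sqnorm (rcons bs b) = sqnorm bs + nsq b.
Proof. by rewrite /sqnorm -cats1 big_cat big_seq1. Qed.

Lemma sqnorm_rcons_gt0 bs b : 0 < sqnorm bs -> 0 < sqnorm (rcons bs b).
Proof. by move=> h; rewrite sqnorm_rcons ltr_wpDr ?nsq_ge0. Qed.

(** A new entry multiplies the squared norm by one plus its relative increment,
    which turns the norm into a product over columns. *)
Lemma sqnorm_left_vec z bs ls ts : 0 < sqnorm bs ->
  sqnorm (left_vec z bs ls ts) =
  sqnorm bs * increment_prod (fun x => 1 + x) z bs ls ts.
Proof.
elim: ls bs ts => [|l ls IH] bs ts b0 /=; first by rewrite mulr1.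
rewrite IH ?sqnorm_rcons_gt0// mulrA; congr (_ * _).
by rewrite sqnorm_rcons mulrDr mulr1 mulrCA divff ?mulr1// gt_eqF.
Qed.

Lemma increment_prod_ge0 f z bs ls ts : (forall x, 0 <= x -> 0 <= f x) ->
  0 <= increment_prod f z bs ls ts.
Proof.
move=> f0; elim: ls bs ts => [|l ls IH] bs ts //=.
by rewrite mulr_ge0// f0// divr_ge0 ?nsq_ge0 ?sqnorm_ge0.
Qed.

Lemma le_increment_prod f g z bs ls ts :
  (forall x, 0 <= x -> 0 <= f x <= g x) ->
  increment_prod f z bs ls ts <= increment_prod g z bs ls ts.
Proof.
move=> fg; elim: ls bs ts => [|l ls IH] bs ts //=.
have h : 0 <= nsq (column_form bs ts / (z - l)) / sqnorm bs.
  by rewrite divr_ge0 ?nsq_ge0 ?sqnorm_ge0.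
have /andP[f0 le] := fg _ h.
by apply: ler_pM => //; apply: increment_prod_ge0 => x /fg /andP[].
Qed.

Lemma increment_prodX f z bs ls ts s :
  increment_prod (fun x => f x ^+ s) z bs ls ts = increment_prod f z bs ls ts ^+ s.
Proof.
elim: ls bs ts => [|l ls IH] bs ts /=; first by rewrite expr1n.
by rewrite IH exprMn.
Qed.

Lemma increment_prodV f z bs ls ts :
  increment_prod (fun x => (f x)^-1) z bs ls ts = (increment_prod f z bs ls ts)^-1.
Proof.
elim: ls bs ts => [|l ls IH] bs ts /=; first by rewrite invr1.
by rewrite IH invfM.
Qed.

Lemma measurable_funrV d (T : measurableType d) (f : T -> R) :
  measurable_fun setT f -> measurable_fun setT (fun x => (f x)^-1).
Proof.
move=> mf; rewrite (_ : (fun x => _) = fun x => complex.Re ((f x)%:C^-1 : C)).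
  apply: measurable_Re; apply: measurable_complexV.
  by apply/measurable_complexP; split=> //=; exact: measurable_cst.
by apply/funext => x; rewrite -(fmorphV (real_complex R)).
Qed.

Lemma measurable_column_form d (T : measurableType d) (bs ts : seq (T -> C)) :
  (forall i, measurable_fun setT (fun x => [seq b x | b <- bs]`_i)) ->
  (forall i, measurable_fun setT (fun x => [seq t x | t <- ts]`_i)) ->
  measurable_fun setT (fun x => column_form [seq b x | b <- bs] [seq t x | t <- ts]).
Proof.
move=> mb mt; rewrite /column_form.
rewrite (_ : (fun x => _) = fun x =>
    \sum_(i < size bs) [seq b x | b <- bs]`_i * [seq t x | t <- ts]`_i).
  by apply: measurable_complex_sum => i; exact: measurable_complexM.
by apply/funext => x; rewrite size_map.
Qed.

Lemma measurable_sqnorm d (T : measurableType d) (bs : seq (T -> C)) :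
  (forall i, measurable_fun setT (fun x => [seq b x | b <- bs]`_i)) ->
  measurable_fun setT (fun x => sqnorm [seq b x | b <- bs]).
Proof.
move=> mb; rewrite (_ : (fun x => _) = fun x =>
    \sum_(i < size bs) nsq [seq b x | b <- bs]`_i).
  by apply: measurable_sum => i; exact: measurable_nsq.
apply/funext => x; rewrite /sqnorm (big_nth 0) size_map big_mkord.
by [].
Qed.

Lemma measurable_increment_prod d (T : measurableType d) (f : R -> R) z
    (bs ls ts : seq (T -> C)) :
  measurable_fun setT f ->
  (forall i, measurable_fun setT (fun x => [seq b x | b <- bs]`_i)) ->
  (forall i, measurable_fun setT (fun x => [seq g x | g <- ls]`_i)) ->
  (forall i, measurable_fun setT (fun x => [seq t x | t <- ts]`_i)) ->
  measurable_fun setT (fun x => increment_prod f z [seq b x | b <- bs]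
    [seq g x | g <- ls] [seq t x | t <- ts]).
Proof.
move=> mf; elim: ls bs ts => [|l ls IH] bs ts mb ml mt /=; first exact: measurable_cst.
have mq : measurable_fun setT (fun x =>
    column_form [seq b x | b <- bs] [seq t x | t <- ts] / (z - l x)).
  apply: measurable_complexM; first exact: measurable_column_form.
  apply: measurable_complexV; apply: measurable_complexB; first exact: measurable_cst.
  exact: (ml 0%N).
apply: measurable_funM.
  apply: measurableT_comp mf _; apply: measurable_funM; first exact: measurable_nsq.
  by apply: measurable_funrV; exact: measurable_sqnorm.
pose q x := column_form [seq b x | b <- bs] [seq t x | t <- ts] / (z - l x).
rewrite (_ : (fun x => _) = fun x => increment_prod f z
    [seq b x | b <- rcons bs q] [seq g x | g <- ls] [seq t x | t <- drop (size bs) ts]); last first.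
  by apply/funext => x; rewrite map_rcons size_map map_drop.
apply: IH.
- move=> i; have [ib|] := ltnP i (size bs).
    rewrite (_ : (fun x => _) = fun x => [seq b x | b <- bs]`_i)//.
    by apply/funext => x; rewrite map_rcons nth_rcons size_map ib.
  rewrite leq_eqVlt => /predU1P[<-|bi].
    rewrite (_ : (fun x => _) = q)//.
    by apply/funext => x; rewrite map_rcons nth_rcons size_map ltnn eqxx.
  rewrite (_ : (fun x => _) = cst 0); first exact: measurable_cst.
  by apply/funext => x; rewrite nth_default// size_map size_rcons.
- by move=> i; exact: (ml i.+1).
- move=> i; rewrite (_ : (fun x => _) = fun x => [seq t x | t <- ts]`_(size bs + i))//.
  by apply/funext => x; rewrite map_drop nth_drop.
Qed.

Lemma measurable_nth_tuple d (T : measurableType d) n (t : T -> n.-tuple C) i :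
  measurable_fun setT t -> measurable_fun setT (fun x => (t x)`_i).
Proof.
move=> mt; have [ik|ki] := ltnP i n.
  rewrite (_ : (fun x => _) = (fun s : n.-tuple C => tnth s (Ordinal ik)) \o t).
    by apply: measurableT_comp => //; exact: measurable_tnth.
  by apply/funext => x /=; rewrite (tnth_nth 0).
rewrite (_ : (fun x => _) = cst 0); first exact: measurable_cst.
by apply/funext => x; rewrite nth_default// size_tuple.
Qed.

Lemma measurable_increment_prod_tuple d (T : measurableType d) (f : R -> R) z bs n m
    (l : T -> n.-tuple C) (t : T -> m.-tuple C) :
  measurable_fun setT f -> measurable_fun setT l -> measurable_fun setT t ->
  measurable_fun setT (fun x => increment_prod f z bs (l x) (t x)).
Proof.
move=> mf ml mt.
pose bf := [seq (fun _ : T => b) | b <- bs].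
pose lf := [seq (fun x => tnth (l x) i) | i <- enum 'I_n].
pose tf := [seq (fun x => tnth (t x) i) | i <- enum 'I_m].
have bfE x : [seq b x | b <- bf] = bs by rewrite -map_comp map_id_in.
have lfE x : [seq g x | g <- lf] = l x by rewrite -map_comp -[RHS]map_tnth_enum.
have tfE x : [seq g x | g <- tf] = t x by rewrite -map_comp -[RHS]map_tnth_enum.
rewrite (_ : (fun x => _) = fun x => increment_prod f z
    [seq b x | b <- bf] [seq g x | g <- lf] [seq g x | g <- tf]); last first.
  by apply/funext => x; rewrite bfE lfE tfE.
apply: measurable_increment_prod => // i.
- by under eq_fun do rewrite bfE; exact: measurable_cst.
- by under eq_fun do rewrite lfE; exact: measurable_nth_tuple.
- by under eq_fun do rewrite tfE; exact: measurable_nth_tuple.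
Qed.

Section gaussian_columns.
Variables (v : R) (p : {poly R}).
Hypotheses (v0 : 0 < v) (p0 : forall x, 0 <= x -> 0 <= p.[x]).
Local Notation gamma := (complex_normal v).

Lemma exp_expect_ge0 u : 0 <= u -> 0 <= exp_expect p u.
Proof.
move=> u0; have := integral_linear_poly v0 1 [:: (Num.sqrt (u / v))%:C] p0.
rewrite big_ord_recl big_ord0 addr0 nsq_real sqr_sqrtr ?divr_ge0 ?(ltW v0)//.
rewrite [v * _]mulrC divfK ?gt_eqF// => e; rewrite -lee_fin -e.
have [g gE] := tuple_measure_sigma_finite gamma 1; rewrite -gE.
by apply: integral_ge0 => t _; rewrite lee_fin p0// nsq_ge0.
Qed.

(** Given the preceding columns, the increment of each column is an
    exponential variable of mean [v / nsq (z - l)]. *)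
Lemma integral_increment_prod z bs ls : 0 < sqnorm bs ->
  (\int[tuple_measure gamma (triangle_size (size bs) (size ls))]_t
     (increment_prod (fun x => p.[x]) z bs ls t)%:E =
   (\prod_(l <- ls) exp_expect p (v / nsq (z - l)))%:E)%E.
Proof.
elim: ls bs => [|l ls IH] bs b0.
  rewrite ge0_integral_tuple_measure0; first by rewrite /= big_nil.
  - by apply/measurable_EFinP; exact: measurable_cst.
  - by move=> t; rewrite lee_fin.
have mprod k bs' ls' : measurable_fun setT (fun t : k.-tuple C =>
    (increment_prod (fun x => p.[x]) z bs' ls' t)%:E).
  apply/measurable_EFinP.
  exact: (measurable_increment_prod_tuple z bs' (measurable_real_horner p)
    (measurable_cst (in_tuple ls')) (@measurable_id _ _ setT)).
rewrite [triangle_size _ _]/= ge0_integral_tuple_measureD; last 2 first.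
- exact: mprod.
- by move=> t; rewrite lee_fin increment_prod_ge0.
set m := size bs; set k := triangle_size m.+1 (size ls).
have [g gE] := tuple_measure_sigma_finite gamma m.
have [h hE] := tuple_measure_sigma_finite gamma k.
pose K := \prod_(l <- ls) exp_expect p (v / nsq (z - l)).
(* The new entry relative to the norm of the part already built, as a linear
   form in the new column. *)
pose c : seq C := [seq b / (Num.sqrt (sqnorm bs) )%:C / (z - l) | b <- bs].
have sb : Num.sqrt (sqnorm bs) ^+ 2 = sqnorm bs by rewrite sqr_sqrtr// ltW.
have step (s : m.-tuple C) :
    (\int[tuple_measure gamma k]_t
       (increment_prod (fun x => p.[x]) z bs (l :: ls) [tuple of s ++ t])%:E =
     (p.[nsq (\sum_(i < m) c`_i * tnth s i)])%:E * K%:E)%E.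
  rewrite -hE.
  have colE (t : k.-tuple C) : column_form bs (s ++ t) = \sum_(i < m) bs`_i * tnth s i.
    apply: eq_bigr => i _; rewrite nth_cat size_tuple ltn_ord (tnth_nth 0).
    by [].
  set a := \sum_(i < m) bs`_i * tnth s i in colE.
  have aE : nsq (a / (z - l)) / sqnorm bs = nsq (\sum_(i < m) c`_i * tnth s i).
    rewrite -{1}sb -nsq_real -nsqV -nsqM; congr nsq.
    rewrite /a -mulrA mulr_suml; apply: eq_bigr => i _.
    by rewrite (nth_map 0)//; ring.
  under eq_integral => t _.
    rewrite [increment_prod _ _ _ _ _]/= colE aE drop_size_cat ?size_tuple// EFinM.
    over.
  rewrite ge0_integralZl//; last 3 first.
  - exact: mprod.
  - by move=> t _; rewrite lee_fin increment_prod_ge0.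
  - by rewrite lee_fin p0// nsq_ge0.
  congr (_ * _)%E.
  have := IH (rcons bs (a / (z - l))) (sqnorm_rcons_gt0 _ b0).
  by rewrite size_rcons -/m -/k -hE.
rewrite -gE; under eq_integral do rewrite step.
have K0 : 0 <= K by apply: prodr_ge0 => l' _; rewrite exp_expect_ge0// divr_ge0 ?nsq_ge0 ?ltW.
rewrite ge0_integralZr//; last 2 first.
- apply/measurable_EFinP; apply: measurableT_comp (measurable_real_horner p) _; apply: measurable_nsq.
  apply: measurable_complex_sum => i.
  by apply: measurable_complexM; [exact: measurable_cst|exact: measurable_tnth].
- by move=> s _; rewrite lee_fin p0// nsq_ge0.
have gl := integral_linear_poly v0 m c p0; rewrite -gE in gl.
rewrite gl -EFinM big_cons; congr (exp_expect _ _ * _)%:E.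
rewrite mulrC [in RHS]mulrC; congr (_ * _).
rewrite (eq_bigr (fun i : 'I_m => nsq bs`_i * ((sqnorm bs)^-1 * (nsq (z - l))^-1))); last first.
  move=> i _; rewrite (nth_map 0)// !nsqM !nsqV nsq_real sb mulrA//.
rewrite -mulr_suml -[\sum_(i < m) _](big_mkord xpredT (fun i => nsq bs`_i)).
rewrite -(big_nth 0 xpredT) -/(sqnorm bs) mulrA divff ?mul1r//.
by rewrite gt_eqF.
Qed.

End gaussian_columns.

End left_eigenvector.

(** * Joint law of the eigenvalues and the triangular entries *)

Section conditional_product.
Context d (Omega : measurableType d) (R : realType) (P : probability Omega R).
Context d1 d2 (T1 : measurableType d1) (T2 : measurableType d2).
Variables (m1 : {sigma_finite_measure set T1 -> \bar R}).
Variables (m2 : {sigma_finite_measure set T2 -> \bar R}).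
Variables (X : Omega -> T1) (Y : Omega -> T2) (D : set Omega).
Hypotheses (mX : measurable_fun setT X) (mY : measurable_fun setT Y) (mD : measurable D).

Let XY w := (X w, Y w).

Let mXY : measurable_fun setT XY.
Proof. exact/measurable_fun_pairP. Qed.

Let pf : set (T1 * T2) -> \bar R := pushforward (mrestr P mD) XY.

Let pf0 : pf set0 = 0%E.
Proof. by rewrite /pf; apply: measure0. Qed.

Let pf_ge0 A : (0 <= pf A)%E.
Proof. by rewrite /pf; apply: measure_ge0. Qed.

Let pf_sigma_additive : semi_sigma_additive pf.
Proof. by rewrite /pf; apply: measure_semi_sigma_additive. Qed.

HB.instance Definition _ := isMeasure.Build _ _ _ pf pf0 pf_ge0 pf_sigma_additive.

(** Uniqueness of the product measure, on a further event [D]: this is the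
    induction step that peels off one entry from independent families. *)
Lemma product_law_restricted :
  (forall A B, measurable A -> measurable B ->
    P (X @^-1` A `&` Y @^-1` B `&` D) = (m1 A * m2 B * P D)%E) ->
  forall E, measurable E -> P (XY @^-1` E `&` D) = ((m1 \x m2)%E E * P D)%E.
Proof.
move=> rect E mE.
have fD : P D \is a fin_num by exact: fin_num_measure.
have [PD0|PD0] := eqVneq (P D) 0%E.
  rewrite PD0 mule0; apply/eqP; rewrite eq_le measure_ge0 andbT -PD0.
  apply: le_measure; rewrite ?inE//; apply: measurableI => //.
  by rewrite -[X in measurable X]setTI; exact: mXY.
have c0 : 0 <= (fine (P D))^-1 by rewrite invr_ge0 fine_ge0.
have cD : ((fine (P D))^-1%:E * P D = 1)%E.
  by rewrite -{2}(fineK fD) -EFinM mulVf// fine_eq0.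
pose m' : {measure set (T1 * T2)%type -> \bar R} := mscale (NngNum c0) pf.
have -> : ((m1 \x m2)%E E = m' E).
  apply: product_measure_unique => // A B mA mB.
  rewrite /m' /= /mscale/= /pf /pushforward /mrestr.
  rewrite (_ : XY @^-1` (A `*` B) = X @^-1` A `&` Y @^-1` B)//.
  by rewrite rect// muleC -muleA [(P D * _)%E]muleC cD mule1.
rewrite /m' /= /mscale/= muleAC cD mul1e.
by [].
Qed.

End conditional_product.

Section schur_law.
Context {R : realType} d (Omega : measurableType d) (P : probability Omega R).
Local Notation C := R[i].
Variables (n : nat) (v : R).
Variables (lam : {RV P >-> n.-tuple C}) (T : 'I_n.+1 -> 'I_n.+1 -> {RV P >-> C}).
Hypothesis lawT : forall i j : 'I_n.+1, (i < j)%N -> has_law (T i j) (complex_normal v).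
Hypothesis indep : schur_independent lam T.
Local Notation gamma := (complex_normal v).

Let cyl A (B : 'I_n.+1 -> 'I_n.+1 -> set C) : set Omega :=
  lam @^-1` A `&` [set w | forall i j : 'I_n.+1, (i < j)%N -> B i j (T i j w)].

Let measurable_cyl A B : measurable A -> (forall i j, measurable (B i j)) ->
  measurable (cyl A B).
Proof.
move=> mA mB; apply: measurableI.
  by rewrite -[X in measurable X]setTI; exact: measurable_funP.
rewrite (_ : [set w | _] =
    \bigcap_(i in [set: 'I_n.+1]) \bigcap_(j in [set j : 'I_n.+1 | (i < j)%N]) (T i j @^-1` B i j)); last first.
  apply/seteqP; split => w /= h; first by move=> i _ j /= ij; exact: h.
  by move=> i j ij; exact: (h i I j ij).
apply: fin_bigcap_measurable => // i _; apply: fin_bigcap_measurable => // j _.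
by rewrite -[X in measurable X]setTI; exact: measurable_funP.
Qed.

Let entries_of m (es : m.-tuple ('I_n.+1 * 'I_n.+1)) (w : Omega) : m.-tuple C :=
  [tuple of [seq T e.1 e.2 w | e <- es]].

Let measurable_entries_of m (es : m.-tuple ('I_n.+1 * 'I_n.+1)) :
  measurable_fun setT (entries_of es).
Proof.
apply/measurable_fun_tnthP => i.
rewrite (_ : _ \o _ = T (tnth es i).1 (tnth es i).2)//.
by apply/funext => w /=; rewrite tnth_map.
Qed.

Let upd (B : 'I_n.+1 -> 'I_n.+1 -> set C) (e : 'I_n.+1 * 'I_n.+1) S i j :=
  if (i, j) == e then S else B i j.

Let cyl_upd A B (e : 'I_n.+1 * 'I_n.+1) S : (e.1 < e.2)%N -> B e.1 e.2 = setT ->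
  cyl A (upd B e S) = T e.1 e.2 @^-1` S `&` cyl A B.
Proof.
case: e => a b /= ab BT; apply/seteqP; split => w.
  move=> [lA h]; split; last split => //.
    by have := h a b ab; rewrite /upd eqxx.
  move=> i j ij; have := h i j ij; rewrite /upd; case: eqP => // -[-> ->].
  by rewrite BT.
move=> [hS [lA h]]; split => // i j ij; rewrite /upd.
by case: eqP => [[-> ->]//|_]; exact: h.
Qed.

Let prob_cyl_upd A B (e : 'I_n.+1 * 'I_n.+1) S : measurable A ->
  (forall i j, measurable (B i j)) -> measurable S ->
  (e.1 < e.2)%N -> B e.1 e.2 = setT ->
  P (cyl A (upd B e S)) = (gamma S * P (cyl A B))%E.
Proof.
move=> mA mB mS e12 BT.
have mU i j : measurable (upd B e S i j) by rewrite /upd; case: ifP.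
rewrite /cyl !indep// muleCA; congr (_ * _)%E.
rewrite !pair_big_dep/= (bigD1 e)//= [in RHS](bigD1 e)//= BT preimage_setT.
rewrite probability_setT mul1e.
congr (_ * _)%E.
  by rewrite /upd -surjective_pairing eqxx -(lawT e12 mS).
apply: eq_bigr => -[i j]/= /andP[_ ne]; rewrite /upd.
by rewrite (negbTE ne).
Qed.

Let law_entries m (es : m.-tuple ('I_n.+1 * 'I_n.+1)) A B E :
  uniq es -> (forall e, e \in es -> (e.1 < e.2)%N /\ B e.1 e.2 = setT) ->
  measurable A -> (forall i j, measurable (B i j)) -> measurable E ->
  P (entries_of es @^-1` E `&` cyl A B) = (tuple_measure gamma m E * P (cyl A B))%E.
Proof.
elim: m es A B E => [|m IH] es A B E ues hes mA mB mE.
  rewrite /= diracE (tuple0 es).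
  have -> : entries_of [tuple] = cst [tuple].
    by apply/funext => w; rewrite tuple0.
  rewrite preimage_cst; case: ifPn => hE.
    by rewrite setTI mul1e.
  by rewrite set0I measure0 mul0e.
move: ues hes; case/tupleP: es => e es /= /andP[ees ues] hes.
have [e12 BeT] : (e.1 < e.2)%N /\ B e.1 e.2 = setT by apply: hes; rewrite mem_head.
have hes' e' : e' \in es -> (e'.1 < e'.2)%N /\ B e'.1 e'.2 = setT.
  by move=> h; apply: hes; rewrite inE h orbT.
have [g gE] := tuple_measure_sigma_finite gamma m.
have mC := measurable_cyl mA mB.
have rect (S : set C) (F : set (m.-tuple C)) : measurable S -> measurable F ->
    P (T e.1 e.2 @^-1` S `&` entries_of es @^-1` F `&` cyl A B) =
    (gamma S * g F * P (cyl A B))%E.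
  move=> mS mF; rewrite [_ @^-1` S `&` _]setIC -setIA -cyl_upd// IH//.
  - by rewrite prob_cyl_upd// -gE muleCA muleA.
  - move=> e' e'es; have [? BT] := hes' _ e'es; split => //; rewrite /upd.
    rewrite -surjective_pairing; case: eqP => // ee.
    by move: ees; rewrite -ee e'es.
  - by move=> i j; rewrite /upd; case: ifP.
have := product_law_restricted (@measurable_funP _ _ _ _ _ (T e.1 e.2))
  (measurable_entries_of es) mC rect.
pose E' := [set p : C * m.-tuple C | E [tuple of p.1 :: p.2]].
have mE' : measurable E'.
  rewrite -[X in measurable X]setTI; exact: (@measurable_tuple_cons _ _ m _ E mE).
move=> /(_ E' mE'); rewrite gE => h.
transitivity (P ((fun w => (T e.1 e.2 w, entries_of es w)) @^-1` E' `&` cyl A B)).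
  congr (P (_ `&` _)); apply/seteqP; split => w /=; rewrite /E' /preimage/=;
    congr (E _); exact: val_inj.
by rewrite h.
Qed.

(** Independence is a product rule on rectangles; uniqueness of the product
    measure extends it to joint expectations. *)
Lemma schur_joint_law m (es : m.-tuple ('I_n.+1 * 'I_n.+1)) (h : n.-tuple C * m.-tuple C -> \bar R) :
  uniq es -> (forall e, e \in es -> (e.1 < e.2)%N) ->
  measurable_fun setT h -> (forall p, 0 <= h p)%E ->
  (\int[P]_w h (lam w, [tuple of [seq T e.1 e.2 w | e <- es]]) =
   \int[distribution P lam]_l \int[tuple_measure gamma m]_t h (l, t))%E.
Proof.
move=> ues hes mh h0.
have [g gE] := tuple_measure_sigma_finite gamma m.
have mp : measurable_fun setT (fun w => (lam w, entries_of es w)).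
  apply/measurable_fun_pairP; split => //; exact: measurable_entries_of.
pose f : {mfun Omega >-> (n.-tuple C * m.-tuple C)%type} :=
  HB.pack (fun w => (lam w, entries_of es w)) (isMeasurableFun.Build _ _ _ _ _ mp).
transitivity (\int[distribution P f]_p h p)%E.
  by rewrite ge0_integral_distribution.
have rect (A : set (n.-tuple C)) (F : set (m.-tuple C)) : measurable A -> measurable F ->
    P (lam @^-1` A `&` entries_of es @^-1` F `&` setT) =
    (distribution P lam A * g F * P setT)%E.
  move=> mA mF; rewrite setIT probability_setT mule1 setIC.
  have -> : lam @^-1` A = cyl A (fun _ _ => setT).
    by rewrite /cyl (_ : [set w | _] = setT) ?setIT//; apply/seteqP; split.
  rewrite law_entries//; last by move=> e /hes.
  rewrite -gE muleC; congr (_ * _)%E.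
  rewrite /cyl (_ : [set w | _] = setT) ?setIT//; apply/seteqP; split => //.
transitivity (\int[(distribution P lam \x g)%E]_p h p)%E.
  apply: eq_measure_integral => E mE _.
  have := product_law_restricted (@measurable_funP _ _ _ _ _ lam)
    (measurable_entries_of es) measurableT rect mE.
  by rewrite setIT probability_setT mule1.
by rewrite fubini_tonelli1// -gE.
Qed.

End schur_law.

(** * Law of the remaining eigenvalues *)

Section gaussian_density.
Context {R : realType}.
Local Notation C := R[i].
Variable v : R.
Hypothesis v0 : 0 < v.
Local Notation gamma := (complex_normal v).
Local Notation leb := (@complex_lebesgue R).
Local Notation mu := (@lebesgue_measure R).

Let s := Num.sqrt (v / 2).
Let s0 : 0 < s. Proof. by rewrite sqrtr_gt0 divr_gt0. Qed.
Let s2 : s ^+ 2 = v / 2. Proof. by rewrite sqr_sqrtr// ltW// divr_gt0. Qed.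

Definition gaussian_peak : R := normal_peak s ^+ 2.

Lemma gaussian_peak_gt0 : 0 < gaussian_peak.
Proof. by rewrite exprn_gt0// normal_peak_gt0// gt_eqF. Qed.

Definition gaussian_density (w : C) : R := gaussian_peak * expR (- (nsq w / v)).

Lemma gaussian_density_gt0 w : 0 < gaussian_density w.
Proof. by rewrite mulr_gt0 ?gaussian_peak_gt0 ?expR_gt0. Qed.

Lemma measurable_gaussian_density : measurable_fun setT gaussian_density.
Proof.
apply: measurable_funM; first exact: measurable_cst.
apply: measurableT_comp => //; apply: measurableT_comp => //.
apply: measurable_funM; last exact: measurable_cst.
by apply: measurable_nsq; exact: measurable_id.
Qed.

Let pdfM x y : normal_pdf 0 s x * normal_pdf 0 s y = gaussian_density (x +i* y).
Proof.
rewrite !normal_pdfE ?gt_eqF// /normal_fun !subr0 mulrACA -expRD.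
rewrite /gaussian_density /gaussian_peak expr2 /nsq/=; congr (_ * expR _).
by rewrite -[s ^+ 2 *+ 2]mulr_natr s2 divfK//; field; rewrite gt_eqF.
Qed.

Lemma complex_lebesgue_sigma_finite :
  exists m : {sigma_finite_measure set C -> \bar R}, (m : set C -> \bar R) = leb.
Proof.
have [pm pmE] := sigma_finite_product mu mu.
rewrite /complex_lebesgue -pmE.
have mf : measurable_fun [set: measurableTypeR R * measurableTypeR R] (@complex_of_pair R).
  exact: measurable_complex_of_pair.
have mg : measurable_fun [set: C] (@pair_of_complex R :
    C -> measurableTypeR R * measurableTypeR R).
  exact: measurable_pair_of_complex.
have fK : cancel (@complex_of_pair R) (@pair_of_complex R) by case.
have [m' m'E] := sigma_finite_pushforward pm mf mg fK.
by exists m'.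
Qed.

Lemma ge0_integral_complex_lebesgue (f : C -> \bar R) :
  measurable_fun setT f -> (forall w, 0 <= f w)%E ->
  (\int[leb]_w f w = \int[mu]_y \int[mu]_x f (x +i* y))%E.
Proof.
move=> mf f0; rewrite /complex_lebesgue ge0_integral_pushforward//; last first.
  exact: measurable_complex_of_pair.
rewrite preimage_setT fubini_tonelli2//; last by move=> p; exact: f0.
by apply: measurableT_comp => //; exact: measurable_complex_of_pair.
Qed.

Lemma ge0_integral_gaussian_density (f : C -> \bar R) :
  measurable_fun setT f -> (forall w, 0 <= f w)%E ->
  (\int[gamma]_w f w = \int[leb]_w (f w * (gaussian_density w)%:E))%E.
Proof.
move=> mf f0.
rewrite ge0_integral_complex_normal// -/s ge0_integral_complex_lebesgue; last 2 first.
- by apply: emeasurable_funM => //; apply/measurable_EFinP; exact: measurable_gaussian_density.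
- by move=> w; rewrite mule_ge0// lee_fin ltW// gaussian_density_gt0.
have mfp : measurable_fun [set: measurableTypeR R * measurableTypeR R]
    (fun p => f (p.1 +i* p.2)).
  apply: (measurableT_comp mf); exact: measurable_complex_of_pair.
have mpdf : measurable_fun [set: measurableTypeR R] (normal_pdf 0 s).
  exact: measurable_normal_pdf.
rewrite (@ge0_integral_density _ _ _ mu (normal_prob 0 s) (normal_pdf 0 s))//; last 2 first.
- apply: (@measurable_fun_fubini_tonelli_G _ _ _ _ _ (normal_prob 0 s)
    (fun p : measurableTypeR R * measurableTypeR R => f (p.1 +i* p.2))) => //.
- by move=> y; apply: integral_ge0.
apply: eq_integral => y _.
have mfy : measurable_fun [set: measurableTypeR R] (fun x => f (x +i* y)).
  exact: (measurableT_comp mfp (pair2_measurable y)).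
rewrite (@ge0_integral_density _ _ _ mu (normal_prob 0 s) (normal_pdf 0 s))//.
rewrite -ge0_integralZr//; last 3 first.
- by apply: emeasurable_funM => //; exact/measurable_EFinP.
- by move=> x _; rewrite mule_ge0// lee_fin normal_pdf_ge0.
- by rewrite lee_fin normal_pdf_ge0.
by apply: eq_integral => x _; rewrite -muleA -EFinM pdfM.
Qed.

Lemma ge0_integral_tuple_gaussian_density n (f : n.-tuple C -> \bar R) :
  measurable_fun setT f -> (forall t, 0 <= f t)%E ->
  (\int[tuple_measure gamma n]_t f t =
   \int[tuple_measure leb n]_t (f t * (\prod_(k < n) gaussian_density (tnth t k))%:E))%E.
Proof.
have [l lE] := complex_lebesgue_sigma_finite; rewrite -lE.
have mprod k : measurable_fun setT (fun t : k.-tuple C =>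
    (\prod_(i < k) gaussian_density (tnth t i))%:E).
  by apply/measurable_EFinP; apply: measurable_prod_tuple; exact: measurable_gaussian_density.
have prod0 k (t : k.-tuple C) : (0 <= (\prod_(i < k) gaussian_density (tnth t i))%:E)%E.
  by rewrite lee_fin prodr_ge0// => i _; rewrite ltW// gaussian_density_gt0.
elim: n f => [|n IH] f mf f0.
  rewrite !ge0_integral_tuple_measure0//.
  - by rewrite big_ord0 mule1.
  - by apply: emeasurable_funM => //; exact: mprod.
  - by move=> t; rewrite mule_ge0// prod0.
rewrite !ge0_integral_tuple_measureS//; last 2 first.
- by apply: emeasurable_funM => //; exact: mprod.
- by move=> t; rewrite mule_ge0// prod0.
rewrite ge0_integral_gaussian_density -?lE; last 2 first.
- exact: (measurable_integral_tuple_tail gamma mf f0).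
- move=> w; have [g gE] := tuple_measure_sigma_finite gamma n; rewrite -gE.
  exact: integral_ge0.
apply: eq_integral => x _.
have mfx : measurable_fun setT (fun t : n.-tuple C => f [tuple of x :: t]).
  by apply: measurableT_comp mf _; apply: measurable_cons.
rewrite (IH (fun t => f [tuple of x :: t]))//.
have [lt ltE] := tuple_measure_sigma_finite l n; rewrite -ltE.
rewrite -ge0_integralZr//; last 3 first.
- by apply: emeasurable_funM => //; exact: mprod.
- by move=> t _; rewrite mule_ge0// prod0.
- by rewrite lee_fin ltW// gaussian_density_gt0.
apply: eq_integral => t _; rewrite -muleA -EFinM; congr (_ * _%:E)%E.
rewrite big_ord_recl tnth0 mulrC; congr (_ * _).
by apply: eq_bigr => k _; rewrite tnthS.
Qed.

End gaussian_density.

Section eigenvalue_law.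
Context {R : realType} d (Omega : measurableType d) (P : probability Omega R).
Local Notation C := R[i].
Variables (n : nat) (z : C) (lam : {RV P >-> n.-tuple C}) (c : R).
Hypothesis z0 : z != 0.
Hypothesis law : has_law lam (fun A =>
  \int[tuple_measure (@complex_lebesgue R) n]_(t in A) (c * eigen_weight z t)%:E)%E.

Local Notation v := (n.+1%:R^-1 : R).
Let v0 : 0 < v. Proof. by rewrite invr_gt0. Qed.
Local Notation gamma := (complex_normal v).
Local Notation leb := (@complex_lebesgue R).
Local Notation W := (tilted_weight z).

(** Distances to [z] and Vandermonde factor aside, the eigenvalue density is a
    product of complex normal densities. *)
Let eigen_weightE (t : n.-tuple C) : eigen_weight z t * gaussian_peak v ^+ n =
  (\prod_(k < n) nsq (z - tnth t k)) * vdm_sq t *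
  \prod_(k < n) gaussian_density v (tnth t k).
Proof.
have -> : \prod_(k < n) gaussian_density v (tnth t k) =
    gaussian_peak v ^+ n * expR (- (n.+1%:R * \sum_(k < n) nsq (tnth t k))).
  rewrite /gaussian_density big_split/= prodr_const card_ord -expR_sum.
  congr (_ * expR _); rewrite mulr_sumr -sumrN; apply: eq_bigr => k _.
  by rewrite invrK mulrC.
rewrite /eigen_weight -!mulrA [expR _ * _]mulrC; congr (_ * (_ * (_ * expR (- (_ * _))))).
- by apply: eq_bigr => k _; rewrite nsq_normc.
- by apply: eq_bigr => i _; apply: eq_bigr => j _; rewrite nsq_normc.
- by apply: eq_bigr => k _; rewrite nsq_normc.
Qed.

Let measurable_one_point (f : C -> R) : measurable_fun setT f ->
  measurable_fun setT (fun t : n.-tuple C => \prod_(k < n) f (tnth t k)).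
Proof. exact: measurable_prod_tuple. Qed.

Let peak_gt0 : 0 < gaussian_peak v ^+ n.
Proof. by rewrite exprn_gt0// gaussian_peak_gt0. Qed.

Let peak0 : gaussian_peak v ^+ n != 0.
Proof. by rewrite gt_eqF. Qed.

Let weightE (t : n.-tuple C) : eigen_weight z t =
  (\prod_(k < n) nsq (z - tnth t k)) * vdm_sq t *
  (\prod_(k < n) gaussian_density v (tnth t k)) / gaussian_peak v ^+ n.
Proof. by rewrite -eigen_weightE mulfK. Qed.

Let weight_ge0 (t : n.-tuple C) : 0 <= eigen_weight z t.
Proof.
rewrite weightE divr_ge0 ?(ltW peak_gt0)//.
rewrite mulr_ge0 ?mulr_ge0 ?vdm_sq_ge0 ?prodr_ge0// => i _; first exact: nsq_ge0.
by rewrite ltW// gaussian_density_gt0.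
Qed.

Let measurable_weight : measurable_fun setT (@eigen_weight R n z).
Proof.
rewrite (_ : @eigen_weight R n z = fun t => (\prod_(k < n) nsq (z - tnth t k)) * vdm_sq t *
  (\prod_(k < n) gaussian_density v (tnth t k)) / gaussian_peak v ^+ n); last first.
  by apply/funext => t; rewrite weightE.
apply: measurable_funM; last exact: measurable_cst.
apply: measurable_funM; last by apply: measurable_one_point; exact: measurable_gaussian_density.
apply: measurable_funM; last exact: measurable_vdm_sq.
exact: (measurable_one_point (measurable_nsq_dist z)).
Qed.

Let integral_weight (h : n.-tuple C -> \bar R) (k : R) : 0 <= k ->
  measurable_fun setT h -> (forall t, 0 <= h t)%E ->
  (\int[tuple_measure leb n]_t (h t * (k * eigen_weight z t)%:E) =
   (k / gaussian_peak v ^+ n)%:E * \int[tuple_measure gamma n]_t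
     (h t * ((\prod_(k < n) nsq (z - tnth t k)) * vdm_sq t)%:E))%E.
Proof.
move=> k0 mh h0.
have g10 (t : n.-tuple C) : 0 <= (\prod_(k < n) nsq (z - tnth t k)) * vdm_sq t.
  by rewrite mulr_ge0 ?vdm_sq_ge0// prodr_ge0// => i _; exact: nsq_ge0.
have mg1 : measurable_fun setT (fun t : n.-tuple C =>
    (h t * ((\prod_(k < n) nsq (z - tnth t k)) * vdm_sq t)%:E)%E).
  apply: emeasurable_funM => //; apply/measurable_EFinP; apply: measurable_funM.
    exact: (measurable_one_point (measurable_nsq_dist z)).
  exact: measurable_vdm_sq.
have g20 (t : n.-tuple C) : 0 <= \prod_(k < n) gaussian_density v (tnth t k).
  by apply: prodr_ge0 => i _; rewrite ltW// gaussian_density_gt0.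
rewrite (ge0_integral_tuple_gaussian_density v0 mg1); last first.
  by move=> t; rewrite mule_ge0// lee_fin.
have [l lE] := complex_lebesgue_sigma_finite (R := R).
have [lt ltE] := tuple_measure_sigma_finite l n.
rewrite -lE -ltE -ge0_integralZl//; last 3 first.
- apply: emeasurable_funM => //; apply/measurable_EFinP.
  by apply: measurable_one_point; exact: measurable_gaussian_density.
- by move=> t _; rewrite mule_ge0 ?mule_ge0// lee_fin.
- by rewrite lee_fin divr_ge0// ltW.
apply: eq_integral => t _; rewrite -[RHS]muleC -!muleA -!EFinM; congr (_ * _%:E)%E.
by rewrite weightE; ring.
Qed.

Let c_ge0 : 0 <= c.
Proof.
rewrite leNgt; apply/negP => c0.
have := law measurableT; rewrite probability_setT => e.
have [l lE] := complex_lebesgue_sigma_finite (R := R).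
have [lt ltE] := tuple_measure_sigma_finite l n.
have : (1 <= 0 :> \bar R)%E.
  rewrite e -lE -ltE.
  rewrite (_ : (fun t => _) = fun t => (- (- c * eigen_weight z t)%:E)%E); last first.
    by apply/funext => t; rewrite mulNr -EFinN opprK.
  rewrite integral_ge0N; last first.
    by move=> t _; rewrite lee_fin mulr_ge0// oppr_ge0 ltW.
  rewrite leeNl oppe0; apply: integral_ge0 => t _.
  by rewrite lee_fin mulr_ge0// oppr_ge0 ltW.
by rewrite lee_fin ler10.
Qed.

Let integral_law (h : n.-tuple C -> \bar R) :
  measurable_fun setT h -> (forall t, 0 <= h t)%E ->
  (\int[distribution P lam]_t h t =
   (c / gaussian_peak v ^+ n)%:E * \int[tuple_measure gamma n]_t
     (h t * ((\prod_(k < n) nsq (z - tnth t k)) * vdm_sq t)%:E))%E.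
Proof.
move=> mh h0; rewrite -integral_weight//.
have [l lE] := complex_lebesgue_sigma_finite (R := R).
have [lt ltE] := tuple_measure_sigma_finite l n.
have law' := law; rewrite /has_law -lE -ltE in law'.
rewrite -lE -ltE.
apply: ge0_integral_density => //.
by apply: measurable_funM => //; exact: measurable_cst.
Qed.

(** The constant [c] is determined by the total mass, so that only the ratio of
    the two integrals of [tilted_vandermonde] remains. *)
Lemma law_tilt (f : C -> R) (k1 k2 : R) (m : nat) :
  measurable_fun setT f -> (forall w, 0 <= f w) -> 0 <= k2 ->
  (forall w, nsq (z - w) * f w <= W k1 k2 m w) ->
  (\int[distribution P lam]_t (\prod_(k < n) f (tnth t k))%:E <=
   (expR (k1 * (\sum_(k < n) op_energy v z 0 k / op_pivot v z k) +
          k2 * (\sum_(k < n) op_energy v z m k / op_pivot v z k)))%:E)%E.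
Proof.
move=> mf f0 k20 fW.
have W0 w : 0 <= W k1 k2 m w by apply: le_trans (fW w); rewrite mulr_ge0 ?nsq_ge0.
have [Z Z0 [ZE Zle]] := tilted_vandermonde n v0 z0.
have K0 : 0 <= c / gaussian_peak v ^+ n.
  by rewrite divr_ge0// ltW.
have KZ : c / gaussian_peak v ^+ n * Z = 1.
  apply: EFin_inj; rewrite EFinM -ZE.
  have := @integral_law (cst 1%E) (measurable_cst _) (fun=> lee01).
  rewrite (_ : (\int[_]_t _)%E = 1%E); last first.
    by rewrite integral_cst//= mul1e; exact: probability_setT.
  move=> ->; congr (_ * _)%E.
  have [g gE] := tuple_measure_sigma_finite gamma n; rewrite -gE.
  by apply: eq_integral => t _; rewrite mul1e.
rewrite integral_law; last 2 first.
- by apply/measurable_EFinP; exact: measurable_one_point.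
- by move=> t; rewrite lee_fin prodr_ge0.
have := Zle k1 k2 m k20 W0; set E := expR _ => le.
apply: (@le_trans _ _ ((c / gaussian_peak v ^+ n)%:E * (Z * E)%:E)%E); last first.
  by rewrite -EFinM mulrA KZ mul1r.
apply: lee_wpmul2l; first by rewrite lee_fin.
apply: le_trans le.
have [g gE] := tuple_measure_sigma_finite gamma n; rewrite -gE.
have Yf0 w : 0 <= nsq (z - w) * f w by rewrite mulr_ge0 ?nsq_ge0.
apply: ge0_le_integral => //.
- move=> t _; rewrite -EFinM lee_fin mulr_ge0 ?prodr_ge0// mulr_ge0 ?vdm_sq_ge0//.
  by rewrite prodr_ge0// => i _; exact: nsq_ge0.
- apply: emeasurable_funM; apply/measurable_EFinP; first exact: measurable_one_point.
  apply: measurable_funM; last exact: measurable_vdm_sq.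
  exact: (measurable_one_point (measurable_nsq_dist z)).
- apply/measurable_EFinP; apply: measurable_funM; last exact: measurable_vdm_sq.
  apply: measurable_one_point; apply: measurable_funD.
    by apply: measurable_funD; [exact: measurable_nsq_dist|exact: measurable_cst].
  apply: measurable_funM; first exact: measurable_cst.
  by apply: measurable_funX; apply: measurable_nsq; exact: measurable_id.
- move=> t _; rewrite -EFinM lee_fin mulrA; apply: ler_wpM2r; first exact: vdm_sq_ge0.
  rewrite -big_split/=; apply: ler_prod => k _.
  by rewrite [f _ * _]mulrC Yf0 fW.
Qed.

Let law_weight_eq0 : distribution P lam [set t | eigen_weight z t = 0] = 0%E.
Proof.
have mA : measurable [set t : n.-tuple C | eigen_weight z t = 0].
  rewrite (_ : [set t | _] = eigen_weight z @^-1` [set 0])//.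
  by rewrite -[X in measurable X]setTI; apply: measurable_weight.
rewrite law//.
have [l lE] := complex_lebesgue_sigma_finite (R := R).
have [lt ltE] := tuple_measure_sigma_finite l n.
rewrite -lE -ltE; apply: integral0_eq => t /= ->.
by rewrite mulr0.
Qed.

(** The density vanishes where two of the points [z, lam] coincide. *)
Lemma law_distinct : {ae P, forall w, uniq (z :: lam w)}.
Proof.
exists (lam @^-1` [set t | eigen_weight z t = 0]); split => //.
- rewrite -[X in measurable X]setTI; apply: measurable_funP => //.
  rewrite (_ : [set t | _] = eigen_weight z @^-1` [set 0])//.
  by rewrite -[X in measurable X]setTI; apply: measurable_weight.
move=> w /= nu; rewrite /preimage/=.
have [//|] := eqVneq (eigen_weight z (lam w)) 0.
rewrite /eigen_weight !mulf_eq0 !negb_or => /andP[/andP[zn /prodf_neq0 vn] _].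
exfalso; apply: nu; apply/andP; split.
  apply/negP => /tnthP[k zE]; move/prodf_neq0 : zn => /(_ k isT).
  by rewrite -zE subrr -nsq_normc nsq0 eqxx.
apply/(uniqP 0) => i j; rewrite !inE size_tuple => ilt jlt eij.
wlog : i j ilt jlt eij / (i < j)%N => [wl|ij].
  by case: (ltngtP i j) => // [/wl|/wl]; [exact|move=> ->].
have := vn (Ordinal ilt) isT => /prodf_neq0 /(_ (Ordinal jlt)) /(_ ij).
by rewrite !(tnth_nth 0)/= eij subrr -nsq_normc nsq0 eqxx.
Qed.

End eigenvalue_law.

(** * The overlap as a squared norm *)

Section schur_overlap.
Context {R : realType}.
Local Notation C := R[i].
Local Open Scope sesquilinear_scope.

(** Positions strictly above the diagonal, in columns [j, ..., j + k - 1],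
    in the order in which [left_vec] reads the entries. *)
Fixpoint column_indices (j k : nat) : seq (nat * nat) :=
  if k is k'.+1 then [seq (i, j) | i <- iota 0 j] ++ column_indices j.+1 k' else [::].

Lemma size_column_indices j k : size (column_indices j k) = triangle_size j k.
Proof. by elim: k j => //= k IH j; rewrite size_cat size_map size_iota IH. Qed.

Lemma column_indicesP j k p : p \in column_indices j k ->
  [/\ (p.1 < p.2)%N, (j <= p.2)%N & (p.2 < j + k)%N].
Proof.
elim: k j => //= k IH j; rewrite mem_cat => /orP[/mapP[i0]|/IH[h1 h2 h3]].
  by rewrite mem_iota add0n => ij -> /=; rewrite leqnn -addSnnS ltn_addr.
by rewrite addnS -addSn h1 h3 (ltnW h2).
Qed.

Lemma uniq_column_indices j k : uniq (column_indices j k).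
Proof.
elim: k j => //= k IH j; rewrite cat_uniq IH andbT map_inj_uniq ?iota_uniq//=; last by move=> a b [].
apply/hasPn => p /column_indicesP[_ jp _]; apply/mapP => -[i _ e].
by move: jp; rewrite e ltnn.
Qed.

Definition triangle_indices n : seq ('I_n.+1 * 'I_n.+1) :=
  [seq (inord p.1, inord p.2) | p <- column_indices 1 n].

Lemma size_triangle_indices n : size (triangle_indices n) == triangle_size 1 n.
Proof. by rewrite size_map size_column_indices. Qed.

Canonical triangle_indices_tuple n := Tuple (size_triangle_indices n).

Lemma triangle_indicesP n e : e \in triangle_indices n -> (e.1 < e.2)%N.
Proof.
move=> /mapP[p /column_indicesP[h1 h2 h3] ->]/=.
by rewrite !inordK//; apply: ltn_trans h3.
Qed.

Lemma uniq_triangle_indices n : uniq (triangle_indices n).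
Proof.
rewrite map_inj_in_uniq ?uniq_column_indices//.
move=> [i j] [i' j'] /column_indicesP[/= h1 h2 h3] /column_indicesP[/= h1' h2' h3'].
move=> [] /(congr1 val) /= + /(congr1 val)/=.
rewrite !inordK//; first by move=> -> ->.
- exact: ltn_trans h3'.
- exact: ltn_trans h3.
Qed.

(** The recursion determines all entries; [A] and [tij] are indexed by integers
    so that no ordinal casts occur. *)
Lemma left_vecE (A : nat -> C) (tij : nat * nat -> C) z j ls :
  (forall k, (k < size ls)%N ->
     A (j + k)%N = (\sum_(i < j + k) A i * tij (val i, (j + k)%N)) / (z - ls`_k)) ->
  left_vec z [seq A i | i <- iota 0 j] ls
    [seq tij p | p <- column_indices j (size ls)] =
  [seq A i | i <- iota 0 (j + size ls)].
Proof.
elim: ls j => [|l ls IH] j Ah; first by rewrite /= addn0.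
rewrite [left_vec _ _ _ _]/= -/left_vec.
have -> : column_form [seq A i | i <- iota 0 j]
    [seq tij p | p <- column_indices j (size (l :: ls))] / (z - l) = A j.
  have := Ah 0 isT; rewrite addn0 /= => ->; congr (_ / _).
  rewrite /column_form size_map size_iota; apply: eq_bigr => i _.
  rewrite (nth_map 0%N) ?size_iota// nth_iota// add0n; congr (_ * _).
  by rewrite /= map_cat nth_cat !size_map size_iota ltn_ord -map_comp
    (nth_map 0%N) ?size_iota//= nth_iota.
rewrite [drop _ _]/= map_cat drop_size_cat ?size_map//.
rewrite -map_rcons -[rcons _ _](_ : iota 0 j.+1 = _); last first.
  by rewrite -addn1 iotaD add0n cats1.
rewrite [size _]/= addnS -addSn; apply: IH.
by move=> k ks; have := Ah k.+1 ks; rewrite !addnS !addSn.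
Qed.

Lemma braket_unitary n (U : 'M[C]_n) (u v : 'cV[C]_n) : U \is unitarymx ->
  braket (U^t* *m u) (U^t* *m v) = braket u v.
Proof.
move=> Uu; rewrite /braket trmx_mul map_mxM/= trmxCK.
by rewrite mulmxA -(mulmxA _ U) (unitarymxP Uu) mulmx1.
Qed.

(** Back substitution from the last row. *)
Lemma schur_eigenvector n z (t : n.-tuple C) (T : 'I_n.+1 -> 'I_n.+1 -> C) (r : 'cV[C]_n.+1) :
  uniq (z :: t) -> schur_mx z t T *m r = z *: r ->
  forall i : 'I_n.+1, (0 < i)%N -> r i 0 = 0.
Proof.
move=> /= /andP[zt _] Sr.
have H k : forall i : 'I_n.+1, (0 < i)%N -> (n.+1 - i <= k)%N -> r i 0 = 0.
  elim: k => [|k IH] i i0 ik.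
    by move: ik; rewrite leqn0 subn_eq0 leqNgt ltn_ord.
  have := congr1 (fun M : 'cV[C]_n.+1 => M i 0) Sr.
  rewrite mxE [RHS]mxE (bigD1 i)//= big1 ?addr0; last first.
    move=> j ji; rewrite mxE; case: ltnP => [ij|_]; last by rewrite eq_sym (negbTE ji) mul0r.
    rewrite (IH j) ?mulr0 ?(leq_trans i0 (ltnW ij))//.
    by rewrite leq_subLR; move: ik; rewrite leq_subLR; lia.
  rewrite mxE ltnn eqxx => e.
  have : (tnth [tuple of z :: t] i - z) * r i 0 = 0 by rewrite mulrBl e subrr.
  move=> /eqP; rewrite mulf_eq0 => /orP[|/eqP//]; rewrite subr_eq0 => /eqP e2.
  move: zt; rewrite -{1}e2 => /negP[].
  have il : (i.-1 < n)%N by rewrite -ltnS prednK.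
  rewrite (_ : i = lift ord0 (Ordinal il)); first by rewrite tnthS mem_tnth.
  by apply: val_inj; rewrite /= /bump /= add1n prednK.
by move=> i i0; exact: (H _ i i0 (leqnn _)).
Qed.

(** Unitary conjugation brings [G] to its Schur form, whose right eigenvector
    for [z] is a multiple of the first basis vector; hence the overlap is the
    squared norm of the left eigenvector normalized to have first entry [1]. *)
Lemma overlap_schur n z (t : n.-tuple C) (T : 'I_n.+1 -> 'I_n.+1 -> C)
    (U G V W : 'M[C]_n.+1) :
  U \is unitarymx -> G = U *m schur_mx z t T *m U^t* -> uniq (z :: t) ->
  biorthogonal_eigenvectors G [tuple of z :: t] V W ->
  overlap V W ord0 ord0 =
  (sqnorm (left_vec z [:: 1] t [seq T e.1 e.2 | e <- triangle_indices n]))%:C.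
Proof.
move=> Uu GE ut [hW hV hb]; set S := schur_mx z t T in GE.
have UU : U *m U^t* = 1%:M by exact/unitarymxP.
have UU' : U^t* *m U = 1%:M by exact: mulmx1C.
pose r := U^t* *m col ord0 W; pose l := U^t* *m col ord0 V.
rewrite /overlap -(braket_unitary (col ord0 V) (col ord0 V) Uu).
rewrite -(braket_unitary (col ord0 W) (col ord0 W) Uu) -/r -/l.
have lr : braket l r = 1 by rewrite braket_unitary// hb eqxx.
have Sr : S *m r = z *: r.
  have := hW ord0; rewrite tnth0 GE => e.
  by rewrite /r scalemxAr -e !mulmxA UU' mul1mx.
have lS : l^t* *m S = z *: l^t*.
  have := hV ord0; rewrite tnth0 GE => e.
  have lE : l^t* = (col ord0 V)^t* *m U.
    by rewrite /l trmx_mul map_mxM/= trmxCK.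
  by rewrite lE scalemxAl -e !mulmxA -(mulmxA _ _ U) UU' mulmx1.
have r0 := schur_eigenvector ut Sr.
clearbody r l; pose a := l^t*.
have ar : a 0 ord0 * r ord0 0 = 1.
  rewrite -lr /braket [RHS]mxE (bigD1 ord0)//= big1 ?addr0// => i i0.
  by rewrite r0 ?mulr0// lt0n.
have a0 : a 0 ord0 != 0.
  by apply/eqP => e; move: ar; rewrite e mul0r => /esym/eqP; rewrite oner_eq0.
have aj (j : 'I_n.+1) : (0 < j)%N ->
    a 0 j * (z - tnth [tuple of z :: t] j) = \sum_(i < n.+1 | (i < j)%N) a 0 i * T i j.
  move=> j0; have := congr1 (fun M : 'rV[C]_n.+1 => M 0 j) lS.
  rewrite mxE [RHS]mxE (bigID (fun i : 'I_n.+1 => (i < j)%N))/= => e.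
  have e2 : \sum_(i < n.+1 | ~~ (i < j)%N) a 0 i * S i j =
      a 0 j * tnth [tuple of z :: t] j.
    rewrite (bigD1 j) ?ltnn//= [S j j]mxE ltnn eqxx big1 ?addr0//.
    by move=> i /andP[ij ji]; rewrite [S i j]mxE (negbTE ij) (negbTE ji) mulr0.
  rewrite mulrBr [a 0 j * z]mulrC -e e2 addrK; apply: eq_bigr => i ij.
  by rewrite [S i j]mxE ij.
pose A (i : nat) := a 0 (inord i) / a 0 ord0.
pose tij (p : nat * nat) := T (inord p.1) (inord p.2).
have i0 : inord 0 = ord0 :> 'I_n.+1 by apply: val_inj; rewrite /= inordK.
have -> : left_vec z [:: 1] t [seq T e.1 e.2 | e <- triangle_indices n] =
    [seq A i | i <- iota 0 n.+1].
  have -> : [:: 1] = [seq A i | i <- iota 0 1] by rewrite /= /A i0 divff.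
  have -> : [seq T e.1 e.2 | e <- triangle_indices n] =
      [seq tij p | p <- column_indices 1 (size t)].
    by rewrite -map_comp size_tuple.
  rewrite left_vecE ?size_tuple// => k kn.
  have zk : z - t`_k != 0.
    rewrite subr_eq0; apply/negP => /eqP e; move: ut => /= /andP[/negP[]].
    by rewrite e mem_nth ?size_tuple.
  apply: (mulIf zk); rewrite divfK// /A mulrAC.
  have kE : val (inord (1 + k) : 'I_n.+1) = k.+1 by rewrite /= inordK.
  have := aj (inord (1 + k)); rewrite kE => /(_ isT).
  rewrite (_ : tnth _ _ = t`_k); last by rewrite (tnth_nth 0) kE.
  move=> ->; rewrite mulr_suml.
  rewrite (big_ord_widen_cond n.+1 xpredT (fun i => a 0 (inord i) / a 0 ord0 * tij (i, (1 + k)%N))) //=; last first.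
    by rewrite add1n ltnS ltnW.
  apply: eq_big => [i|i _]; first by rewrite add1n.
  by rewrite /tij /= inord_val mulrAC.
rewrite /sqnorm big_map (_ : iota 0 n.+1 = index_iota 0 n.+1); last first.
  by rewrite /index_iota subn0.
rewrite big_mkord.
have bll : braket l l = \sum_(i < n.+1) (nsq (a 0 i))%:C.
  rewrite /braket mxE; apply: eq_bigr => i _; rewrite nsqC /a !mxE.
  by congr (_ * _); exact/esym/conjcK.
have brr : braket r r = (nsq (r ord0 0))%:C.
  rewrite /braket mxE (bigD1 ord0)//= big1 ?addr0; last first.
    by move=> i i0'; rewrite r0 ?mulr0// lt0n.
  by rewrite nsqC !mxE mulrC.
rewrite bll brr -raddf_sum -real_complexM; congr (_%:C).
rewrite mulr_suml; apply: eq_bigr => i _; rewrite /A inord_val !nsqM nsqV.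
congr (_ * _); have := congr1 (@nsq _) ar; rewrite nsqM nsq1 => e.
by apply: (mulfI (_ : nsq (a 0 ord0) != 0)); rewrite ?nsq_eq0// e divff// nsq_eq0.
Qed.

End schur_overlap.

(** * Pivots and energies for a point outside the unit disk *)

Section outside_disk.
Context {R : realType}.
Variables (v : R) (z : R[i]).
Hypotheses (v0 : 0 < v) (z1 : 1 < nsq z).
Local Notation x := (nsq z).
Local Notation delta := (op_pivot v z).
Local Notation energy := (op_energy v z).

Definition limit_overlap : R := x / (x - 1).
Local Notation L := limit_overlap.

Let x0 : 0 < x. Proof. exact: lt_trans z1. Qed.
Let z0 : z != 0. Proof. by rewrite -nsq_eq0 gt_eqF. Qed.
Let x10 : 0 < x - 1. Proof. by rewrite subr_gt0. Qed.

(** This fixed point equation closes the inductions on [k] below: one step costs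
    [1] and contracts by at least [1 / x]. *)
Let LE : L = 1 + L / x.
Proof. by rewrite /limit_overlap; field; rewrite !gt_eqF. Qed.

Lemma limit_overlap_gt0 : 0 < L.
Proof. by rewrite divr_gt0. Qed.

Let L0 := limit_overlap_gt0.

Let L1 : 1 <= L.
Proof. by rewrite LE lerDl divr_ge0// ltW. Qed.

Lemma op_pivot_le k : k%:R * v <= 1 -> delta k <= x + L * v.
Proof.
elim: k => [|k IH] kv; first by rewrite lerD2l ler_peMl// ltW.
have {}IH : delta k <= x + L * v.
  by apply: IH; apply: le_trans kv; rewrite ler_wpM2r ?ler_nat// ltW.
rewrite [delta _]/= -/(delta k); set d := delta k in IH *.
have dx : x <= d by exact: op_pivot_ge.
have d0 : 0 < d by exact: lt_le_trans dx.
set u := k.+1%:R * v in kv *.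
have u0 : 0 <= u by rewrite mulr_ge0// ltW.
rewrite (_ : k.+2%:R * v = u + v); last by rewrite /u -[k.+2%:R]natr1 mulrDl mul1r.
have h : u - x * u / d <= L * v / x.
  rewrite (_ : u - _ = u * (d - x) / d); last by field; rewrite gt_eqF.
  rewrite ler_pdivrMr// [leRHS]mulrAC ler_pdivlMr//.
  apply: (@le_trans _ _ ((d - x) * x)); first by rewrite ler_wpM2r ?(ltW x0)// ler_piMl ?subr_ge0.
  by apply: ler_pM; rewrite ?subr_ge0 ?(ltW x0)// lerBlDl.
have e : L * v = v + L * v / x.
  by rewrite [X in X * v = _]LE mulrDl mul1r mulrAC.
by move: h e; lra.
Qed.

Let fock0 k : fock_w v (0 + k.+1) / fock_w v k.+1 = 1.
Proof. by rewrite add0n divff// gt_eqF// fock_w_gt0. Qed.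

Let energy0_ge0 k : 0 <= energy 0 k.
Proof.
elim: k => [|k IH]; first by rewrite op_energy0 divff ?ler01// gt_eqF// fock_w_gt0.
rewrite op_energyS// fock0 addr_ge0// mulr_ge0// divr_ge0 ?exprn_ge0 ?(ltW (op_pivot_gt0 _ _ _))//.
by rewrite !mulr_ge0// ltW.
Qed.

Let stepv k : k.+1%:R * v = k%:R * v + v.
Proof. by rewrite -natr1 mulrDl mul1r. Qed.

Let kv_ge0 k : 0 <= k%:R * v.
Proof. by rewrite mulr_ge0// ltW. Qed.

Lemma op_energy_le k : k%:R * v <= 1 -> energy 0 k <= x / (x - k%:R * v).
Proof.
elim: k => [|k IH] kv.
  by rewrite op_energy0 mul0r subr0 !divff// gt_eqF// fock_w_gt0.
rewrite stepv in kv.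
have {}IH := IH (le_trans (_ : _ <= k%:R * v + v) kv).
rewrite op_energyS// fock0 stepv.
have k0 := kv_ge0 k; set a := k%:R * v in kv IH k0 *; set u := a + v in kv *.
have u0 : 0 <= u by rewrite addr_ge0// ltW.
have au : a <= u by rewrite lerDl ltW.
have {}IH := IH au.
have xu : 0 < x - u by rewrite subr_gt0 (le_lt_trans kv).
have xa : 0 < x - a by rewrite (lt_le_trans xu)// lerB.
have dx : x <= delta k by exact: op_pivot_ge.
have h1 : x * u / delta k ^+ 2 <= u / x.
  rewrite ler_pdivrMr ?exprn_gt0 ?(lt_le_trans x0)// mulrAC ler_pdivlMr// mulrAC mulrC.
  by rewrite ler_wpM2l// -expr2 ler_pXn2r// nnegrE ltW// (lt_le_trans x0).
rewrite (_ : x / (x - u) = 1 + u / (x - u)); last by field; rewrite gt_eqF.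
rewrite lerD2l.
apply: (@le_trans _ _ (u / x * (x / (x - a)))).
  apply: ler_pM => //; rewrite divr_ge0 ?exprn_ge0 ?mulr_ge0 ?(ltW x0)//.
  by rewrite ltW// (lt_le_trans x0).
rewrite mulrA divfK ?gt_eqF// ler_wpM2l// lef_pV2 ?posrE//.
by rewrite lerB.
Qed.

(** The bound of [op_energy_le] holds conversely after an upward shift of
    [x] by a multiple of [v]. *)
Definition shifted_modulus : R := (x + L * v) ^+ 2 / x + L * v.
Local Notation y := shifted_modulus.

Let Lv0 : 0 < L * v. Proof. exact: mulr_gt0. Qed.
Let xL0 : 0 < x + L * v. Proof. exact: addr_gt0. Qed.

Let y_ge : x + L * v <= y.
Proof.
rewrite /shifted_modulus -[leLHS]addr0 lerD ?(ltW Lv0)// ler_pdivlMr// expr2 ler_wpM2l//.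
  exact: ltW.
by rewrite lerDl ltW.
Qed.

Let y_gt1 : 1 < y.
Proof. by rewrite (lt_le_trans z1)// (le_trans _ y_ge)// lerDl ltW. Qed.

Lemma op_energy_ge k : k%:R * v <= 1 -> y / (y - k%:R * v) <= energy 0 k.
Proof.
elim: k => [|k IH] kv.
  by rewrite op_energy0 mul0r subr0 !divff// gt_eqF ?fock_w_gt0// (lt_trans _ y_gt1).
have dle : delta k <= x + L * v.
  by apply: op_pivot_le; apply: le_trans kv; rewrite stepv lerDl ltW.
rewrite stepv in kv.
have k0 := kv_ge0 k; rewrite op_energyS// fock0 stepv.
set a := k%:R * v in kv IH k0 *; set u := a + v in kv *.
have u0 : 0 < u by rewrite ltr_wpDl.
have au : a <= u by rewrite lerDl ltW.
have {}IH := IH (le_trans au kv).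
have yu : 0 < y - u by rewrite subr_gt0 (le_lt_trans kv).
have ya : 0 < y - a by rewrite (lt_le_trans yu)// lerB.
have d0 : 0 < delta k by exact: op_pivot_gt0.
pose q := (x + L * v) ^+ 2 / x.
have q0 : 0 < q by rewrite divr_gt0 ?exprn_gt0.
have y0 : 0 < y by exact: lt_trans y_gt1.
have h1 : u / q <= x * u / delta k ^+ 2.
  rewrite /q invf_div mulrCA mulrA ler_wpM2l ?mulr_ge0 ?(ltW x0) ?(ltW u0)//.
  rewrite lef_pV2 ?posrE ?exprn_gt0//.
  by rewrite ler_pXn2r// nnegrE ltW.
rewrite (_ : y / (y - u) = 1 + u / (y - u)); last by field; rewrite gt_eqF.
rewrite lerD2l.
apply: (@le_trans _ _ (u / q * (y / (y - a)))); last first.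
  by apply: ler_pM => //; rewrite divr_ge0// ltW.
have xy : x <= y by apply: le_trans y_ge; rewrite lerDl ltW.
have Ly : y <= L * (y - a).
  apply: (@le_trans _ _ (L * (y - 1))); last first.
    by rewrite ler_wpM2l ?(ltW L0)// lerB// (le_trans au).
  rewrite /limit_overlap mulrAC ler_pdivlMr// !mulrBr !mulr1 [x * y]mulrC.
  by rewrite lerB.
have yq : y = q + L * v by [].
rewrite -[leRHS]mulrA ler_wpM2l ?(ltW u0)// [leRHS]mulrC -[leRHS]mulrA -invfM.
have qE : q = y - L * v by rewrite yq addrK.
have yaq : 0 < (y - a) * q by exact: mulr_gt0.
rewrite (ler_pdivlMr _ _ yaq) [leLHS]mulrC (ler_pdivrMr _ _ yu).
rewrite -subr_ge0 (_ : _ - _ = v * (L * (y - a) - y)); last first.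
  by rewrite qE /u; ring.
by rewrite mulr_ge0 ?(ltW v0)// subr_ge0.
Qed.

Let fock_shift m k : k%:R * v <= 1 -> fock_w v (m + k) / fock_w v k <= (1 + m%:R * v) ^+ m.
Proof.
move=> kv; elim: m => [|m IH]; first by rewrite add0n divff ?expr0// gt_eqF// fock_w_gt0.
rewrite addSn fock_wS exprS -[leLHS]mulrA.
have h0 i : 0 <= 1 + i%:R * v by rewrite addr_ge0 ?mulr_ge0// ltW.
apply: ler_pM.
- by rewrite mulr_ge0// ltW.
- by rewrite divr_ge0// ltW// fock_w_gt0.
- by rewrite -addSn natrD mulrDl addrC lerD2r.
apply: le_trans IH _.
rewrite lerXn2r ?nnegrE// lerD2l ler_wpM2r ?ler_nat// ltW//.
Qed.

(** Powers of [|w|^2] cost at most [(1 + m v) ^+ m], which stays bounded when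
    [m] is of order [v ^- (1 / 2)]. *)
Lemma op_energy_moment_le m k : k%:R * v <= 1 ->
  energy m k <= (1 + m%:R * v) ^+ m * L.
Proof.
set M := (1 + m%:R * v) ^+ m.
have M0 : 0 <= M by rewrite exprn_ge0// addr_ge0 ?mulr_ge0// ltW.
elim: k => [|k IH] kv.
  rewrite op_energy0 -[X in fock_w v X]addn0; apply: le_trans (fock_shift m _) _.
    by rewrite mul0r.
  by rewrite ler_peMr.
have {}IH := IH (le_trans (_ : _ <= k.+1%:R * v) kv).
rewrite op_energyS// [L]LE mulrDr mulr1 lerD ?fock_shift//.
have dx : x <= delta k by exact: op_pivot_ge.
have d0 : 0 < delta k by exact: op_pivot_gt0.
apply: (@le_trans _ _ (x^-1 * (M * L))); last by rewrite mulrC mulrA.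
have c0 : 0 <= x * (k.+1%:R * v) / delta k ^+ 2.
  by rewrite divr_ge0 ?mulr_ge0 ?exprn_ge0 ?(ltW x0) ?(ltW d0)// (ltW v0).
apply: (@le_trans _ _ (x * (k.+1%:R * v) / delta k ^+ 2 * (M * L))).
  by rewrite ler_wpM2l// IH// ler_wpM2r ?ler_nat// ltW.
apply: ler_wpM2r; first by rewrite mulr_ge0 ?(ltW L0).
rewrite ler_pdivrMr ?exprn_gt0// [leRHS]mulrC ler_pdivlMr// mulrAC -expr2.
rewrite -[leRHS]mulr1; apply: ler_pM => //.
- by rewrite exprn_ge0// ltW.
- by rewrite ler_pXn2r// nnegrE ltW.
Qed.

(** A Riemann sum for the logarithm of [L], as the [k]-th term is close to
    [1 / (x - k v)]. *)
Definition mean_exponent n : R := v * \sum_(k < n) energy 0 k / delta k.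

(** Telescoping: the exponential of [v / (x - k v)] is at most the ratio of two
    consecutive values of [x - k v]. *)
Lemma mean_exponent_le n : n%:R * v <= 1 -> expR (mean_exponent n) <= x / (x - n%:R * v).
Proof.
rewrite /mean_exponent; elim: n => [|n IH] nv.
  by rewrite big_ord0 mulr0 expR0 mul0r subr0 divff// gt_eqF.
rewrite stepv in nv; rewrite big_ord_recr/= mulrDr expRD stepv.
have a0 := kv_ge0 n; set a := n%:R * v in nv IH a0 *.
have au : a <= 1 by apply: le_trans nv; rewrite lerDl ltW.
have xa : 0 < x - a by rewrite subr_gt0 (le_lt_trans au).
have xu : 0 < x - (a + v) by rewrite subr_gt0 (le_lt_trans nv).
rewrite (_ : x / (x - (a + v)) = x / (x - a) * ((x - a) / (x - (a + v)))); last first.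
  by rewrite mulrA divfK// gt_eqF.
apply: ler_pM; rewrite ?expR_ge0 ?IH//.
have w0 : 0 < 1 - v / (x - a).
  by rewrite subr_gt0 ltr_pdivrMr// mul1r; move: xu; lra.
apply: (@le_trans _ _ (expR (v / (x - a)))).
  rewrite ler_expR ler_wpM2l ?(ltW v0)// ler_pdivrMr ?op_pivot_gt0//.
  apply: le_trans (op_energy_le au) _; rewrite -/a mulrC ler_wpM2l ?invr_ge0 ?(ltW xa)//.
  exact: op_pivot_ge.
rewrite -[expR _]invrK -expRN (_ : (x - a) / _ = (1 - v / (x - a))^-1); last first.
  by field; rewrite !gt_eqF//; move: xu; lra.
by rewrite lef_pV2 ?posrE ?expR_gt0// expR_ge1Dx.
Qed.

Lemma mean_exponent_ge n : n%:R * v <= 1 ->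
  (y + v) / (y + v - n%:R * v) <= expR (mean_exponent n).
Proof.
rewrite /mean_exponent; elim: n => [|n IH] nv.
  by rewrite big_ord0 mulr0 expR0 mul0r subr0 divff// gt_eqF// addr_gt0// (lt_trans _ y_gt1).
rewrite stepv in nv; rewrite big_ord_recr/= mulrDr expRD stepv.
have a0 := kv_ge0 n; set a := n%:R * v in nv IH a0 *.
have au : a <= 1 by apply: le_trans nv; rewrite lerDl ltW.
have y0 : 0 < y by exact: lt_trans y_gt1.
have ya : 0 < y - a by rewrite subr_gt0 (le_lt_trans au).
have yu : 0 < y + v - a by rewrite addrAC addr_gt0.
rewrite (_ : (y + v) / (y + v - (a + v)) = (y + v) / (y + v - a) * ((y + v - a) / (y - a))); last first.
  by rewrite mulrA divfK ?gt_eqF//; congr (_ / _); ring.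
have yv : 0 <= y + v by rewrite addr_ge0 ?ltW.
apply: ler_pM (IH au) _; [exact: divr_ge0 yv (ltW yu)|exact: divr_ge0 (ltW yu) (ltW ya)|].
apply: (@le_trans _ _ (expR (v / (y - a)))).
  apply: le_trans (expR_ge1Dx _); rewrite ler_pdivrMr// mulrDl mul1r divfK ?gt_eqF//.
  by rewrite addrAC.
rewrite ler_expR ler_wpM2l ?(ltW v0)// ler_pdivlMr ?op_pivot_gt0//.
apply: le_trans (op_energy_ge au); rewrite -/a mulrC ler_wpM2r ?invr_ge0 ?(ltW ya)//.
exact: le_trans (op_pivot_le au) y_ge.
Qed.

Lemma moment_trace_le m n : n%:R * v <= 1 ->
  \sum_(k < n) energy m k / delta k <= n%:R * ((1 + m%:R * v) ^+ m * L).
Proof.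
move=> nv; rewrite mulr_natl -[X in _ *+ X](card_ord n) -sumr_const.
apply: ler_sum => k _.
have kv : k%:R * v <= 1.
  by apply: le_trans nv; rewrite ler_wpM2r ?ler_nat ?(ltW v0)// ltnW.
rewrite ler_pdivrMr ?op_pivot_gt0//; apply: le_trans (op_energy_moment_le m kv) _.
have M0 : 0 <= 1 + m%:R * v by rewrite addr_ge0 ?mulr_ge0// ltW.
apply: ler_peMr; first by rewrite mulr_ge0 ?exprn_ge0// ltW.
exact: le_trans (ltW z1) (op_pivot_ge v0 z0 k).
Qed.

End outside_disk.

(** * Moments of the overlap given by one-point weights *)

Section overlap_moments.
Context {R : realType} d (Omega : measurableType d) (P : probability Omega R).
Local Notation C := R[i].
Variables (n : nat) (z : C) (lam : {RV P >-> n.-tuple C})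
  (T : 'I_n.+1 -> 'I_n.+1 -> {RV P >-> C}) (c : R).
Hypothesis z0 : z != 0.
Hypothesis law : has_law lam (fun A =>
  \int[tuple_measure (@complex_lebesgue R) n]_(t in A) (c * eigen_weight z t)%:E)%E.
Hypothesis lawT : forall i j : 'I_n.+1, (i < j)%N ->
  has_law (T i j) (complex_normal n.+1%:R^-1).
Hypothesis indep : schur_independent lam T.

Local Notation v := (n.+1%:R^-1 : R).
Let v0 : 0 < v. Proof. by rewrite invr_gt0. Qed.
Local Notation gamma := (complex_normal v).
Local Notation energy_sum m := (\sum_(k < n) op_energy v z m k / op_pivot v z k).

Local Notation entries w := [seq T e.1 e.2 w | e <- triangle_indices n].

(** An indicator, written as a product of one-point functions. *)
Definition separated (dl : R) (l : seq C) : R := \prod_(x <- l) (dl <= nsq (z - x))%R%:R.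

Definition column_prod (f : R -> R) w : R := increment_prod f z [:: 1] (lam w) (entries w).

Lemma measurable_column_prod f : measurable_fun setT f -> measurable_fun setT (column_prod f).
Proof.
move=> mf; apply: (measurable_increment_prod_tuple z [:: 1]
  (t := fun w => [tuple of [seq T e.1 e.2 w | e <- triangle_indices_tuple n]])) => //.
apply/measurable_fun_tnthP => i; pose e := tnth (triangle_indices_tuple n) i.
by rewrite (_ : _ \o _ = T e.1 e.2)//; apply/funext => w /=; rewrite tnth_map.
Qed.

Lemma separated_ge0 dl l : 0 <= separated dl l.
Proof. exact: prodr_ge0. Qed.

Let measurable_separated1 dl : measurable_fun setT (fun w : C => (dl <= nsq (z - w))%R%:R : R).
Proof.
rewrite (_ : (fun w => _) = \1_[set w | dl <= nsq (z - w)]); last first.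
  by apply/funext => w; rewrite indicE; congr ((nat_of_bool _)%:R); apply/idP/idP; rewrite inE.
apply: measurable_indic; apply: measurable_set_of_bool.
by apply: measurable_fun_ler; [exact: measurable_cst|exact: measurable_nsq_dist].
Qed.

Lemma measurable_separated dl : measurable_fun setT (fun t : n.-tuple C => separated dl t).
Proof.
rewrite (_ : (fun t => _) = fun t : n.-tuple C =>
    \prod_(k < n) (dl <= nsq (z - tnth t k))%R%:R); last first.
  by apply/funext => t; rewrite /separated big_tuple.
exact: (measurable_prod_tuple (measurable_separated1 dl)).
Qed.

(** The matrix entries are integrated out first: each column contributes an
    exponential moment that is a function of one eigenvalue only. *)
Lemma separated_moment_le (p : {poly R}) (dl k1 k2 : R) (m : nat) :
  (forall x, 0 <= x -> 0 <= p.[x]) -> 0 < dl -> 0 <= k2 ->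
  (forall w, 0 <= tilted_weight z k1 k2 m w) ->
  (forall w, dl <= nsq (z - w) ->
    nsq (z - w) * exp_expect p (v / nsq (z - w)) <= tilted_weight z k1 k2 m w) ->
  (\int[P]_w (separated dl (lam w) * column_prod (fun x => p.[x]) w)%:E <=
   (expR (k1 * energy_sum 0 + k2 * energy_sum m))%:E)%E.
Proof.
move=> p0 dl0 k20 W0 hW.
pose h (q : n.-tuple C * (triangle_size 1 n).-tuple C) : R :=
  separated dl q.1 * increment_prod (fun x => p.[x]) z [:: 1] q.1 q.2.
have h0 q : 0 <= h q by rewrite mulr_ge0 ?separated_ge0 ?increment_prod_ge0.
have mp := measurable_real_horner p.
have mi : measurable_fun setT (fun q : n.-tuple C * (triangle_size 1 n).-tuple C =>
    increment_prod (fun x => p.[x]) z [:: 1] q.1 q.2).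
  exact: (measurable_increment_prod_tuple z [:: 1] mp measurable_fst measurable_snd).
have mh : measurable_fun setT h.
  apply: measurable_funM => //.
  exact: (measurableT_comp (measurable_separated dl) measurable_fst).
have := schur_joint_law lawT indep (es := triangle_indices_tuple n)
  (h := fun q => (h q)%:E).
rewrite /h/= => ->; first last.
- by move=> q; rewrite lee_fin; exact: h0.
- by apply/measurable_EFinP; exact: mh.
- exact: triangle_indicesP.
- exact: uniq_triangle_indices.
pose f (w : C) : R := (dl <= nsq (z - w))%R%:R * exp_expect p (v / nsq (z - w)).
have f0 w : 0 <= f w.
  by rewrite mulr_ge0// (exp_expect_ge0 v0 p0)// divr_ge0 ?nsq_ge0// ltW.
have mf : measurable_fun setT f.
  apply: measurable_funM; first exact: measurable_separated1.
  apply: measurable_sum => k; apply: measurable_funM; first exact: measurable_cst.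
  apply: measurable_funM; first exact: measurable_cst.
  apply: measurable_funX; apply: measurable_funM; first exact: measurable_cst.
  by apply: measurable_funrV; exact: measurable_nsq_dist.
apply: le_trans (law_tilt z0 law mf f0 k20 _); last first.
  move=> w; rewrite /f; have [hd|hd] := boolP (dl <= nsq (z - w)); last by rewrite /= mul0r mulr0 W0.
  by rewrite mul1r hW.
rewrite le_eqVlt; apply/orP; left; apply/eqP; apply: eq_integral => l _.
have -> : \prod_(k < n) f (tnth l k) =
    separated dl l * \prod_(x <- l) exp_expect p (v / nsq (z - x)).
  by rewrite /separated -big_split/= big_tuple.
have s1 : 0 < sqnorm [:: 1 : C] by rewrite /sqnorm big_seq1 nsq1.
have int : (\int[tuple_measure gamma (triangle_size 1 n)]_t
     (increment_prod (fun x => p.[x]) z [:: 1] l t)%:E =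
   (\prod_(x <- l) exp_expect p (v / nsq (z - x)))%:E)%E.
  have := integral_increment_prod v0 p0 z l s1.
  by rewrite [size [:: 1]]/= size_tuple.
rewrite EFinM -int.
have [g gE] := tuple_measure_sigma_finite gamma (triangle_size 1 n); rewrite -gE.
have ml : measurable_fun setT (fun t : (triangle_size 1 n).-tuple C =>
    (increment_prod (fun x => p.[x]) z [:: 1] l t)%:E).
  by apply/measurable_EFinP; exact: (measurableT_comp mi (pair1_measurable l)).
rewrite -ge0_integralZl//; last 2 first.
- by move=> t _; rewrite lee_fin increment_prod_ge0.
- by rewrite lee_fin separated_ge0.
Qed.

End overlap_moments.

(** * Positive and negative moments of the overlap *)

Section polynomial_expectations.
Context {R : realType}.

Lemma exp_expect_widen (p : {poly R}) u n : (size p <= n)%N ->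
  exp_expect p u = \sum_(k < n) p`_k * (k`!%:R * u ^+ k).
Proof.
move=> pn; rewrite /exp_expect (big_ord_widen n (fun k => p`_k * (k`!%:R * u ^+ k)))//.
rewrite big_mkcond/=; apply: eq_bigr => k _; case: ltnP => // kp.
by rewrite nth_default// mul0r.
Qed.

Definition binomial_poly s : {poly R} := \poly_(i < s.+1) 'C(s, i)%:R.

Lemma horner_binomial_poly s x : (binomial_poly s).[x] = (1 + x) ^+ s.
Proof. by rewrite horner_poly addrC exprD1n; apply: eq_bigr => i _; rewrite mulr_natl. Qed.

(** Falling factorials are at most powers, so the expectation is at most a
    truncated geometric series. *)
Lemma exp_expect_binomial_le s u : 0 <= u -> s%:R * u <= 2^-1 ->
  exp_expect (binomial_poly s) u <= 1 + s%:R * u + 2 * (s%:R * u) ^+ 2.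
Proof.
move=> u0 su; rewrite (@exp_expect_widen _ _ s.+1) ?size_poly//.
set a := s%:R * u in su *; have a0 : 0 <= a by rewrite mulr_ge0.
apply: (@le_trans _ _ (\sum_(k < s.+1) a ^+ k)).
  apply: ler_sum => k _; rewrite coef_poly ltn_ord mulrA -natrM bin_ffact /a exprMn.
  rewrite ler_wpM2r ?exprn_ge0// -natrX ler_nat.
  elim: (k : nat) => [|j IH]; first by rewrite ffactn0.
  by rewrite ffactnSr expnSr leq_mul// leq_subr.
elim: s.+1 => [|j IH].
  by rewrite big_ord0 addr_ge0 ?addr_ge0 ?mulr_ge0 ?exprn_ge0.
rewrite big_ord_recl expr0 -addrA lerD2l.
rewrite (_ : \sum_(i < j) _ = a * \sum_(i < j) a ^+ i); last first.
  by rewrite mulr_sumr; apply: eq_bigr => i _; rewrite exprS.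
apply: le_trans (ler_wpM2l a0 IH) _; nra.
Qed.

(** A quadratic majorant of [(1 + x) ^- s] on the half-line. *)
Definition inverse_power_poly (s : nat) : {poly R} :=
  \poly_(i < 3) [:: 1; - s%:R; s%:R ^+ 2]`_i.

Lemma horner_inverse_power_poly s x :
  (inverse_power_poly s).[x] = 1 - s%:R * x + (s%:R * x) ^+ 2.
Proof.
rewrite horner_poly !big_ord_recl big_ord0/= addr0 expr0 mulr1 expr1.
by rewrite mulNr exprMn addrA.
Qed.

Lemma inverse_power_poly_ge s x : 0 <= x ->
  0 <= ((1 + x) ^+ s)^-1 <= (inverse_power_poly s).[x].
Proof.
move=> x0; rewrite invr_ge0 exprn_ge0 ?addr_ge0//= horner_inverse_power_poly.
have a0 : 0 <= s%:R * x by rewrite mulr_ge0.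
have h : 1 + s%:R * x <= (1 + x) ^+ s.
  elim: s {a0} => [|s IH]; first by rewrite mul0r addr0 expr0.
  rewrite exprS -natr1; apply: le_trans (ler_wpM2l (addr_ge0 ler01 x0) IH).
  have : 0 <= s%:R * x ^+ 2 by rewrite mulr_ge0// exprn_ge0.
  lra.
apply: (@le_trans _ _ (1 + s%:R * x)^-1).
  by rewrite lef_pV2// posrE ?exprn_gt0// ltr_wpDr.
set a := s%:R * x in a0 *.
rewrite -[leLHS]mul1r ler_pdivrMr; last by rewrite ltr_wpDr.
by have : 0 <= a ^+ 3 by [rewrite exprn_ge0]; nra.
Qed.

Lemma exp_expect_inverse_power s u :
  exp_expect (inverse_power_poly s) u = 1 - s%:R * u + 2 * (s%:R * u) ^+ 2.
Proof.
rewrite (@exp_expect_widen _ _ 3) ?size_poly// !big_ord_recl big_ord0 !coef_poly/=.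
by rewrite addr0 /bump/= !addn0 !add1n (_ : 2`! = 2%N)// (_ : 1`! = 1%N)// fact0; ring.
Qed.

End polynomial_expectations.

Section overlap_tails.
Context {R : realType} d (Omega : measurableType d) (P : probability Omega R).
Local Notation C := R[i].
Variables (n : nat) (z : C) (lam : {RV P >-> n.-tuple C})
  (T : 'I_n.+1 -> 'I_n.+1 -> {RV P >-> C}) (c : R).
Hypothesis z0 : z != 0.
Hypothesis law : has_law lam (fun A =>
  \int[tuple_measure (@complex_lebesgue R) n]_(t in A) (c * eigen_weight z t)%:E)%E.
Hypothesis lawT : forall i j : 'I_n.+1, (i < j)%N ->
  has_law (T i j) (complex_normal n.+1%:R^-1).
Hypothesis indep : schur_independent lam T.
Variables (dl r : R).
Hypotheses (dl0 : 0 < dl) (r0 : 0 < r).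
Hypothesis near_large : forall w, nsq (z - w) < dl -> r <= nsq w.

Local Notation v := (n.+1%:R^-1 : R).
Let v0 : 0 < v. Proof. by rewrite invr_gt0. Qed.
Local Notation energy_sum m := (\sum_(k < n) op_energy v z m k / op_pivot v z k).
Local Notation sep w := (separated z dl (lam w)).
Local Notation overlap w := (column_prod z lam T (fun x => 1 + x) w).

Lemma separated_le1 l : separated z dl l <= 1.
Proof.
elim: l => [|x l IH]; rewrite /separated ?big_nil// big_cons.
by have [_|_] := boolP (dl <= nsq (z - x)); rewrite /= ?mul1r ?mul0r.
Qed.

(** At distance at least [sqrt dl] from [z] the one-point function [exp_expect] is
    [1 + s v / Y] up to second order, [Y] being the squared distance; its
    product with [Y] is thus [Y] plus a constant. *)
Lemma overlap_upper_moment s : s%:R * v / dl <= 2^-1 ->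
  (\int[P]_w (sep w * overlap w ^+ s)%:E <=
   (expR (s%:R * v * (1 + 2 * (s%:R * v) / dl) * energy_sum 0))%:E)%E.
Proof.
move=> sv; set k1 := s%:R * v * _.
have sv0 : 0 <= s%:R * v by rewrite mulr_ge0// ltW.
have k10 : 0 <= k1.
  by rewrite mulr_ge0// addr_ge0// divr_ge0 ?(ltW dl0)// mulr_ge0.
rewrite (_ : (fun w => _) = fun w => (sep w * column_prod z lam T
    (fun x => (binomial_poly s).[x]) w)%:E); last first.
  apply/funext => w; congr (_ * _)%:E; rewrite -increment_prodX.
  by congr (increment_prod _ _ _ _ _); apply/funext => x; rewrite horner_binomial_poly.
rewrite -[X in expR X]addr0 -[X in expR (_ + X)](mul0r (energy_sum 0)).
apply: (separated_moment_le z0 law lawT indep) => //.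
- by move=> x x0; rewrite horner_binomial_poly exprn_ge0// addr_ge0.
- by move=> w; rewrite /tilted_weight mul0r addr0 addr_ge0// nsq_ge0.
move=> w hw; rewrite /tilted_weight mul0r addr0; set Y := nsq (z - w) in hw *.
have Y0 : 0 < Y by exact: lt_le_trans hw.
have svY : s%:R * (v / Y) <= s%:R * v / dl.
  by rewrite mulrA ler_wpM2l// lef_pV2 ?posrE.
apply: le_trans (ler_wpM2l (ltW Y0) (exp_expect_binomial_le _ _)) _.
- by rewrite divr_ge0// ltW.
- exact: le_trans sv.
set q := s%:R * (v / Y) in svY *.
have qE : Y * q = s%:R * v by rewrite /q mulrA mulrC divfK// gt_eqF.
rewrite (_ : Y * _ = Y + (Y * q + Y * q * (2 * q))); last by ring.
rewrite qE lerD2l /k1 mulrDr mulr1 lerD2l ler_wpM2l// -[leRHS]mulrA.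
by rewrite ler_wpM2l.
Qed.

(** Here the constant added to [Y] is negative, and the sum may fail to be
    nonnegative close to [z]. There [|w|^2 >= r], and a multiple of
    [(|w|^2 / r) ^+ m] restores positivity at a small cost in trace. *)
Lemma overlap_lower_moment s m : s%:R * v / dl <= 2^-1 ->
  (\int[P]_w (sep w / overlap w ^+ s)%:E <=
   (expR (s%:R * v * (1 - 2 * (s%:R * v) / dl) * (energy_sum m / r ^+ m - energy_sum 0)))%:E)%E.
Proof.
move=> sv; set k1 := s%:R * v * _.
have sv0 : 0 <= s%:R * v by rewrite mulr_ge0// ltW.
have f0 : 0 <= 1 - 2 * (s%:R * v) / dl by rewrite -(mulrA 2); move: sv; set a := _ / dl => sv; lra.
have k10 : 0 <= k1 by rewrite mulr_ge0.
have k1le : k1 <= dl.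
  apply: (@le_trans _ _ (s%:R * v)).
    by rewrite ler_piMr// gerBl divr_ge0 ?mulr_ge0 ?(ltW dl0).
  move: sv; rewrite ler_pdivrMr// => /le_trans; apply.
  by rewrite ler_piMl// ?(ltW dl0)//; lra.
have pge (x : R) : 0 <= x -> 0 <= (inverse_power_poly s).[x].
  by move=> /(@inverse_power_poly_ge _ s) /andP[]; exact: le_trans.
have W0 w : 0 <= tilted_weight z (- k1) (k1 / r ^+ m) m w.
  rewrite /tilted_weight mulrAC -mulrA -expr_div_n.
  have q0 : 0 <= (nsq w / r) ^+ m by rewrite exprn_ge0// divr_ge0 ?nsq_ge0// ltW.
  have [hd|hd] := leP dl (nsq (z - w)).
    by rewrite addr_ge0// ?mulr_ge0// subr_ge0 (le_trans k1le).
  rewrite -addrA addr_ge0 ?nsq_ge0// addrC -[X in _ - X]mulr1 -mulrBr mulr_ge0// subr_ge0.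
  by rewrite exprn_ege1// ler_pdivlMr// mul1r near_large.
apply: (@le_trans _ _ (\int[P]_w (sep w * column_prod z lam T
    (fun x => (inverse_power_poly s).[x]) w)%:E)%E).
  have mx (f : R -> R) : measurable_fun setT f ->
      measurable_fun setT (fun w => (sep w * column_prod z lam T f w)%:E).
    move=> mf; apply/measurable_EFinP; apply: measurable_funM.
      by apply: measurableT_comp (measurable_separated z dl) _.
    exact: measurable_column_prod.
  have invE w : (overlap w ^+ s)^-1 = column_prod z lam T (fun x => ((1 + x) ^+ s)^-1) w.
    by rewrite /column_prod increment_prodV increment_prodX.
  apply: ge0_le_integral => //.
  - move=> w _; rewrite lee_fin mulr_ge0 ?separated_ge0// invE.
    by apply: increment_prod_ge0 => x /(@inverse_power_poly_ge _ s) /andP[].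
  - rewrite (_ : (fun w => _) = fun w => (sep w * column_prod z lam T (fun x => ((1 + x) ^+ s)^-1) w)%:E).
      apply: mx; apply: measurable_funrV; apply: measurable_funX.
      by apply: measurable_funD => //; exact: measurable_cst.
    by apply/funext => w; rewrite invE.
  - by apply: mx; exact: measurable_real_horner.
  - move=> w _; rewrite lee_fin invE ler_wpM2l ?separated_ge0//.
    by apply: le_increment_prod => x /inverse_power_poly_ge.
rewrite (_ : k1 * _ = - k1 * energy_sum 0 + k1 / r ^+ m * energy_sum m); last by ring.
apply: (separated_moment_le z0 law lawT indep) => //.
  by rewrite divr_ge0// exprn_ge0// ltW.
move=> w hw; rewrite exp_expect_inverse_power /tilted_weight; set Y := nsq (z - w) in hw *.
have Y0 : 0 < Y by exact: lt_le_trans hw.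
apply: (@le_trans _ _ (Y + - k1)); last first.
  by rewrite lerDl mulr_ge0 ?divr_ge0 ?exprn_ge0 ?nsq_ge0// ltW.
set q := s%:R * (v / Y).
have qE : Y * q = s%:R * v by rewrite /q mulrA mulrC divfK// gt_eqF.
rewrite (_ : Y * _ = Y + - (Y * q - Y * q * (2 * q))); last by ring.
rewrite qE /q [s%:R * (v / Y)]mulrA [2 * (_ / Y)]mulrA lerD2l lerN2 /k1 mulrBr mulr1 lerD2l lerN2 ler_wpM2l//.
by rewrite ler_wpM2l ?mulr_ge0// lef_pV2 ?posrE.
Qed.

(** First moment bound in exponential form: the product of [1] plus the
    indicators of proximity is at least [2] as soon as one point is close to
    [z], and [dl * (|w|^2 / r) ^+ m] dominates that indicator times [Y]. *)
Lemma unseparated_le m :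
  (\int[P]_w (1 - sep w)%:E <= (expR (dl / r ^+ m * energy_sum m) - 1)%:E)%E.
Proof.
pose f (w : C) : R := 1 + (nsq (z - w) < dl)%R%:R.
have f1 w : 1 <= f w by rewrite lerDl.
have key (l : seq C) : 2 - separated z dl l <= \prod_(x <- l) f x.
  have p1 (l' : seq C) : 1 <= \prod_(x <- l') f x.
    by elim: l' => [|x l' IH]; rewrite ?big_nil// big_cons -[leLHS]mulr1 ler_pM.
  elim: l => [|x l IH]; first by rewrite /separated !big_nil; lra.
  rewrite /separated !big_cons -/(separated z dl l) {1}/f.
  have [h|h] := ltP (nsq (z - x)) dl.
    by rewrite /= mul0r; have := p1 l; lra.
  by rewrite /= addr0 !mul1r.
have sep1 w : sep w <= 1 by exact: separated_le1.
have mf : measurable_fun setT f.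
  apply: measurable_funD; first exact: measurable_cst.
  rewrite (_ : (fun w => _) = \1_[set w | nsq (z - w) < dl]); last first.
    by apply/funext => w; rewrite indicE; congr ((nat_of_bool _)%:R); apply/idP/idP; rewrite inE.
  apply: measurable_indic; apply: measurable_set_of_bool.
  by apply: measurable_fun_ltr; [exact: measurable_nsq_dist|exact: measurable_cst].
have k20 : 0 <= dl / r ^+ m by rewrite divr_ge0 ?exprn_ge0 ?ltW.
have := law_tilt z0 law mf (fun w => le_trans ler01 (f1 w)) (k1 := 0) k20 (m := m).
have hW w : nsq (z - w) * f w <= tilted_weight z 0 (dl / r ^+ m) m w.
  rewrite /tilted_weight addr0 /f; have [h|h] := ltP (nsq (z - w)) dl; last first.
    by rewrite /= addr0 mulr1 lerDl mulr_ge0// exprn_ge0// nsq_ge0.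
  rewrite /= mulrDr mulr1 lerD2l (le_trans (ltW h))// mulrAC -mulrA -expr_div_n.
  by rewrite ler_peMr ?(ltW dl0)// exprn_ege1// ler_pdivlMr// mul1r near_large.
move=> /(_ hW); rewrite mul0r add0r => bound.
rewrite EFinB leeBrDr//; apply: le_trans bound.
rewrite ge0_integral_distribution//; last 2 first.
- by apply/measurable_EFinP; exact: measurable_prod_tuple.
- by move=> t; rewrite lee_fin prodr_ge0// => k _; exact: le_trans (f1 _).
have msep : measurable_fun setT (fun w => 1 - sep w).
  apply: measurable_funB; first exact: measurable_cst.
  by apply: measurableT_comp (measurable_separated z dl) _.
have <- : (\int[P]_w (1%:E) = 1 :> \bar R)%E.
  by rewrite integral_cst//= mul1e; exact: probability_setT.
rewrite -ge0_integralD//; last 2 first.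
- by move=> w _; rewrite lee_fin subr_ge0.
- exact/measurable_EFinP.
apply: ge0_le_integral => //.
- by move=> w _; rewrite -EFinD lee_fin addr_ge0// subr_ge0.
- apply: emeasurable_funD; last exact: measurable_cst.
  exact/measurable_EFinP.
- apply/measurable_EFinP.
  by apply: measurableT_comp (measurable_prod_tuple mf) _.
move=> w _; rewrite -EFinD lee_fin.
by apply: le_trans (_ : 2 - sep w <= _); [lra|rewrite (le_trans (key _))// big_tuple].
Qed.

End overlap_tails.

(** * Tail bounds with exponents of square root order *)

Section tail_probability.
Context {R : realType}.
Local Notation C := R[i].

Definition decay_const (q : R) : R := 36 ^+ 3 / Num.min 1 (q - 1) ^+ 6.

Lemma decay_const_gt0 q : 1 < q -> 0 < decay_const q.
Proof. by move=> q1; rewrite divr_gt0 ?exprn_gt0// lt_min ltr01 subr_gt0. Qed.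

(** The exponent is [6 t] with [t] of order [sqrt N]: its square is at most [N],
    which keeps second order terms bounded, and by Bernoulli's inequality the
    sixth power of [q ^+ t] is at least of order [N ^+ 3]. *)
Lemma square_root_exponent (N : nat) : (0 < N)%N ->
  exists s : nat, (s ^ 2 <= N)%N /\
    forall q : R, 1 < q -> (q ^+ s)^-1 <= decay_const q / N%:R ^+ 3.
Proof.
move=> N0; pose Q t := ((6 * t) ^ 2 <= N)%N.
have ub t : Q t -> (t <= N)%N.
  rewrite /Q expnMn => h; apply: leq_trans h.
  by case: t => // t; rewrite -[t.+1 in leqLHS]mul1n leq_mul// expnS leq_pmulr ?expn_gt0.
have Q0 : exists t, Q t by exists 0%N; rewrite /Q muln0.
case: (ex_maxnP Q0 ub) => t Qt tmax; exists (6 * t)%N; split => // q q1.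
have Nt : (N <= 36 * t.+1 ^ 2)%N.
  rewrite leqNgt; apply/negP => h.
  by have := tmax t.+1; rewrite /Q expnMn (ltnW h) ltnn => /(_ isT).
pose e := Num.min 1 (q - 1).
have e0 : 0 < e by rewrite lt_min ltr01 subr_gt0.
have bern : e * t.+1%:R <= q ^+ t.
  apply: (@le_trans _ _ (1 + t%:R * (q - 1))).
    rewrite -[t.+1%:R]natr1 mulrDr mulr1 [e * _]mulrC addrC lerD ?ge_min ?lexx//.
    by rewrite ler_wpM2l// ge_min lexx orbT.
  elim: t {Qt tmax Nt} => [|t IH]; first by rewrite mul0r addr0.
  rewrite exprS -natr1.
  have q0 : 0 <= q by rewrite (le_trans _ (ltW q1)).
  apply: le_trans (ler_wpM2l q0 IH).
  have : 0 <= t%:R * (q - 1) ^+ 2 by rewrite mulr_ge0// sqr_ge0.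
  lra.
have N0' : 0 < N%:R :> R by rewrite ltr0n.
have p6 : (e * t.+1%:R) ^+ 6 <= q ^+ (6 * t).
  by rewrite mulnC exprM lerXn2r// nnegrE ?mulr_ge0 ?exprn_ge0 ?(ltW e0)// (le_trans _ (ltW q1)).
have e6 : (t.+1 ^ 6 = (t.+1 ^ 2) ^ 3)%N by rewrite -expnM.
have Nt' : N%:R ^+ 3 <= 36 ^+ 3 * t.+1%:R ^+ 6 :> R.
  by rewrite -!natrX -natrM ler_nat e6 -expnMn leq_exp2r.
rewrite /decay_const -/e ler_pdivlMr ?exprn_gt0// mulrC ler_pdivrMr ?exprn_gt0 ?(lt_trans _ q1)//.
rewrite mulrAC ler_pdivlMr ?exprn_gt0//.
apply: (@le_trans _ _ (36 ^+ 3 * t.+1%:R ^+ 6 * e ^+ 6)).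
  by rewrite ler_wpM2r// exprn_ge0// ltW.
by rewrite -mulrA ler_wpM2l// mulrC -exprMn.
Qed.

Variables (z : C) (dl r eps : R).
Hypotheses (z1 : 1 < nsq z) (dl0 : 0 < dl) (r1 : 1 < r) (eps0 : 0 < eps).
Hypothesis near_large : forall w, nsq (z - w) < dl -> r <= nsq w.
Local Notation L := (limit_overlap z).

Definition tail_const : R :=
  let K := dl * (decay_const r * expR 1 * L) in
  K * expR K + expR (2 * L / dl) * decay_const (1 + eps) +
  expR (decay_const r * expR 1 * L + 2 * L / dl) * decay_const (1 + eps / 2).

Variables (n : nat).
Local Notation v := (n.+1%:R^-1 : R).
Local Notation N := (n.+1%:R : R).
Local Notation energy_sum m := (\sum_(k < n) op_energy v z m k / op_pivot v z k).

Let N0 : 0 < N. Proof. by []. Qed.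
Let N1 : 1 <= N. Proof. by rewrite ler1n. Qed.
Let v0 : 0 < v. Proof. by rewrite invr_gt0. Qed.
Let z0 : z != 0. Proof. by rewrite -nsq_eq0 gt_eqF// (lt_trans _ z1). Qed.
Let L0 : 0 < L. Proof. exact: limit_overlap_gt0. Qed.
Let r0 : 0 < r. Proof. exact: lt_trans r1. Qed.

Let nv : n%:R * v <= 1.
Proof. by rewrite ler_pdivrMr// mul1r ler_nat. Qed.

Let N3_le (k : R) : 0 <= k -> k / N ^+ 3 <= k / N ^+ 2.
Proof.
move=> k0; rewrite ler_wpM2l// lef_pV2 ?posrE ?exprn_gt0//.
by rewrite exprS ler_peMl// exprn_ge0.
Qed.

Let N2_le (k : R) : 0 <= k -> k / N ^+ 2 <= k.
Proof. by move=> k0; rewrite ler_pdivrMr ?exprn_gt0// ler_peMr// exprn_ege1. Qed.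

(** The leading parts of the exponents are [s] times [mean_exponent], and cancel
    against the powers of [L] up to the factors [1 + eps] and [1 + eps / 2];
    the rest is bounded because [s ^+ 2 * v <= 1]. *)
Lemma tail_bound s : (s ^ 2 <= n.+1)%N ->
  (forall q : R, 1 < q -> (q ^+ s)^-1 <= decay_const q / N ^+ 3) ->
  L * (1 + eps / 2) <= expR (mean_exponent v z n) * (1 + eps) ->
  s%:R * v / dl <= 2^-1 ->
  expR (dl / r ^+ s * energy_sum s) - 1 +
  expR (s%:R * v * (1 + 2 * (s%:R * v) / dl) * energy_sum 0) / (L * (1 + eps)) ^+ s +
  expR (s%:R * v * (1 - 2 * (s%:R * v) / dl) * (energy_sum s / r ^+ s - energy_sum 0)) *
    (L / (1 + eps)) ^+ s <= tail_const / N ^+ 2.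
Proof.
move=> sN decay Lle sv.
set E := mean_exponent v z n in Lle.
have EE : v * energy_sum 0 = E by [].
set T := energy_sum s; set S := energy_sum 0 in EE *.
set Cr := decay_const r; have Cr0 : 0 < Cr by exact: decay_const_gt0.
have s2v : s%:R ^+ 2 * v <= 1 by rewrite ler_pdivrMr// mul1r -natrX ler_nat.
have sv0 : 0 <= s%:R * v by rewrite mulr_ge0// ltW.
have sv1 : s%:R * v <= 1.
  apply: le_trans s2v; rewrite ler_wpM2r ?(ltW v0)// -natrX ler_nat.
  by case: (s) => // k; rewrite expnS leq_pmulr ?expn_gt0.
have [TE EL] : T <= n%:R * (expR 1 * L) /\ expR E <= L.
  split.
    apply: le_trans (moment_trace_le v0 z1 s nv) _.
    rewrite ler_wpM2l// ler_wpM2r ?(ltW L0)//.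
    apply: (@le_trans _ _ (expR (s%:R * v) ^+ s)).
      by rewrite lerXn2r ?nnegrE ?expR_ge0 ?addr_ge0// expR_ge1Dx.
    by rewrite -expRM_natr ler_expR mulrC mulrA -expr2.
  apply: le_trans (mean_exponent_le v0 z1 nv) _.
  rewrite ler_wpM2l ?(ltW (lt_trans _ z1))// lef_pV2 ?posrE ?subr_gt0 ?lerB//.
  exact: le_lt_trans z1.
rewrite /tail_const -/Cr.
have l0 := L0; move: TE EL Lle l0; generalize L => l TE EL Lle l0.
set A := Cr * expR 1 * l.
have A0 : 0 < A by rewrite mulr_gt0// mulr_gt0// expR_gt0.
have ELe : E <= l by have := expR_ge1Dx E; move: EL; lra.
have rs0 : 0 < r ^+ s by rewrite exprn_gt0.
have TA : T / r ^+ s <= A / N ^+ 2.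
  apply: (@le_trans _ _ (N * (expR 1 * l) * (Cr / N ^+ 3))).
    apply: (@le_trans _ _ (N * (expR 1 * l) / r ^+ s)).
      rewrite ler_wpM2r ?invr_ge0 ?(ltW rs0)//; apply: le_trans TE _.
      by rewrite ler_wpM2r ?mulr_ge0 ?expR_ge0 ?(ltW l0)// ler_nat.
    by rewrite ler_wpM2l ?mulr_ge0 ?expR_ge0 ?(ltW l0)// decay.
  rewrite le_eqVlt; apply/orP; left; apply/eqP.
  by rewrite /A; set a := N; have : a != 0 by [rewrite gt_eqF]; clearbody a => a0; field.
clearbody A.
(* Mean value bound [exp y - 1 <= y exp y]. *)
have h1 : expR (dl / r ^+ s * T) - 1 <= dl * A * expR (dl * A) / N ^+ 2.
  pose y := dl * A / N ^+ 2.
  have yK : y <= dl * A by apply: N2_le; rewrite mulr_ge0 ?ltW.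
  have le : dl / r ^+ s * T <= y.
    by rewrite mulrAC -mulrA /y -mulrA ler_wpM2l ?(ltW dl0).
  apply: (@le_trans _ _ (y * expR y)).
    have := expR_ge1Dx (- y); rewrite expRN => ey.
    have : (1 - y) * expR y <= 1.
      by rewrite -[leRHS](mulVf (lt0r_neq0 (expR_gt0 y))) ler_wpM2r ?expR_ge0.
    have : expR (dl / r ^+ s * T) <= expR y by rewrite ler_expR.
    by rewrite mulrBl mul1r; lra.
  rewrite [leRHS]mulrAC -/y ler_wpM2l ?ler_expR//.
  by rewrite divr_ge0 ?mulr_ge0 ?exprn_ge0 ?(ltW dl0) ?(ltW A0).
have err : 2 * (s%:R * v) / dl * (s%:R * E) <= 2 * l / dl.
  rewrite (_ : _ * _ = 2 / dl * (s%:R ^+ 2 * v * E)); last by ring.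
  rewrite [leRHS]mulrAC ler_wpM2l ?divr_ge0 ?(ltW dl0)//.
  apply: (@le_trans _ _ (s%:R ^+ 2 * v * l)); last by rewrite ler_piMl// ltW.
  by rewrite ler_wpM2l// mulr_ge0 ?exprn_ge0 ?(ltW v0).
have h2 : expR (s%:R * v * (1 + 2 * (s%:R * v) / dl) * S) / (l * (1 + eps)) ^+ s <=
    expR (2 * l / dl) * decay_const (1 + eps) / N ^+ 2.
  rewrite (_ : s%:R * v * _ * S = E * s%:R + 2 * (s%:R * v) / dl * (s%:R * E)); last first.
    by rewrite -EE; ring.
  rewrite expRD expRM_natr exprMn invfM mulrACA.
  have Ls : expR E ^+ s / l ^+ s <= 1.
    by rewrite ler_pdivrMr ?exprn_gt0// mul1r lerXn2r ?nnegrE ?expR_ge0 ?(ltW l0).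
  have d0 := decay (1 + eps); rewrite ltrDl in d0.
  have c0 := @decay_const_gt0 (1 + eps); rewrite ltrDl in c0.
  apply: (@le_trans _ _ (1 * (expR (2 * l / dl) * (decay_const (1 + eps) / N ^+ 3)))).
    apply: ler_pM => //.
    - by rewrite mulr_ge0 ?exprn_ge0 ?expR_ge0 ?invr_ge0 ?exprn_ge0 ?(ltW l0).
    - by rewrite mulr_ge0 ?expR_ge0// invr_ge0 exprn_ge0// addr_ge0 ?(ltW eps0).
    - by apply: ler_pM; rewrite ?expR_ge0 ?ler_expR ?d0 ?invr_ge0 ?exprn_ge0// addr_ge0 ?(ltW eps0).
  by rewrite mul1r mulrA N3_le// mulr_ge0 ?expR_ge0// ltW// c0.
have k0 : 0 <= 1 - 2 * (s%:R * v) / dl.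
  by rewrite -(mulrA 2); move: sv; set a := _ / dl => sv; lra.
have k1 : s%:R * v * (1 - 2 * (s%:R * v) / dl) <= 1.
  apply: le_trans sv1; rewrite ler_piMr// gerBl divr_ge0 ?mulr_ge0 ?(ltW dl0)//.
have h3 : expR (s%:R * v * (1 - 2 * (s%:R * v) / dl) * (T / r ^+ s - S)) *
    (l / (1 + eps)) ^+ s <=
    expR (A + 2 * l / dl) * decay_const (1 + eps / 2) / N ^+ 2.
  have e2 : 1 < 1 + eps / 2 by rewrite ltrDl divr_gt0.
  have e1 : 0 < 1 + eps by rewrite addr_gt0.
  set kl := s%:R * v * _ in k1 *.
  have kl0 : 0 <= kl by rewrite mulr_ge0.
  have le : kl * (T / r ^+ s - S) <= (A + 2 * l / dl) + (- E) * s%:R.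
    have a1 : kl * (T / r ^+ s) <= A.
      have TA' : T / r ^+ s <= A by rewrite (le_trans TA)// N2_le// ltW.
      apply: (@le_trans _ _ (kl * A)); first by rewrite ler_wpM2l.
      by rewrite ler_piMl// ltW.
    have a2 : kl * S = s%:R * E - 2 * (s%:R * v) / dl * (s%:R * E).
      by rewrite /kl -EE; ring.
    by rewrite mulrBr a2 mulNr [E * _]mulrC opprB addrA lerD2r lerD.
  apply: (@le_trans _ _ (expR (A + 2 * l / dl) * expR (- E) ^+ s * (l / (1 + eps)) ^+ s)).
    by rewrite ler_wpM2r ?exprn_ge0 ?divr_ge0 ?(ltW l0) ?(ltW e1)// -expRM_natr -expRD ler_expR.
  rewrite -mulrA -exprMn -[leRHS]mulrA ler_wpM2l ?expR_ge0//.
  apply: le_trans (N3_le (ltW (decay_const_gt0 e2))); apply: le_trans (decay _ e2).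
  rewrite -exprVn lerXn2r ?nnegrE ?mulr_ge0 ?invr_ge0 ?expR_ge0 ?(ltW l0) ?(ltW e1) ?(ltW (lt_trans _ e2))//.
  rewrite -[leRHS]mul1r ler_pdivlMr ?(lt_trans _ e2)//.
  rewrite (_ : _ * _ * _ = l * (1 + eps / 2) / (expR E * (1 + eps))); last first.
    by rewrite expRN invfM; ring.
  by rewrite ler_pdivrMr ?mulr_gt0 ?expR_gt0// mul1r.
rewrite [leRHS]mulrDl [X in _ <= X + _]mulrDl; exact: lerD (lerD h1 h2) h3.
Qed.

End tail_probability.

(** * Deviation probabilities and the Borel-Cantelli lemma *)

Section borel_cantelli.
Context {R : realType} d (Omega : measurableType d) (P : probability Omega R).

(** Borel-Cantelli; [1 / (n + 1)^2] is compared with a telescoping series. *)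
Lemma ae_eventually_not (F : nat -> set Omega) (K : R) (n0 : nat) :
  (forall n, measurable (F n)) ->
  (forall n, (n0 <= n)%N -> (P (F n) <= (K / n.+1%:R ^+ 2)%:E)%E) ->
  {ae P, forall w, exists n1, forall n, (n1 <= n)%N -> ~ F n w}.
Proof.
move=> mF PF; pose F' n := F (n + n0)%N.
have K0 : 0 <= K.
  have := le_trans (measure_ge0 P _) (PF n0 (leqnn _)).
  by rewrite lee_fin pmulr_lge0// invr_gt0 exprn_gt0.
have PF' n : (P (F' n) <= (2 * K * (n.+1%:R^-1 - n.+2%:R^-1))%:E)%E.
  apply: le_trans (PF _ (leq_addl _ _)) _; rewrite lee_fin.
  have a0 : 0 < n.+1%:R :> R by [].
  apply: (@le_trans _ _ (K / n.+1%:R ^+ 2)).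
    by rewrite ler_wpM2l// lef_pV2 ?posrE ?exprn_gt0// lerXn2r ?nnegrE// ler_nat ltnS leq_addr.
  rewrite -[n.+2%:R]natr1 (mulrC 2) -[leRHS]mulrA ler_wpM2l//.
  set a := n.+1%:R in a0 *; have a1 : 1 <= a by rewrite ler1n.
  rewrite (_ : _ * _ = 2 / (a * (a + 1))); last first.
    by field; rewrite !gt_eqF// addr_gt0.
  rewrite -[leLHS]mul1r ler_pdivrMr ?exprn_gt0// mulrAC ler_pdivlMr ?mulr_gt0 ?addr_gt0//.
  by nra.
exists (lim_sup_set F'); split.
- apply: bigcap_measurable => // k _; apply: bigcup_measurable => j _; exact: mF.
- apply: lim_sup_set_cvg0 => [k|]; first exact: mF.
  apply: (@le_lt_trans _ _ (2 * K)%:E); last by rewrite ltry.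
  apply: lime_le; first by apply: is_cvg_nneseries => n _ _; exact: measure_ge0.
  apply: nearW => k.
  apply: (@le_trans _ _ (\sum_(0 <= n < k) (2 * K * (n.+1%:R^-1 - n.+2%:R^-1))%:E)%E).
    by apply: lee_sum => n _; exact: PF'.
  rewrite sumEFin lee_fin -mulr_sumr -[leRHS]mulr1 ler_wpM2l ?mulr_ge0//.
  rewrite (_ : \sum_(0 <= n < k) _ = 1 - k.+1%:R^-1).
    by rewrite gerBl invr_ge0.
  elim: k => [|k IH]; first by rewrite big_nil invr1 subrr.
  by rewrite big_nat_recr//= IH addrA subrK.
move=> w /= nw n _.
apply: contrapT => h; apply: nw; exists (n + n0)%N => m nm Fm.
apply: h; exists (m - n0)%N => /=; first by rewrite leq_subRL ?(leq_trans (leq_addl _ _) nm)// addnC.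
by rewrite /F' subnK// (leq_trans (leq_addl _ _) nm).
Qed.

End borel_cantelli.

Section deviation.
Context {R : realType} d (Omega : measurableType d) (P : probability Omega R).
Local Notation C := R[i].
Variables (n : nat) (z : C) (lam : {RV P >-> n.-tuple C})
  (T : 'I_n.+1 -> 'I_n.+1 -> {RV P >-> C}) (c : R).
Hypothesis law : has_law lam (fun A =>
  \int[tuple_measure (@complex_lebesgue R) n]_(t in A) (c * eigen_weight z t)%:E)%E.
Hypothesis lawT : forall i j : 'I_n.+1, (i < j)%N ->
  has_law (T i j) (complex_normal n.+1%:R^-1).
Hypothesis indep : schur_independent lam T.
Variables (dl r eps : R).
Hypotheses (z1 : 1 < nsq z) (dl0 : 0 < dl) (r1 : 1 < r) (eps0 : 0 < eps).
Hypothesis near_large : forall w, nsq (z - w) < dl -> r <= nsq w.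
Local Notation L := (limit_overlap z).
Local Notation v := (n.+1%:R^-1 : R).
Local Notation sep w := (separated z dl (lam w)).
Local Notation overlap w := (column_prod z lam T (fun x => 1 + x) w).
Hypothesis Lle : L * (1 + eps / 2) <= expR (mean_exponent v z n) * (1 + eps).
Hypothesis vle : v <= (dl / 2) ^+ 2.

Let z0 : z != 0. Proof. by rewrite -nsq_eq0 gt_eqF// (lt_trans _ z1). Qed.
Let L0 : 0 < L. Proof. exact: limit_overlap_gt0. Qed.
Let r0 : 0 < r. Proof. exact: lt_trans r1. Qed.

Definition deviation : set Omega :=
  [set w | ~~ ((L / (1 + eps) < overlap w) && (overlap w < L * (1 + eps)))].

Let moverlap : measurable_fun setT (fun w => overlap w).
Proof.
by apply: measurable_column_prod; apply: measurable_funD => //; exact: measurable_cst.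
Qed.

Lemma measurable_deviation : measurable deviation.
Proof.
apply: measurable_set_of_bool; apply: measurableT_comp => //.
apply: measurable_and; apply: measurable_fun_ltr => //; exact: measurable_cst.
Qed.

Lemma overlap_gt0 w : 0 < overlap w.
Proof.
rewrite /column_prod; set bs := [:: 1]; have : 0 < sqnorm (bs : seq C) by rewrite /sqnorm big_seq1 nsq1.
set ls := (lam w : seq _); set ts := [seq _ | _ <- _]; move: bs ls ts => bs ls ts b0.
elim: ls bs ts b0 => //= l ls IH bs ts b0.
by rewrite mulr_gt0 ?IH ?sqnorm_rcons_gt0// ltr_wpDr// divr_ge0 ?nsq_ge0// ltW.
Qed.

(** Markov's inequality for the sum of the three moments, each of which is
    at least [1] on one part of the deviation event. *)
Lemma deviation_le : (P deviation <= (tail_const z dl r eps / n.+1%:R ^+ 2)%:E)%E.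
Proof.
have [s [sN decay]] := @square_root_exponent R n.+1 isT.
have v0 : 0 < v by rewrite invr_gt0.
have sv : s%:R * v / dl <= 2^-1.
  have s2v : s%:R ^+ 2 * v <= 1 by rewrite ler_pdivrMr// mul1r -natrX ler_nat.
  rewrite ler_pdivrMr// [leRHS]mulrC -(@ler_pXn2r _ 2)// ?nnegrE ?mulr_ge0 ?(ltW dl0) ?(ltW v0)//.
  apply: le_trans vle; rewrite exprMn [v ^+ 2]expr2 mulrA -[leRHS]mul1r.
  by rewrite ler_wpM2r// ltW.
have mpow : measurable_fun setT (fun w => overlap w ^+ s) by exact: measurable_funX.
have msep : measurable_fun setT (fun w => sep w).
  by apply: measurableT_comp (measurable_separated z dl) _.
pose a := ((L * (1 + eps)) ^+ s)^-1; pose b := (L / (1 + eps)) ^+ s.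
have e1 : 0 < 1 + eps by rewrite addr_gt0.
have lo0 : 0 < L / (1 + eps) by exact: divr_gt0.
have hi0 : 0 < L * (1 + eps) by exact: mulr_gt0.
have a0 : 0 < a by rewrite invr_gt0 exprn_gt0// mulr_gt0.
have b0 : 0 < b by rewrite exprn_gt0// divr_gt0.
have O0 w : 0 < overlap w ^+ s by rewrite exprn_gt0// overlap_gt0.
have sep0 w : 0 <= sep w by exact: separated_ge0.
have sep1 w : sep w <= 1 by exact: separated_le1.
pose h1 w := 1 - sep w; pose h2 w := a * (sep w * overlap w ^+ s).
pose h3 w := b * (sep w / overlap w ^+ s).
have h10 w : 0 <= h1 w by rewrite subr_ge0.
have h20 w : 0 <= h2 w by rewrite mulr_ge0 ?mulr_ge0 ?(ltW a0) ?(ltW (O0 w)).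
have h30 w : 0 <= h3 w by rewrite mulr_ge0 ?divr_ge0 ?(ltW b0) ?(ltW (O0 w)).
have mh1 : measurable_fun setT h1 by apply: measurable_funB => //; exact: measurable_cst.
have m2 : measurable_fun setT (fun w => sep w * overlap w ^+ s) by exact: measurable_funM.
have m3 : measurable_fun setT (fun w => sep w / overlap w ^+ s).
  by apply: measurable_funM => //; exact: measurable_funrV.
have mh2 : measurable_fun setT h2 by apply: measurable_funM => //; exact: measurable_cst.
have mh3 : measurable_fun setT h3 by apply: measurable_funM => //; exact: measurable_cst.
have key : (P deviation <= \int[P]_w (h1 w)%:E + \int[P]_w (h2 w)%:E + \int[P]_w (h3 w)%:E)%E.
  rewrite -ge0_integralD//; last 4 first.
  - by move=> w _; rewrite lee_fin.
  - exact/measurable_EFinP.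
  - by move=> w _; rewrite lee_fin.
  - exact/measurable_EFinP.
  rewrite -ge0_integralD//; last 4 first.
  - by move=> w _; rewrite -EFinD lee_fin addr_ge0.
  - by apply: emeasurable_funD; exact/measurable_EFinP.
  - by move=> w _; rewrite lee_fin.
  - exact/measurable_EFinP.
  rewrite -[X in P X]setIT -integral_indic//; last exact: measurable_deviation.
  apply: ge0_le_integral => //.
  - apply/measurable_EFinP; apply: measurable_indic; exact: measurable_deviation.
  - by apply: emeasurable_funD; [apply: emeasurable_funD|]; exact/measurable_EFinP.
  move=> w _; rewrite -!EFinD lee_fin indicE.
  have [|_] := boolP (w \in deviation); last exact: addr_ge0 (addr_ge0 (h10 w) (h20 w)) (h30 w).
  rewrite inE /deviation/= negb_and -!leNgt => /orP[lo|hi].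
    have : 1 <= b / overlap w ^+ s.
      by rewrite ler_pdivlMr// mul1r /b lerXn2r// nnegrE ltW// overlap_gt0.
    move=> /(ler_wpM2l (sep0 w)); rewrite mulr1 mulrCA -/(h3 w) => le.
    by rewrite /= /h1; have := h20 w; move: le; lra.
  have : 1 <= a * overlap w ^+ s.
    by rewrite mulrC ler_pdivlMr ?exprn_gt0// mul1r lerXn2r// nnegrE ltW// overlap_gt0.
  move=> /(ler_wpM2l (sep0 w)); rewrite mulr1 mulrCA -/(h2 w) => le.
  by rewrite /= /h1; have := h30 w; move: le; lra.
apply: le_trans key _; rewrite /h1 /h2 /h3.
under [X in (_ + X + _)%E]eq_integral do rewrite EFinM.
under [X in (_ + _ + X)%E]eq_integral do rewrite EFinM.
rewrite (ge0_integralZl_EFin _ measurableT)//; last 3 first.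
- by move=> w _; rewrite lee_fin mulr_ge0// ltW.
- exact/measurable_EFinP.
- exact: ltW.
rewrite (ge0_integralZl_EFin _ measurableT)//; last 3 first.
- by move=> w _; rewrite lee_fin divr_ge0// ltW.
- exact/measurable_EFinP.
- exact: ltW.
have B := tail_bound z1 dl0 r1 eps0 sN decay Lle sv.
have I1 := unseparated_le z0 law dl0 r0 near_large s.
have I2 := overlap_upper_moment z0 law lawT indep dl0 sv.
have I3 := overlap_lower_moment z0 law lawT indep dl0 r0 near_large s sv.
apply: (@le_trans _ _ (_%:E)); last by rewrite lee_fin; exact: B.
rewrite !EFinD; apply: leeD; first apply: leeD.
- exact: I1.
- rewrite [X in (_ <= X%:E)%E]mulrC EFinM; apply: lee_wpmul2l; first by rewrite lee_fin ltW.
  exact: I2.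
- rewrite [X in (_ <= X%:E)%E]mulrC EFinM; apply: lee_wpmul2l; first by rewrite lee_fin ltW.
  exact: I3.
Qed.

End deviation.

(** * Almost sure convergence *)

Section limits.
Context {R : realType}.
Variable z : R[i].
Hypothesis z1 : 1 < nsq z.
Local Notation x := (nsq z).
Local Notation L := (limit_overlap z).

Let x0 : 0 < x. Proof. exact: lt_trans z1. Qed.

Lemma cvg_mean_exponent_bound :
  (fun n => (shifted_modulus (harmonic n) z + harmonic n) /
    (shifted_modulus (harmonic n) z + harmonic n - n%:R * harmonic n)) @ \oo --> L.
Proof.
have v0 := @cvg_harmonic R.
have yv : (fun n => shifted_modulus (harmonic n) z + harmonic n) @ \oo --> x.
  have lin : (fun n => L * harmonic n) @ \oo --> (0 : R).
    by rewrite -[X in _ --> X](mulr0 L); apply: cvgM => //; exact: cvg_cst.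
  have xl : (fun n => x + L * harmonic n) @ \oo --> x.
    by rewrite -[X in _ --> X]addr0; apply: cvgD => //; exact: cvg_cst.
  rewrite (_ : x = x * x / x + 0 + 0); last by rewrite mulfK ?gt_eqF// !addr0.
  apply: cvgD => //; apply: cvgD => //; apply: cvgM; last exact: cvg_cst.
  by rewrite (_ : (fun n => _) = fun n => (x + L * harmonic n) * (x + L * harmonic n));
    [exact: cvgM|apply/funext => n; rewrite expr2].
have nv : (fun n => n%:R * harmonic n) @ \oo --> (1 : R).
  rewrite (_ : (fun n => _) = fun n => 1 - harmonic n); last first.
    by apply/funext => n; rewrite /harmonic/= -[n.+1%:R]natr1; field; rewrite natr1.
  by rewrite -[X in _ --> X]subr0; apply: cvgB => //; exact: cvg_cst.
apply: cvgM => //; apply: cvgV; first by rewrite gt_eqF// subr_gt0.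
exact: cvgB.
Qed.

Lemma mean_exponent_eventually eps : 0 < eps -> exists n0, forall n, (n0 <= n)%N ->
  L * (1 + eps / 2) <= expR (mean_exponent n.+1%:R^-1 z n) * (1 + eps).
Proof.
move=> eps0; have e1 : 0 < 1 + eps by rewrite addr_gt0.
have L0 : 0 < L by exact: limit_overlap_gt0.
have lt : L * (1 + eps / 2) / (1 + eps) < L.
  by rewrite ltr_pdivrMr// ltr_pM2l// ltrD2l ltr_pdivrMr// ltr_pMr// ltr1n.
have [n0 _ h] := cvgr_gt _ cvg_mean_exponent_bound _ lt.
exists n0 => n /h /ltW; rewrite ler_pdivrMr// => /le_trans; apply.
rewrite ler_wpM2r ?(ltW e1)//; apply: mean_exponent_ge => //.
  by rewrite /harmonic/= invr_gt0.
by rewrite ler_pdivrMr// mul1r ler_nat.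
Qed.

Let rho1 : 1 < Normc.normc z.
Proof.
have n0 : 0 <= Normc.normc z by case: z => a b; exact: sqrtr_ge0.
by rewrite -(@ltr_pXn2r _ 2) ?nnegrE// expr1n -nsq_normc.
Qed.

Lemma nsq_gt_away (w : R[i]) :
  nsq (z - w) < ((Normc.normc z - 1) / 2) ^+ 2 ->
  ((Normc.normc z + 1) / 2) ^+ 2 <= nsq w.
Proof.
have nc0 (u : R[i]) : 0 <= Normc.normc u by case: u => a b; exact: sqrtr_ge0.
have nE (u : R[i]) : `|u| = (Normc.normc u)%:C by rewrite normc_def; case: u.
have tri : Normc.normc z <= Normc.normc (z - w) + Normc.normc w.
  by have := ler_normD (z - w) w; rewrite subrK !nE -raddfD lecR.
have r0 := rho1.
rewrite !nsq_normc ltr_pXn2r// ?nnegrE//; last by lra.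
by move=> h; rewrite lerXn2r ?nnegrE//; lra.
Qed.

End limits.

Theorem theorem2 (R : realType) (z : R[i]) (hz : 1 < `|z|)
    (d : measure_display) (Omega : measurableType d) (P : probability Omega R)
    (lam : forall n : nat, {RV P >-> n.-tuple R[i]})
    (G V W : forall n : nat, Omega -> 'M[R[i]]_n.+1)
    (hG : forall n : nat, conditioned_ginibre z (lam n) (G n))
    (hVW : forall n : nat, {ae P, forall w,
       uniq (z :: lam n w) ->
       biorthogonal_eigenvectors (G n w) [tuple of z :: lam n w]
         (V n w) (W n w)}) :
  {ae P, forall w,
    (fun n : nat => overlap (V n w) (W n w) ord0 ord0 : R[i]^o) @ \oo -->
      (`|z| ^+ 2 / (`|z| ^+ 2 - 1) : R[i]^o)}.
Proof.
have zE : `|z| ^+ 2 = (nsq z)%:C by rewrite nsq_norm.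
have rho0 : 0 <= Normc.normc z by case: (z) => a b; exact: sqrtr_ge0.
have rho1 : 1 < Normc.normc z.
  by move: hz; rewrite normc_def ltcE/= => /andP[_]; case: (z).
have z1 : 1 < nsq z by rewrite nsq_normc exprn_egt1.
have z0 : z != 0 by rewrite -nsq_eq0 gt_eqF// (lt_trans _ z1).
(* Half of the gap between [z] and the unit circle: points within this distance
   of [z] have modulus at least [(|z| + 1) / 2]. *)
pose dl := ((Normc.normc z - 1) / 2) ^+ 2; pose r := ((Normc.normc z + 1) / 2) ^+ 2.
have dl0 : 0 < dl by rewrite exprn_gt0// divr_gt0// subr_gt0.
have r1 : 1 < r by rewrite exprn_egt1// ltr_pdivlMr// mul1r; lra.
have away := @nsq_gt_away R z z1.
have L0 : 0 < limit_overlap z by exact: limit_overlap_gt0.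
pose T n := sval (cid (hG n).2).
have [lawT indep schur] : [/\
    forall n (i j : 'I_n.+1), (i < j)%N -> has_law (T n i j) (complex_normal n.+1%:R^-1),
    forall n, schur_independent (lam n) (T n)
  & forall n, {ae P, forall w, exists2 U : 'M[R[i]]_n.+1, U \is unitarymx &
      G n w = U *m schur_mx z (lam n w) (fun i j => T n i j w) *m (map_mx Num.conj U^T)}].
  by split=> n; rewrite /T; case: cid => ? [].
pose O n w := column_prod z (lam n) (T n) (fun x => 1 + x) w.
have identified n : {ae P, forall w, overlap (V n w) (W n w) ord0 ord0 = (O n w)%:C}.
  have [c law] := (hG n).1.
  apply: filterS3 (schur n) (hVW n) (law_distinct law) => w [U Uu GE] biorth uz.
  rewrite (overlap_schur Uu GE uz (biorth uz)) sqnorm_left_vec /sqnorm big_seq1 nsq1//.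
  by rewrite mul1r.
have concentrated q : {ae P, forall w, exists n1, forall n, (n1 <= n)%N ->
    ~ deviation z (lam n) (T n) q.+1%:R^-1 w}.
  have eps0 : 0 < q.+1%:R^-1 :> R by rewrite invr_gt0.
  have [n1 hn1] := mean_exponent_eventually z1 eps0.
  have [n2 _ hn2] : \forall n \near \oo, harmonic n < (dl / 2) ^+ 2.
    by apply: cvgr_lt; [exact: cvg_harmonic|rewrite exprn_gt0// divr_gt0].
  apply: (@ae_eventually_not _ _ _ _ _ (tail_const z dl r q.+1%:R^-1) (maxn n1 n2)).
    by move=> n; exact: measurable_deviation.
  move=> n; rewrite geq_max => /andP[/hn1 h1 /hn2 /ltW h2].
  have [c law] := (hG n).1.
  exact: (deviation_le law (@lawT n) (@indep n) z1 dl0 r1 eps0 away h1 h2).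
apply: filterS2 (ae_foralln identified) (ae_foralln concentrated) => w idw devw.
rewrite (_ : (fun n => _) = fun n => (O n w)%:C : R[i]^o); last by apply/funext => n; rewrite idw.
rewrite (_ : _ / _ = (limit_overlap z)%:C); last first.
  by rewrite zE /limit_overlap rmorphM fmorphV rmorphB rmorph1.
apply/cvgrPdist_lt => e e0.
have [eE e0'] : e = (complex.Re e)%:C /\ 0 < complex.Re e.
  by move: e0; case: e => a b; rewrite ltcE/= => /andP[/eqP -> ?].
set e' := complex.Re e in eE e0' *.
have [q _ /(_ q (leqnn q)) hq] : \forall n \near \oo, harmonic n < e' / limit_overlap z.
  by apply: cvgr_lt; [exact: cvg_harmonic|rewrite divr_gt0].
have [n1 hn1] := devw q; exists n1 => // n /hn1.
rewrite /deviation/= -[column_prod _ _ _ _ _]/(O n w) => /negP; rewrite negbK => /andP[lo hi].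
rewrite /harmonic/= ltr_pdivlMr// mulrC in hq.
rewrite eE -raddfB normc_def/= expr0n addr0 sqrtr_sqr ltcR ltr_norml.
have eps0 : 0 < q.+1%:R^-1 :> R by rewrite invr_gt0.
set eps := q.+1%:R^-1 in eps0 lo hi hq.
have lo' : limit_overlap z * (1 - eps) <= limit_overlap z / (1 + eps).
  rewrite ler_pdivlMr ?addr_gt0// -mulrA -[leRHS]mulr1 ler_wpM2l ?(ltW L0)//.
  by have : 0 <= eps ^+ 2 by [exact: sqr_ge0]; lra.
rewrite mulrBr mulr1 in lo'; rewrite mulrDr mulr1 in hi.
have close (a b o t : R) : a - b < o -> o < a + b -> b < t -> - t < a - o < t.
  by move=> *; apply/andP; split; lra.
exact: close (le_lt_trans lo' lo) hi hq.
Qed.
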